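(* For any $\mu$ and any model $(M,R)\models T_{H,\mu}$, $(M,R)$ is a strongly minimal uniform Steiner triple system. In fact, the algebraic closure of any pair of distinct points $a,b$ is the line $\{a,b,c\}$ through $a,b$ (where $c$ is the third point on that line), and so each cycle is infinite.
   Context: The structures are $\{R\}$-structures, $R$ ternary, with $R$ holding only of distinct triples and invariant under permutations. For finite $A$ let $\delta_H(A)=|A|-r(A)$, where $r(A)$ is the number of 3-element subsets of $A$ satisfying $R$; $\delta_H(C/A)=\delta_H(A\cup C)-\delta_H(A)$. $A\leq B$ (''strong'') means $A\subseteq B$ and $\delta_H(C)\ge\delta_H(A)$ for all $A\subseteq C\subseteq B$. $\mathbf K^H_0$ is the class of finite structures $A$ such that every $B\subseteq A$ with $|B|\le3$ satisfies $B\leq A$. (It follows that 2 points lie on at most one triple in $R$; $R$ is interpreted as collinearity.) For disjoint $B,C$ with $C\ne\emptyset$ and $B\cup C\in\mathbf K^H_0$, $C$ is 0-primitive over $B$ if $B\leq B\cup C$, $\delta_H(C/B)=0$ and no $D$ satisfies $B\subsetneq D\subsetneq B\cup C$, $B\leq D\leq B\cup C$; $(B,C)$ is a good pair if moreover $C$ is not 0-primitive over any proper subset of $B$. Here $\mu$ is any function assigning to each isomorphism type of good pair $(B,C)$ a natural number $\mu(B,C)\ge\delta_H(B)$. $\mathbf K_{H,\mu}$ is the class of $A\in\mathbf K^H_0$ such that for each good pair $(B,C)$ with $B\subseteq A$ the maximal number of pairwise disjoint copies of $C$ over $B$ in $A$ is at most $\mu(B,C)$. $T_{H,\mu}$ is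 the theory of the generic of $(\mathbf K_{H,\mu},\leq)$: the unique countable union $\mathcal G$ of a $\leq$-chain of members of the class such that whenever $B\leq C$ are in the class and $B\leq\mathcal G$, there is an embedding of $C$ over $B$ onto a strong substructure of $\mathcal G$. A Steiner triple system is such a structure in which any two distinct points lie on exactly one triple in $R$; for $x\ne y$, $x*y$ is the third point on the line through $x,y$. For $a\ne b$ in $M$, $\mathrm{icl}_M(a,b)$ is the smallest strong subset of $M$ containing $a,b$; $G_M(a,b)$ is the graph with vertex set $M-\mathrm{icl}_M(a,b)$ in which $x,y$ are joined by an edge coloured $a$ (resp. $b$) iff $R(a,x,y)$ (resp. $R(b,x,y)$). $M$ is uniform if $G_M(a,b)\cong G_M(a',b')$ for all pairs $a\ne b$, $a'\ne b'$. A cycle is a path $d_1,\ d_2=a*d_1,\ d_3=b*d_2,\ d_4=a*d_3,\dots$ generated by a point $d_1$ not on the line through $a,b$; it is infinite if it never returns to an earlier point. *)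

(* Defs.v *)
From HB Require Import structures.
From mathcomp Require Import all_boot all_order all_algebra.
From mathcomp Require Import finmap.
From mathcomp Require Import boolp classical_sets functions cardinality.

Set Implicit Arguments.
Unset Strict Implicit.
Unset Printing Implicit Defensive.

Import Order.TTheory GRing.Theory Num.Theory.

Local Open Scope fset_scope.
Local Open Scope classical_set_scope.
Local Open Scope ring_scope.

(* R is boolean and the carrier a choiceType; in the ambient classical logic
   this is no restriction on the structures considered. *)
Record hstruct := HStruct {
  hcarrier :> choiceType;
  hR : hcarrier -> hcarrier -> hcarrier -> bool;
  hR_distinct : forall x y z, hR x y z -> [/\ x != y, x != z & y != z];
  hR_swap12 : forall x y z, hR x y z = hR y x z;
  hR_swap23 : forall x y z, hR x y z = hR x z y
}.

(* A finite structure is a finite subset A of some structure M, taken with the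
   induced relation. *)

Definition is_triple (M : hstruct) (S : {fset M}) : bool :=
  (#|` S| == 3)%N &&
  [exists x : S, exists y : S, exists z : S, hR (val x) (val y) (val z)].

Definition r (M : hstruct) (A : {fset M}) : nat :=
  #|` [fset S in fpowerset A | is_triple S]|.

Definition delta (M : hstruct) (A : {fset M}) : int :=
  (#|` A|)%:Z - (r A)%:Z.

Definition delta_rel (M : hstruct) (C A : {fset M}) : int :=
  delta (A `|` C)%fset - delta A.

Definition strong (M : hstruct) (A B : {fset M}) : Prop :=
  (A `<=` B)%fset /\
  forall C : {fset M}, (A `<=` C)%fset -> (C `<=` B)%fset -> delta A <= delta C.

(* A <= M for a finite subset A of a possibly infinite structure M. *)
Definition strong_in (M : hstruct) (A : {fset M}) : Prop :=
  forall C : {fset M}, (A `<=` C)%fset -> delta A <= delta C.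

Definition K0 (M : hstruct) (A : {fset M}) : Prop :=
  forall B : {fset M}, (B `<=` A)%fset -> (#|` B| <= 3)%N -> strong B A.

(* f restricts to an embedding of the finite structure A into N. *)
Definition embedding_on (M N : hstruct) (A : {fset M}) (f : M -> N) : Prop :=
  {in A &, injective f} /\
  {in A & &, forall x y z, hR (f x) (f y) (f z) = hR x y z}.

Definition primitive0 (M : hstruct) (B C : {fset M}) : Prop :=
  [/\ C != fset0, [disjoint B & C]%fset & K0 (B `|` C)%fset] /\
  [/\ strong B (B `|` C)%fset,
      delta_rel C B = 0 &
      ~ exists D : {fset M},
          [/\ (B `<` D)%fset, (D `<` B `|` C)%fset,
              strong B D & strong D (B `|` C)%fset]].

Definition good_pair (M : hstruct) (B C : {fset M}) : Prop :=
  primitive0 B C /\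
  forall B' : {fset M}, (B' `<` B)%fset -> ~ primitive0 B' C.

Definition pair_iso (M N : hstruct) (B C : {fset M}) (B' C' : {fset N}) : Prop :=
  exists f : M -> N,
    [/\ embedding_on (B `|` C)%fset f,
        [fset f x | x in B]%fset = B' & [fset f x | x in C]%fset = C'].

(* A function on isomorphism types of good pairs is a function on good pairs
   that is invariant under isomorphism; its values at other pairs are
   never used. *)
Record mu_function := MuFunction {
  mu_val :> forall M : hstruct, {fset M} -> {fset M} -> nat;
  mu_iso : forall (M N : hstruct) (B C : {fset M}) (B' C' : {fset N}),
    good_pair B C -> good_pair B' C' -> pair_iso B C B' C' ->
    mu_val B C = mu_val B' C';
  mu_ge : forall (M : hstruct) (B C : {fset M}),
    good_pair B C -> delta B <= (mu_val B C)%:Z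
}.

Definition copy_over (M : hstruct) (B C C' : {fset M}) : Prop :=
  exists f : M -> M,
    [/\ embedding_on (B `|` C)%fset f,
        {in B, forall x, f x = x} & [fset f x | x in C]%fset = C'].

(* It is enough to consider C inside the ambient M: if A contains any copy of
   some C over B, that copy is itself a C of the same isomorphism type. *)
Definition Kmu (mu : mu_function) (M : hstruct) (A : {fset M}) : Prop :=
  K0 A /\
  forall B C : {fset M}, good_pair B C -> (B `<=` A)%fset ->
  forall F : {fset {fset M}},
    (forall C', C' \in F -> (C' `<=` A)%fset /\ copy_over B C C') ->
    {in F &, forall C1 C2, C1 != C2 -> [disjoint C1 & C2]%fset} ->
    (#|` F| <= mu M B C)%N.

(* In the extension property, h presents C as an extension of B. *)
Definition is_generic (mu : mu_function) (G : hstruct) : Prop :=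
  (exists A : nat -> {fset G},
     [/\ forall n, Kmu mu (A n),
         forall n, strong (A n) (A n.+1) &
         forall x : G, exists n, x \in A n]) /\
  forall (B : {fset G}) (N : hstruct) (C : {fset N}) (h : G -> N),
    Kmu mu B -> Kmu mu C -> embedding_on B h ->
    strong [fset h x | x in B]%fset C -> strong_in B ->
    exists g : N -> G,
      [/\ embedding_on C g, {in B, forall x, g (h x) = x} &
          strong_in [fset g y | y in C]%fset].

(* [formula n] has its free variables among n de Bruijn indices; the connectives
   and quantifiers not listed are classically definable from these. *)
Inductive formula : nat -> Type :=
| FEq n : 'I_n -> 'I_n -> formula n
| FRel n : 'I_n -> 'I_n -> 'I_n -> formula n
| FBot n : formula n
| FImp n : formula n -> formula n -> formula n
| FAll n : formula n.+1 -> formula n.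

Definition vcons (T : Type) (n : nat) (x : T) (v : 'I_n -> T) : 'I_n.+1 -> T :=
  fun i => oapp v x (unlift ord0 i).

Fixpoint sat (M : hstruct) (n : nat) (phi : formula n) : ('I_n -> M) -> Prop :=
  match phi in formula k return ('I_k -> M) -> Prop with
  | FEq _ i j => fun v => v i = v j
  | FRel _ i j k => fun v => hR (v i) (v j) (v k)
  | FBot _ => fun _ => False
  | FImp _ p q => fun v => sat p v -> sat q v
  | FAll _ p => fun v => forall x : M, sat p (vcons x v)
  end.

Definition sentence := formula 0.

(* There is exactly one valuation of the empty set of variables. *)
Definition holds (M : hstruct) (phi : sentence) : Prop :=
  forall v : 'I_0 -> M, sat phi v.

Definition theory (M : hstruct) : set sentence := [set phi | holds M phi].

Definition models (M : hstruct) (T : set sentence) : Prop :=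
  forall phi, T phi -> holds M phi.

Definition elem_equiv (M N : hstruct) : Prop := theory M = theory N.

(* The subset defined by phi with parameters v. *)
Definition solutions (M : hstruct) (n : nat) (phi : formula n.+1)
    (v : 'I_n -> M) : set M :=
  [set x | sat phi (vcons x v)].

Definition strongly_minimal (M : hstruct) : Prop :=
  infinite_set [set: M] /\
  forall N : hstruct, elem_equiv N M ->
  forall (n : nat) (phi : formula n.+1) (v : 'I_n -> N),
    finite_set (solutions phi v) \/ finite_set (~` solutions phi v).

Definition acl (M : hstruct) (X : set M) : set M :=
  [set x | exists (n : nat) (phi : formula n.+1) (v : 'I_n -> M),
     [/\ forall i, X (v i), finite_set (solutions phi v) & solutions phi v x]].

Definition steiner (M : hstruct) : Prop :=
  forall x y : M, x != y -> exists! z, hR x y z.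

(* x * y; the value x is a dummy when x, y lie on no triple. *)
Definition star (M : hstruct) (x y : M) : M :=
  if pselect (exists z, hR x y z) is left zP then xchoose zP else x.

Definition line (M : hstruct) (a b : M) : set M := [set a; b; star a b].

(* The finite strong subsets are closed under intersection, so the intersection
   taken by [smallest] is itself the smallest one containing a and b. *)
Definition icl (M : hstruct) (a b : M) : set M :=
  smallest [set X : set M | exists2 S : {fset M}, X = [set` S] & strong_in S]
           [set a; b].

Record bicolored_graph (V : Type) := BicoloredGraph {
  vertices : set V;
  edge1 : V -> V -> Prop;
  edge2 : V -> V -> Prop
}.

Definition graph_iso (V W : Type) (G : bicolored_graph V) (H : bicolored_graph W)
    : Prop :=
  exists f : V -> W, set_bij (vertices G) (vertices H) f /\
    forall x y, vertices G x -> vertices G y ->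
      (edge1 G x y <-> edge1 H (f x) (f y)) /\
      (edge2 G x y <-> edge2 H (f x) (f y)).

(* The first colour is the one of a, the second the one of b. *)
Definition path_graph (M : hstruct) (a b : M) : bicolored_graph M :=
  {| vertices := ~` icl a b;
     edge1 := fun x y => hR a x y;
     edge2 := fun x y => hR b x y |}.

Definition uniform (M : hstruct) : Prop :=
  forall a b a' b' : M, a != b -> a' != b' ->
    graph_iso (path_graph a b) (path_graph a' b').

(* The sequence d, a * d, b * (a * d), a * (b * (a * d)), ... indexed from 0. *)
Fixpoint cycle_point (M : hstruct) (a b d : M) (n : nat) : M :=
  if n is n'.+1 then star (if odd n' then b else a) (cycle_point a b d n')
  else d.

Definition infinite_cycle (M : hstruct) (a b d : M) : Prop :=
  forall i j : nat, (i < j)%N -> cycle_point a b d j != cycle_point a b d i.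

(* Main.v *)
Require Import Defs.
From HB Require Import structures.
From mathcomp Require Import all_boot all_order all_algebra.
From mathcomp Require Import finmap zify.
From mathcomp Require Import boolp classical_sets functions cardinality.

(* In K0 every set of at least four points has predimension at least 3, so a
   non-collinear triple of points is strong in any structure all of whose finite
   subsets lie in K0. A cycle that closes up, together with the two base points,
   would have predimension at most 2: this makes all cycles infinite.

   Saturation is avoided by working inside the generic G with "n-strong" sets,
   tested against at most n extra points. Free amalgamation over an n-strong
   base stays in K_mu unless the extension already has a copy there; hence
   partial isomorphisms between sufficiently strong sets extend, and the degree
   of strength needed to preserve a formula depends only on the formula and the
   number of parameters. As mu bounds the number of points in small extensions
   of relative dimension 0, each formula defines a set that is finite or cofinite
   with a bound independent of the parameters; such statements are first order
   and pass to every model. Non-collinear points over a, b are conjugate and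
   infinite in number, which gives acl(a, b).

   For uniformity, the path graph of a, b is an isolated point and a family of
   two-way infinite paths. There are infinitely many paths because finitely many
   would carry only lines through a or b outside a finite strong set, and then
   their number is the cardinality of M. *)

(** The obstacle is that [strong_in] quantifies over finite sets of every size, while the truth of
    one formula has to be controlled by bounded data. An n-strong set is tested on n points only,
    and each operation has a price: adding a set C of relative dimension at most 0 costs |C| units,
    and amalgamation needs at least 3 units, because a set violating K0 in the amalgam meets the old
    side in at most three points.

    The inequality mu >= delta B serves families of copies whose base is not contained in the old
    side: each member meeting that side uses up one unit of delta B. It also admits the third point
    of a line, so that any two points of G are on a line.

    A strong hull has no size bound that is uniform in the parameters. Parameters are therefore
    closed only up to a strength that itself depends on the size of the closure. This terminates
    because every failure of strength lowers the predimension, which is never negative. *)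

Set Implicit Arguments.
Unset Strict Implicit.
Unset Printing Implicit Defensive.

Import Order.TTheory GRing.Theory Num.Theory.

Local Open Scope fset_scope.
Local Open Scope ring_scope.

(** * Predimension *)

(* Works pointwise, using the inclusions and disjointness facts in the context. *)
Ltac fset_hyps x :=
  repeat match goal with
  | H : is_true (fsubset ?A ?B) |- _ =>
      generalize (introT implyP (fsubsetP H x)); clear H
  | H : is_true (fproper ?A ?B) |- _ =>
      generalize (introT implyP (fsubsetP (fproper_sub H) x)); clear H
  | H : is_true (fdisjoint ?A ?B) |- _ =>
      generalize (introT implyP (fdisjointP H x)); clear H
  end.

Ltac fset_cases :=
  rewrite ?inE /=; do ?[case: (_ \in _) => //=]; do ?[case: (_ == _) => //=].

Ltac fset_point lem :=
  apply/lem; let x := fresh "x" in intro x; fset_hyps x; fset_cases.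

Ltac fset_tac :=
  first [ fset_point fsubsetP | fset_point fdisjointP | fset_point fsetP ].

Lemma cardfs3 (T : choiceType) (x y z : T) : x != y -> x != z -> y != z ->
  #|` [fset x; y; z]| = 3%N.
Proof.
move=> xy xz yz; rewrite fsetUC cardfsU1 cardfs2 xy !inE.
by rewrite (eq_sym z x) (negbTE xz) (eq_sym z y) (negbTE yz).
Qed.

Section Delta.
Variable M : hstruct.
Implicit Types (A B C D S X Y Z U V : {fset M}).

Definition triples A : {fset {fset M}} := [fset S in fpowerset A | is_triple S].

Lemma in_triples A S : (S \in triples A) = (S `<=` A) && is_triple S.
Proof. by rewrite !inE fpowersetE. Qed.

Lemma rE A : r A = #|` triples A|. Proof. by []. Qed.

Definition crossing U V : {fset {fset M}} :=
  [fset S in triples (U `|` V) | ~~ (S `<=` U) && ~~ (S `<=` V)].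

Lemma in_crossing U V S : (S \in crossing U V) =
  [&& S `<=` U `|` V, is_triple S, ~~ (S `<=` U) & ~~ (S `<=` V)].
Proof. by rewrite 2!inE in_triples -!andbA. Qed.

(** Inclusion-exclusion for points and for triples. The triples inside both sets are those of the
    intersection, so the crossing triples are the only defect of modularity. *)
Lemma delta_modular U V :
  delta U + delta V =
  delta (U `|` V) + delta (U `&` V) + #|` crossing U V|%:Z.
Proof.
rewrite /delta !rE.
have e1 := cardfsUI U V.
have e2 := cardfsUI (triples U) (triples V).
have e3 := cardfsID (crossing U V) (triples (U `|` V)).
have e4 : triples U `&` triples V = triples (U `&` V).
  apply/fsetP=> S; rewrite in_fsetI !in_triples fsubsetI.
  by case: (S `<=` U); case: (S `<=` V); case: (is_triple S).
have e5 : triples (U `|` V) `&` crossing U V = crossing U V.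
  apply/fsetP=> S; rewrite in_fsetI [in RHS]in_crossing [X in X && _]in_triples [X in _ && X]in_crossing.
  by case: (S `<=` _); case: (is_triple S).
have e6 : triples (U `|` V) `\` crossing U V = triples U `|` triples V.
  apply/fsetP=> S; rewrite in_fsetD in_crossing in_fsetU !in_triples.
  case: (is_triple S); rewrite ?andbF ?andbT //.
  case SU: (S `<=` U); first by rewrite (fsubset_trans SU (fsubsetUl _ _)) andbF.
  case SV: (S `<=` V); first by rewrite (fsubset_trans SV (fsubsetUr _ _)) andbF.
  by case: (S `<=` _).
rewrite e4 in e2; rewrite e5 e6 in e3.
lia.
Qed.

Lemma delta_submod U V : delta (U `|` V) + delta (U `&` V) <= delta U + delta V.
Proof. by have := delta_modular U V; lia. Qed.

Lemma delta_submod_strict U V S : is_triple S -> S `<=` U `|` V ->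
  ~~ (S `<=` U) -> ~~ (S `<=` V) ->
  delta (U `|` V) + delta (U `&` V) < delta U + delta V.
Proof.
move=> tS SUV SU SV; have : (0 < #|` crossing U V|)%N.
  rewrite cardfs_gt0; apply/fset0Pn; exists S.
  by rewrite in_crossing SUV tS SU SV.
by have := delta_modular U V; lia.
Qed.

Lemma delta_free U V :
  (forall S, is_triple S -> S `<=` U `|` V -> (S `<=` U) || (S `<=` V)) ->
  delta (U `|` V) + delta (U `&` V) = delta U + delta V.
Proof.
move=> free; have -> : delta U + delta V = delta (U `|` V) + delta (U `&` V) +
   #|` crossing U V|%:Z by exact: delta_modular.
suff -> : crossing U V = fset0 by rewrite cardfs0; lia.
apply/eqP; rewrite -[_ == _]negbK; apply/negP => /fset0Pn[S].
rewrite in_crossing => /and4P[SUV tS].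
by case/orP: (free _ tS SUV) => ->.
Qed.

(* Enlarging the base decreases relative dimension. *)
Lemma delta_rel_anti A B X : A `<=` B ->
  delta (B `|` X) - delta B <= delta (A `|` X) - delta (A `|` (X `&` B)).
Proof.
move=> AB; have := delta_submod B (A `|` X).
have -> : B `|` (A `|` X) = B `|` X by fset_tac.
have -> : B `&` (A `|` X) = A `|` (X `&` B) by fset_tac.
lia.
Qed.

Lemma delta_rel_anti_disj A B X : A `<=` B -> [disjoint X & B] ->
  delta (B `|` X) - delta B <= delta (A `|` X) - delta A.
Proof.
move=> AB dX; have := delta_rel_anti X AB.
have -> : A `|` (X `&` B) = A by fset_tac.
by [].
Qed.

Lemma is_tripleP S :
  reflect (exists x y z, hR x y z /\ S = [fset x; y; z]) (is_triple S).
Proof.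
apply: (iffP idP) => [/andP[/eqP c /existsP[x /existsP[y /existsP[z Rxyz]]]]|].
  exists (val x), (val y), (val z); split => //.
  apply/esym/eqP; rewrite eqEfcard c; apply/andP; split.
    by rewrite !fsubUset !fsub1set !fsvalP.
  have [xy xz yz] := hR_distinct Rxyz.
  by rewrite cardfs3.
move=> [x [y [z [Rxyz ->]]]]; apply/andP; split.
  have [xy xz yz] := hR_distinct Rxyz.
  by rewrite cardfs3.
have hx : x \in [fset x; y; z] by rewrite !inE eqxx.
have hy : y \in [fset x; y; z] by rewrite !inE eqxx orbT.
have hz : z \in [fset x; y; z] by rewrite !inE eqxx orbT.
apply/existsP; exists [` hx]; apply/existsP; exists [` hy].
by apply/existsP; exists [` hz].
Qed.

Lemma triple_card S : is_triple S -> #|` S| = 3%N.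
Proof. by case/andP => /eqP. Qed.

Lemma r_small A : (#|` A| <= 2)%N -> r A = 0%N.
Proof.
move=> c; rewrite rE; apply/eqP; rewrite cardfs_eq0; apply/eqP/fsetP=> S.
rewrite in_triples in_fset0; apply/negP => /andP[/fsubset_leq_card SA /triple_card].
lia.
Qed.

Lemma delta_small A : (#|` A| <= 2)%N -> delta A = #|` A|%:Z.
Proof. by move=> c; rewrite /delta r_small //; lia. Qed.

Lemma delta0 : delta (fset0 : {fset M}) = 0.
Proof. by rewrite delta_small ?cardfs0. Qed.

Lemma r3 A : #|` A| = 3%N -> r A = is_triple A.
Proof.
move=> c; rewrite rE.
have -> : triples A = if is_triple A then [fset A] else fset0.
  apply/fsetP=> S; rewrite in_triples; apply/andP/idP => [[SA tS]|].
    have e : S = A by apply/eqP; rewrite eqEfcard SA c (triple_card tS).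
    by rewrite -e tS inE.
  by case: ifP => [tA|]; rewrite ?inE // => /eqP ->; rewrite fsubset_refl.
by case: ifP; rewrite ?cardfs0 ?cardfs1.
Qed.

Lemma delta3 A : #|` A| = 3%N -> delta A = 3 - (is_triple A : nat)%:Z.
Proof. by move=> c; rewrite /delta r3 // c. Qed.

Lemma delta_le_card A : delta A <= #|` A|%:Z.
Proof. rewrite /delta; lia. Qed.

Lemma deltaU1 A x : delta (x |` A) <= delta A + 1.
Proof.
have := delta_submod [fset x] A; rewrite (@delta_small [fset x]) ?cardfs1 //.
case xA: (x \in A).
  have -> : [fset x] `|` A = A by apply/fsetUidPr; rewrite fsub1set.
  by lia.
have -> : [fset x] `&` A = fset0.
  by apply/fsetP=> y; rewrite !inE; case: eqP => // ->; rewrite xA.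
by rewrite delta0; lia.
Qed.

(** The new point costs 1, and the line through y and z pays for it. *)
Lemma delta_addpt A x y z : x \notin A -> y \in A -> z \in A -> hR x y z ->
  delta (x |` A) <= delta A.
Proof.
move=> xA yA zA R.
have t : is_triple [fset x; y; z] by apply/is_tripleP; exists x, y, z.
have := @delta_submod_strict [fset x] A _ t.
rewrite (@delta_small [fset x]) ?cardfs1 //.
have -> : [fset x] `&` A = fset0.
  by apply/fsetP=> w; rewrite !inE; case: eqP => // ->; rewrite (negbTE xA).
rewrite delta0 !fsubUset !fsub1set !inE (negbTE xA) yA zA !eqxx !orbT /=.
have [xy _ _] := hR_distinct R.
rewrite eq_sym (negbTE xy) /= => /(_ isT isT isT); lia.
Qed.

End Delta.

(** * The class K0 and good pairs *)

Lemma fsubset_of_card (T : choiceType) (A : {fset T}) k : (k <= #|` A|)%N ->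
  exists2 Z : {fset T}, Z `<=` A & #|` Z| = k.
Proof.
move=> kA; exists [fset x in take k A].
  by apply/fsubsetP => x; rewrite !inE => /mem_take.
by rewrite card_fseq undup_id ?take_uniq ?fset_uniq // size_takel.
Qed.

Lemma min_fset (T : choiceType) (P : {fset T} -> Prop) (A : {fset T}) : P A ->
  exists B, [/\ B `<=` A, P B & forall C, C `<` B -> ~ P C].
Proof.
have [n] := ubnP #|` A|; elim: n A => // n IH A cA PA.
have [[C [CA PC]]|noC] := pselect (exists C, C `<` A /\ P C).
  have cC := fproper_ltn_card CA.
  have [|B [BC PB minB]] := IH C _ PC; first by lia.
  by exists B; split => //; apply: fsubset_trans BC (fproper_sub CA).
by exists A; split=> // C CA PC; apply: noC; exists C.
Qed.

Section K0.
Variable M : hstruct.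
Implicit Types (A B C D S X Y Z U V : {fset M}).

Lemma K0_sub A B : A `<=` B -> K0 B -> K0 A.
Proof.
move=> AB KB C CA cC; split => // D CD DA.
by have [_] := KB C (fsubset_trans CA AB) cC; apply => //; apply: fsubset_trans DA AB.
Qed.

(** The bound 3 is the predimension of a non-collinear triple, and four points always contain one.
    This single inequality replaces the strength conditions of [K0] from here on. *)
Lemma K0P A :
  K0 A <-> forall Y, Y `<=` A -> (4 <= #|` Y|)%N -> 3 <= delta Y.
Proof.
split=> [KA Y YA cY|H B BA cB].
  have [Z ZY cZ] := fsubset_of_card cY.
  have Z0 : (0 < #|` Z|)%N by rewrite cZ.
  (* If all four 3-subsets of Z were triples, delta Z would be at most 0, below the value 1 of a
     single point, which is strong. *)
  have [T [TZ cT tT]] : exists T, [/\ T `<=` Z, #|` T| = 3%N & ~~ is_triple T].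
    apply/not_existsP => noT.
    have sub : [fset Z `\ w | w in Z] `<=` triples Z.
      apply/fsubsetP => S /imfsetP[w /= wZ ->]; rewrite in_triples.
      have ZwZ : Z `\ w `<=` Z by fset_tac.
      rewrite ZwZ /=; apply/negPn/negP => nt; apply: (noT (Z `\ w)); split=> //.
      by have := cardfsD1 w Z; rewrite wZ cZ; lia.
    have c : (4 <= r Z)%N.
      apply: leq_trans (fsubset_leq_card sub); rewrite card_in_imfset /= ?cZ //.
      move=> v w vZ wZ /fsetP/(_ w); rewrite !inE eqxx wZ andbT /= => /negbT.
      by rewrite negbK => /eqP.
    have /fset0Pn[w wZ] : Z != fset0 by rewrite -cardfs_gt0.
    have [//||_ ] := KA [fset w] _ _; first by rewrite fsub1set (fsubsetP YA) ?(fsubsetP ZY).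
      by rewrite cardfs1.
    move=> /(_ Z); rewrite fsub1set wZ (fsubset_trans ZY YA) => /(_ isT isT).
    by rewrite delta_small ?cardfs1 // /delta cZ; lia.
  have [||_ ] := KA T; first exact: fsubset_trans TZ (fsubset_trans ZY YA).
    by rewrite cT.
  move=> /(_ Y (fsubset_trans TZ ZY) YA); rewrite delta3 // (negbTE tT); lia.
split=> // C BC CA.
have [c4|c3] := leqP 4 #|` C|.
  by have := H C CA c4; have := delta_le_card B; lia.
have cBC := fsubset_leq_card BC.
have [e|ne] := eqVneq B C; first by rewrite e.
have : (#|` B| < #|` C|)%N by apply: fproper_ltn_card; rewrite fproperEneq ne.
have := delta_le_card B.
have [c2|c2] := leqP #|` C| 2; first by rewrite (delta_small c2); lia.
have c : #|` C| = 3%N by lia.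
by rewrite (delta3 c); case: (is_triple C); lia.
Qed.

Lemma K0_ge2 A : K0 A -> (2 <= #|` A|)%N -> 2 <= delta A.
Proof.
move=> KA c; have [c4|c3] := leqP 4 #|` A|.
  by have := (K0P A).1 KA A (fsubset_refl _) c4; lia.
have [c2|c2] := leqP #|` A| 2; first by rewrite (delta_small c2); lia.
have e : #|` A| = 3%N by lia.
by rewrite (delta3 e); case: (is_triple A); lia.
Qed.

Lemma K0_ge1 A : K0 A -> (1 <= #|` A|)%N -> 1 <= delta A.
Proof.
move=> KA c; have [c2|c1] := leqP 2 #|` A|; first by have := K0_ge2 KA c2; lia.
by rewrite delta_small; lia.
Qed.

Lemma K0_ge0 A : K0 A -> 0 <= delta A.
Proof.
move=> KA; have [c2|c1] := leqP 1 #|` A|; first by have := K0_ge1 KA c2; lia.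
by rewrite delta_small; lia.
Qed.

Lemma K0_ge3 A : K0 A -> (3 <= #|` A|)%N -> ~~ is_triple A -> 3 <= delta A.
Proof.
move=> KA c3 nt; have [c4|c3'] := leqP 4 #|` A|; first exact: (K0P A).1.
have e : #|` A| = 3%N by lia.
by rewrite (delta3 e) (negbTE nt).
Qed.

(** 0-primitivity in terms of subsets of C instead of intermediate strong sets, which suits
    submodularity arguments. *)
Definition minimal0 B C : Prop :=
  [/\ C != fset0, [disjoint B & C], delta (B `|` C) = delta B &
      forall X, X `<=` C -> X != fset0 -> X != C -> delta B < delta (B `|` X)].

Lemma minimal0_ge B C X : minimal0 B C -> X `<=` C -> delta B <= delta (B `|` X).
Proof.
move=> [C0 dBC e m] XC; have [->|X0] := eqVneq X fset0; first by rewrite fsetU0.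
by have [->|XneC] := eqVneq X C; [rewrite e | have := m X XC X0 XneC; lia].
Qed.

(** A proper nonempty part X of relative dimension 0 makes B [|] X an intermediate strong set.
    Conversely, an intermediate D has larger predimension than B [|] C and so is not strong in
    it. *)
Lemma primitive0P B C : primitive0 B C <-> minimal0 B C /\ K0 (B `|` C).
Proof.
split=> [[[C0 d K] [sB e noD]]|[m K]].
  split=> //; split=> //; first by move: e; rewrite /delta_rel; lia.
  move=> X XC X0 XneC; rewrite ltNge; apply/negP => le; apply: noD.
  have [_ sBX] := sB.
  have XBC : B `|` X `<=` B `|` C by apply: fsetUS.
  have eX : delta (B `|` X) = delta B.
    by have := sBX (B `|` X) (fsubsetUl _ _) XBC; lia.
  exists (B `|` X); split.
  - rewrite fproperEneq fsubsetUl andbT; apply: contra_neq X0 => eB.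
    apply/fsetP => x; rewrite inE; apply/negP => xX.
    have xB : x \in B by rewrite eB inE xX orbT.
    by move/fdisjointP/(_ x xB): d; rewrite (fsubsetP XC).
  - rewrite fproperEneq XBC andbT; apply: contra_neq XneC => /fsetP eB.
    by apply/fsetP => x; move: (eB x); fset_hyps x; fset_cases.
  - by split=> [|Z BZ ZX]; [apply: fsubsetUl | apply: sBX (fsubset_trans ZX XBC)].
  - split=> // Z BZ ZX; rewrite eX; apply: sBX => //.
    by apply: fsubset_trans BZ; apply: fsubsetUl.
have [C0 d e mX] := m.
split; first by split.
split=> //.
- split; first exact: fsubsetUl.
  move=> Z BZ ZBC; have -> : Z = B `|` (Z `&` C) by fset_tac.
  by apply: minimal0_ge m _; fset_tac.
- by rewrite /delta_rel e; lia.
- move=> [D [BD DBC sBD [_ sDBC]]].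
  have eD : D = B `|` (D `&` C).
    by have := fproper_sub BD; have := fproper_sub DBC => h1 h2; clear BD DBC; fset_tac.
  have : delta B < delta (B `|` (D `&` C)).
    apply: mX; first by fset_tac.
      apply: contraTneq BD => h; rewrite eD h fsetU0 fproperEneq eqxx.
      by [].
    apply: contraTneq DBC => h; rewrite eD h fproperEneq eqxx.
    by [].
  rewrite -eD -e; have := sDBC (B `|` C) (fproper_sub DBC) (fsubset_refl _); lia.
Qed.

Definition good B C : Prop :=
  [/\ minimal0 B C, K0 (B `|` C) &
      forall B', B' `<` B -> delta B' < delta (B' `|` C)].

(** Shrinking the base can only raise the relative dimension of parts of C, so minimality survives
    as soon as C itself still has relative dimension at most 0. *)
Lemma minimal0_shrink B B' C : minimal0 B C -> B' `<=` B ->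
  delta (B' `|` C) <= delta B' -> minimal0 B' C.
Proof.
move=> [C0 d e m] B'B le.
have anti X : X `<=` C -> delta (B `|` X) - delta B <= delta (B' `|` X) - delta B'.
  move=> XC; apply: delta_rel_anti_disj => //.
  by rewrite fdisjoint_sym; apply: fdisjointWr XC d.
split=> //; first by apply: fdisjointWl B'B d.
  by have := anti C (fsubset_refl _); lia.
by move=> X XC X0 XneC; have := anti X XC; have := m X XC X0 XneC; lia.
Qed.

Lemma good_pairP B C : good_pair B C <-> good B C.
Proof.
split=> [[/primitive0P[m K] g]|[m K g]].
  split=> // B' B'B; rewrite ltNge; apply/negP => le; apply: (g _ B'B).
  apply/primitive0P; split; first by apply: minimal0_shrink m (fproper_sub B'B) le.
  by apply: K0_sub K; apply: fsetSU; apply: fproper_sub.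
split; first exact/primitive0P.
by move=> B' B'B /primitive0P[[_ _ e _] _]; have := g B' B'B; rewrite e ltxx.
Qed.

(** The base of the good pair is a minimal subset of B over which C still has relative dimension at
    most 0. *)
Lemma good_base B C : minimal0 B C -> K0 (B `|` C) ->
  exists2 B', B' `<=` B & good B' C.
Proof.
move=> m K; have [_ _ e _] := m.
have [|B' [B'B le minB']] := @min_fset M (fun X => delta (X `|` C) <= delta X) B.
  by rewrite e.
exists B' => //; split.
- exact: minimal0_shrink m B'B le.
- by apply: K0_sub K; apply: fsetSU.
- by move=> B'' B''B; rewrite ltNge; apply/negP; apply: minB'.
Qed.

(** Two points of a set in K0 already force predimension 2, so nothing has relative dimension 0 over
    fewer than two points. *)
Lemma good_card B C : good B C -> (2 <= #|` B|)%N.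
Proof.
move=> [[C0 d e _] K _]; rewrite leqNgt; apply/negP => c.
have C1 : (0 < #|` C|)%N by rewrite cardfs_gt0.
have := cardfsUI B C; rewrite (eqP (d : _ == _)) cardfs0 => cU.
move: e; rewrite (delta_small (A := B)); last by lia.
have [c2|c1] := leqP 2 #|` B `|` C|; first by have := K0_ge2 K c2; lia.
by rewrite delta_small; lia.
Qed.

Lemma good_delta B C : good B C -> 2 <= delta B.
Proof.
move=> g; have [_ K _] := g.
exact: K0_ge2 (K0_sub (fsubsetUl _ _) K) (good_card g).
Qed.

(** Otherwise B and (B without b) [|] C would be in free position, and C would have relative
    dimension 0 over the smaller base, against minimality of B. *)
Lemma good_triple B C b : good B C -> b \in B ->
  exists S, [/\ is_triple S, S `<=` B `|` C, b \in S & exists2 c, c \in C & c \in S].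
Proof.
move=> [[C0 d e m] K g] bB; apply/not_existsP => noS.
have Bb : B `\ b `<` B by apply: fproperD1.
have := g _ Bb.
have U : B `|` (B `\ b `|` C) = B `|` C by fset_tac.
have I : B `&` (B `\ b `|` C) = B `\ b.
  apply/fsetP => x; rewrite !inE; have := fdisjointP d x.
  by case: (x \in B); rewrite ?andbF ?andbT //= => /(_ isT)/negbTE ->; rewrite orbF.
have := @delta_free _ B (B `\ b `|` C); rewrite U I e => h.
have := h _; suff : forall S, is_triple S -> S `<=` B `|` C ->
   (S `<=` B) || (S `<=` B `\ b `|` C) by move=> f /(_ f); lia.
move=> S tS SBC; apply/negPn/negP; rewrite negb_or => /andP[nB nV].
apply: (noS S); split=> //.
  apply/negPn/negP => bS; move/negP: nV; apply; apply/fsubsetP => x xS.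
  have := fsubsetP SBC x xS; rewrite !inE => /orP[xB|->]; last by rewrite orbT.
  by rewrite xB andbT; case: eqP xS bS => //= -> ->.
have /fsubsetPn[c cS cB] := nB.
exists c => //; have := fsubsetP SBC c cS.
by rewrite inE (negbTE cB).
Qed.

(** Passing to a superset of smaller predimension must stop, since predimensions are nonnegative
    integers here. *)
Lemma K0_hull (KM : forall A, K0 A) A : exists2 D, A `<=` D & strong_in D.
Proof.
have [n] := ubnP `|delta A|%N; elim: n A => // n IH A le.
have [sA|/existsNP[C /not_implyP[AC /negP]]] := pselect (strong_in A).
  by exists A.
rewrite -ltNge => lt; have hA := K0_ge0 (@KM A); have hC := K0_ge0 (@KM C).
have [|D CD sD] := IH C; first by clear -le lt hA hC; lia.
by exists D => //; apply: fsubset_trans CD.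
Qed.

End K0.

(** * Embeddings and copies *)

Lemma in_img (T U : choiceType) (f : T -> U) (A : {fset T}) x :
  x \in A -> f x \in f @` A.
Proof. by move=> xA; apply/imfsetP; exists x. Qed.

Lemma img_comp (T U V : choiceType) (f : T -> U) (g : U -> V) (A : {fset T}) :
  g @` (f @` A) = (fun x => g (f x)) @` A.
Proof. by rewrite -imfset_comp. Qed.

Lemma img_id (T : choiceType) (f : T -> T) (A : {fset T}) :
  {in A, forall x, f x = x} -> f @` A = A.
Proof.
move=> h; apply/fsetP => x; apply/imfsetP/idP => /= [[y yA ->]|xA].
  by rewrite h.
by exists x; rewrite ?h.
Qed.

Lemma img_subset (T U : choiceType) (f : T -> U) (A B : {fset T}) :
  A `<=` B -> f @` A `<=` f @` B.
Proof. by move=> /fsubsetP AB; apply: subset_imfset. Qed.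

Section Transport.
Variables (M N : hstruct) (A : {fset M}) (f : M -> N).
Hypothesis emb : embedding_on A f.
Implicit Types (B C S X Y : {fset M}).

Lemma emb_inj X : X `<=` A -> {in X &, injective f}.
Proof.
by move=> /fsubsetP XA x y /XA xA /XA yA; case: emb => inj _; apply: inj.
Qed.

Lemma emb_card X : X `<=` A -> #|` f @` X| = #|` X|.
Proof. by move=> XA; rewrite card_in_imfset //; apply: emb_inj. Qed.

Lemma emb_mem X x : X `<=` A -> x \in A -> (f x \in f @` X) = (x \in X).
Proof.
move=> XA xA; apply/imfsetP/idP => /= [[y yX e]|]; last by exists x.
case: emb => inj _.
by rewrite (inj x y xA _ e) // (fsubsetP XA).
Qed.

Lemma emb_sub X Y : X `<=` A -> Y `<=` A -> (f @` X `<=` f @` Y) = (X `<=` Y).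
Proof.
move=> XA YA; apply/idP/idP => [/fsubsetP h|]; last exact: img_subset.
apply/fsubsetP => x xX; rewrite -(emb_mem YA) ?(fsubsetP XA) //.
exact: h (in_img _ xX).
Qed.

Lemma emb_eq X Y : X `<=` A -> Y `<=` A -> f @` X = f @` Y -> X = Y.
Proof. by move=> XA YA e; apply/eqP; rewrite eqEfsubset -(emb_sub XA YA) -(emb_sub YA XA) e !fsubset_refl. Qed.

Lemma emb_disj X Y : X `<=` A -> Y `<=` A ->
  [disjoint f @` X & f @` Y] = [disjoint X & Y].
Proof.
move=> XA YA; apply/fdisjointP/fdisjointP => h x xX.
  by rewrite -(emb_mem YA) ?h ?in_img ?(fsubsetP XA).
case/imfsetP: xX => y /= yX ->.
by rewrite (emb_mem YA) ?h ?(fsubsetP XA).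
Qed.

Lemma emb_preim (Z : {fset N}) : Z `<=` f @` A -> exists2 X, X `<=` A & Z = f @` X.
Proof.
move=> ZA; exists [fset x in A | f x \in Z].
  by apply/fsubsetP => x; rewrite !inE => /andP[].
apply/fsetP => y; apply/idP/imfsetP => /= [yZ|[x]].
  have /imfsetP[x /= xA e] := fsubsetP ZA y yZ.
  by exists x => //; rewrite !inE xA -e.
by rewrite !inE => /andP[_ h] ->.
Qed.

Lemma emb_triple S : S `<=` A -> is_triple (f @` S) = is_triple S.
Proof.
case: emb => inj hom /fsubsetP SA; apply/is_tripleP/is_tripleP.
  move=> [x' [y' [z' [R e]]]].
  have /imfsetP[x /= xS ex] : x' \in f @` S by rewrite e !inE eqxx.
  have /imfsetP[y /= yS ey] : y' \in f @` S by rewrite e !inE eqxx orbT.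
  have /imfsetP[z /= zS ez] : z' \in f @` S by rewrite e !inE eqxx orbT.
  exists x, y, z; split; first by rewrite -hom ?SA // -ex -ey -ez.
  apply: (emb_eq (X := S)).
  - exact/fsubsetP.
  - by rewrite !fsubUset !fsub1set !SA.
  - by rewrite e !imfsetU !imfset_fset1 ex ey ez.
move=> [x [y [z [R e]]]]; exists (f x), (f y), (f z).
rewrite e !imfsetU !imfset_fset1; split => //.
by rewrite hom // SA // e !inE eqxx ?orbT.
Qed.

Lemma emb_r X : X `<=` A -> r (f @` X) = r X.
Proof.
move=> XA; rewrite !rE.
have -> : triples (f @` X) = imfset imfset_key (fun S : {fset M} => f @` S) (mem (triples X)).
  apply/fsetP => Z; rewrite in_triples; apply/andP/imfsetP => /= [[ZX tZ]|[S]].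
    have [S SA eZ] := emb_preim (fsubset_trans ZX (img_subset _ XA)).
    by exists S => //; rewrite in_triples -emb_sub // -eZ ZX -emb_triple // -eZ.
  rewrite in_triples => /andP[SX tS] ->.
  by rewrite img_subset // emb_triple ?(fsubset_trans SX XA).
rewrite card_in_imfset //= => S T; rewrite !in_triples => /andP[SX _] /andP[TX _].
by apply: emb_eq; [apply: fsubset_trans SX XA | apply: fsubset_trans TX XA].
Qed.

Lemma emb_delta X : X `<=` A -> delta (f @` X) = delta X.
Proof. by move=> XA; rewrite /delta emb_r // emb_card. Qed.

Lemma emb_K0 X : X `<=` A -> K0 X -> K0 (f @` X).
Proof.
move=> XA /K0P K; apply/K0P => Z ZX cZ.
have [Y YA eZ] := emb_preim (fsubset_trans ZX (img_subset _ XA)).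
rewrite eZ emb_delta // K //; first by rewrite -emb_sub // -eZ.
by rewrite -(emb_card YA) -eZ.
Qed.

Lemma emb_minimal0 B C : B `|` C `<=` A -> minimal0 B C ->
  minimal0 (f @` B) (f @` C).
Proof.
rewrite fsubUset => /andP[BA CA] [C0 d e m]; split.
- by rewrite -cardfs_gt0 emb_card // cardfs_gt0.
- by rewrite emb_disj.
- by rewrite -imfsetU !emb_delta // fsubUset BA.
- move=> Z ZC Z0 ZneC.
  have [X XA eZ] := emb_preim (fsubset_trans ZC (img_subset _ CA)).
  rewrite eZ -imfsetU !emb_delta ?fsubUset ?BA //; apply: m.
  + by rewrite -emb_sub // -eZ.
  + by rewrite -cardfs_gt0 -(emb_card XA) -eZ cardfs_gt0.
  + by apply: contra_neq ZneC => <-.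
Qed.

Lemma emb_good B C : B `|` C `<=` A -> good B C -> good (f @` B) (f @` C).
Proof.
move=> BCA [m K g]; have := BCA; rewrite fsubUset => /andP[BA CA]; split.
- exact: emb_minimal0.
- by rewrite -imfsetU; apply: emb_K0.
- move=> Z ZB; have [X XA eZ] := emb_preim (fsubset_trans (fproper_sub ZB) (img_subset _ BA)).
  rewrite eZ -imfsetU !emb_delta ?fsubUset ?XA //; apply: g.
  by rewrite fproperE -(emb_sub XA BA) -(emb_sub BA XA) -eZ -fproperE.
Qed.

Lemma emb_inverse (x0 : M) : exists g : N -> M,
  embedding_on (f @` A) g /\ {in A, forall x, g (f x) = x}.
Proof.
(* The inverse is read off by position in the enumeration of A; [x0] is the default value outside
   the image. *)
pose g y := nth x0 (enum_fset A) (index y (map f (enum_fset A))).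
have gf : {in A, forall x, g (f x) = x}.
  move=> x xA; rewrite /g.
  have /(nthP x0)[i ic <-] := xA.
  rewrite -(nth_map x0 (f x0)) // index_uniq ?size_map //.
  by rewrite map_inj_in_uniq ?fset_uniq // => y z; apply: emb_inj.
exists g; split=> //; split.
  by move=> y z /imfsetP[a /= aA ->] /imfsetP[b /= bA ->]; rewrite !gf // => ->.
move=> x y z /imfsetP[a /= aA ->] /imfsetP[b /= bA ->] /imfsetP[c /= cA ->].
by rewrite !gf //; case: emb => _ ->.
Qed.

End Transport.

Lemma emb_subset (M N : hstruct) (A B : {fset M}) (f : M -> N) :
  B `<=` A -> embedding_on A f -> embedding_on B f.
Proof.
move=> /fsubsetP BA [inj hom]; split=> [x y /BA xA /BA yA|x y z /BA xA /BA yA /BA zA].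
  exact: inj.
exact: hom.
Qed.

Lemma emb_comp (M N P : hstruct) (A : {fset M}) (f : M -> N) (g : N -> P) :
  embedding_on A f -> embedding_on (f @` A) g -> embedding_on A (fun x => g (f x)).
Proof.
move=> [inj hom] [inj' hom']; split=> [x y xA yA e|x y z xA yA zA].
  by apply: inj => //; apply: inj' e; apply: in_img.
by rewrite hom' ?hom ?in_img.
Qed.

(** * Copies over a base and the class K_mu *)

Section Copies.
Variables (mu : mu_function) (M : hstruct).
Implicit Types (A B C X Y : {fset M}) (F : {fset {fset M}}).

Lemma copy_sym B C C' : C != fset0 -> copy_over B C C' -> copy_over B C' C.
Proof.
move=> /fset0Pn[x0 _] [f [emb idB <-]].
have [g [embg gf]] := emb_inverse emb x0.
have gC X : X `<=` B `|` C -> g @` (f @` X) = X.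
  by move=> /fsubsetP XA; rewrite img_comp; apply: img_id => x /XA; apply: gf.
exists g; split.
- by move: embg; rewrite imfsetU (img_id idB).
- by move=> x xB; rewrite -{1}(idB x xB) gf // inE xB.
- by apply: gC; apply: fsubsetUr.
Qed.

Lemma copy_trans B C C' C'' :
  copy_over B C C' -> copy_over B C' C'' -> copy_over B C C''.
Proof.
move=> [f [emb idB <-]] [g [embg idgB <-]]; exists (fun x => g (f x)); split.
- by apply: emb_comp => //; rewrite imfsetU (img_id idB).
- by move=> x xB; rewrite idB // idgB.
- by rewrite img_comp.
Qed.

Lemma copy_good B C C' : good B C -> copy_over B C C' -> good B C'.
Proof.
by move=> g [f [emb idB <-]]; rewrite -(img_id idB); apply: (emb_good emb).
Qed.

Lemma copy_card B C C' : copy_over B C C' -> #|` C'| = #|` C|.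
Proof. by move=> [f [emb idB <-]]; rewrite (emb_card emb) // fsubsetUr. Qed.

Lemma mu_copy B C C' : good B C -> copy_over B C C' -> mu M B C = mu M B C'.
Proof.
move=> g c; apply: mu_iso; [exact/good_pairP| |].
  by apply/good_pairP; apply: copy_good c.
by have [f [emb idB e]] := c; exists f; split=> //; apply: img_id.
Qed.

Definition copy_family B F : Prop :=
  [/\ forall C, C \in F -> good B C,
      {in F &, forall C1 C2, C1 != C2 -> [disjoint C1 & C2]} &
      {in F &, forall C1 C2, copy_over B C1 C2}].

(** The fixed model C of the definition is replaced by the members of the family themselves: they
    are copies of one another, and [mu] takes the same value on each. *)
Lemma KmuP A : Kmu mu A <-> K0 A /\
  forall B F, B `<=` A -> (forall C, C \in F -> C `<=` A) -> copy_family B F ->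
  forall C, C \in F -> (#|` F| <= mu M B C)%N.
Proof.
split=> -[K H]; split=> //.
  move=> B F BA FA [gF dF cF] C CF.
  apply: (H B C) => //; first exact/good_pairP/gF.
  by move=> C' C'F; split; [apply: FA | apply: cF].
move=> B C /good_pairP g BA F HF dF.
have [->|/fset0Pn[C1 C1F]] := eqVneq F fset0; first by rewrite cardfs0.
have [_ c1] := HF _ C1F; have [[C0 _ _ _] _ _] := g.
rewrite (mu_copy g c1); apply: (H B F) => //; first by move=> C' /HF[].
split=> //; first by move=> C' /HF[_]; apply: copy_good.
by move=> C2 C3 /HF[_ c2] /HF[_ c3]; apply: copy_trans c3; apply: copy_sym.
Qed.

Lemma Kmu_sub A A' : A `<=` A' -> Kmu mu A' -> Kmu mu A.
Proof.
move=> AA' [K H]; split=> [|B C g BA F HF dF]; first exact: K0_sub K.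
apply: (H B C g (fsubset_trans BA AA')) => // C' /HF[C'A c]; split=> //.
exact: fsubset_trans AA'.
Qed.

End Copies.

(** A family in the image is pulled back along the inverse of f, and [mu] does not change because it
    is invariant under isomorphism. *)
Lemma Kmu_img (mu : mu_function) (M N : hstruct) (A : {fset M}) (f : M -> N) :
  embedding_on A f -> Kmu mu A -> Kmu mu (f @` A).
Proof.
move=> emb /KmuP[K H]; apply/KmuP; split=> [|B F BA FA [gF dF cF] C CF].
  exact: (emb_K0 emb).
have [[/fset0Pn[y yC] _ _ _] _ _] := gF _ CF.
have /imfsetP[x0 _ _] := fsubsetP (FA _ CF) y yC.
have [g [embg gf]] := emb_inverse emb x0.
have gA : g @` (f @` A) = A by rewrite img_comp; apply: img_id.
have gsub X : X `<=` f @` A -> g @` X `<=` A by move=> XA; rewrite -gA; apply: img_subset.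
have FBA C' : C' \in F -> B `|` C' `<=` f @` A by move=> /FA C'A; rewrite fsubUset BA.
pose F' := imfset imfset_key (fun C' : {fset N} => g @` C') (mem F).
have -> : #|` F| = #|` F'|.
  by rewrite card_in_imfset // => C1 C2 /FA C1A /FA C2A /(emb_eq embg C1A C2A).
have -> : mu N B C = mu M (g @` B) (g @` C).
  apply: mu_iso; first exact/good_pairP/gF.
    by apply/good_pairP/(emb_good embg); [apply: FBA | apply: gF].
  by exists g; split=> //; apply: emb_subset embg; apply: FBA.
apply: H; first exact: gsub.
- by move=> C' /imfsetP[C1 /= C1F ->]; apply/gsub/FA.
- split.
  + move=> C' /imfsetP[C1 /= C1F ->].
    by apply/(emb_good embg); [apply: FBA | apply: gF].
  + move=> ? ? /imfsetP[C1 /= C1F ->] /imfsetP[C2 /= C2F ->] ne.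
    rewrite (emb_disj embg) ?FA //; apply: dF => //.
    by apply: contra_neq ne => ->.
  + move=> ? ? /imfsetP[C1 /= C1F ->] /imfsetP[C2 /= C2F ->].
    have [h [embh idh e]] := cF _ _ C1F C2F.
    have embgB : embedding_on (B `|` C1) g by apply: emb_subset embg; apply: FBA.
    have [k [embk kg]] := emb_inverse embgB y.
    (* The copy map h between C1 and C2 is conjugated by g; k inverts g on B [|] C1. *)
    exists (fun x => g (h (k x))); split.
    * rewrite -imfsetU; apply: (emb_comp (f := k) (g := fun y => g (h y))) => //.
      have -> : k @` (g @` (B `|` C1)) = B `|` C1 by rewrite img_comp; apply: img_id.
      apply: (emb_comp (f := h) (g := g)) => //; rewrite imfsetU (img_id idh) e.
      by apply: emb_subset embg; apply: FBA.
    * by move=> x /imfsetP[b /= bB ->]; rewrite kg ?inE ?bB // idh.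
    * rewrite -e !img_comp; apply: eq_in_imfset => x xC /=; rewrite kg //.
      by rewrite inE; apply/orP; right.
- by apply/imfsetP; exists C.
Qed.

(** * Free amalgamation *)

Lemma hR_triple (M : hstruct) (x y z : M) : hR x y z = is_triple [fset x; y; z].
Proof.
apply/idP/idP => [R|t]; first by apply/is_tripleP; exists x, y, z.
have c3 := triple_card t.
case/is_tripleP: t => u [v [w [R e]]].
have [uv uw vw] := hR_distinct R.
have : u \in [fset x; y; z] by rewrite e !inE eqxx.
have : v \in [fset x; y; z] by rewrite e !inE eqxx orbT.
have : w \in [fset x; y; z] by rewrite e !inE eqxx orbT.
rewrite !inE -!orbA.
do 3! [case/or3P=> /eqP ?]; subst u v w; rewrite ?eqxx // in uv uw vw R *;
  by rewrite ?R // (hR_swap12 x) ?R // hR_swap23 ?R // hR_swap12 ?R // hR_swap23 ?R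
             // hR_swap12 R.
Qed.

(** Reduces an embedding to a condition on 3-element sets, the form in which freeness is known. *)
Lemma emb_of_triples (M N : hstruct) (A : {fset M}) (f : M -> N) :
  {in A &, injective f} ->
  (forall S, S `<=` A -> #|` S| = 3%N -> is_triple (f @` S) = is_triple S) ->
  embedding_on A f.
Proof.
move=> inj H; split=> // x y z xA yA zA; rewrite !hR_triple.
have SA : [fset x; y; z] `<=` A by rewrite !fsubUset !fsub1set xA yA.
have <- : f @` [fset x; y; z] = [fset f x; f y; f z].
  by rewrite !imfsetU !imfset_fset1.
have [/(H _ SA)//|c3] := eqVneq #|` [fset x; y; z]| 3%N.
have c3' : #|` f @` [fset x; y; z]| != 3%N.
  by rewrite card_in_imfset // => u v /(fsubsetP SA) uA /(fsubsetP SA); apply: inj.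
by apply/idP/idP => /triple_card h; [move: c3' | move: c3]; rewrite h.
Qed.

Section OneStructure.
Variables (M : hstruct).
Implicit Types (A B C D S X Y Z : {fset M}).

(* Relative to the strong set D, every C_i that meets D costs at least one unit
   of dimension over B, so there are at most delta B of them. *)
Lemma meet_count D B (s : seq {fset M}) :
  uniq s -> {in s, forall C, good B C} ->
  {in s &, forall C1 C2, C1 != C2 -> [disjoint C1 & C2]} ->
  ~~ (B `<=` D) -> K0 B ->
  (forall X, X `<=` foldr fsetU B s -> delta D <= delta (D `|` X)) ->
  (count (fun C => C `&` D != fset0) s)%:Z <= delta B.
Proof.
move=> us gs ds /fsubsetPn[b bB bD] KB strD.
have K' : 0 <= delta (B `&` D) by apply/K0_ge0/(K0_sub _ KB)/fsubsetIl.
(* With T the union of B and the sets treated so far, delta T - delta (T [&] D) starts at delta B -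
   delta (B [&] D) and drops by one for each set meeting D. Strength of D keeps it nonnegative at
   the end. *)
suff H : delta (foldr fsetU B s) - delta (foldr fsetU B s `&` D) +
    (count (fun C => C `&` D != fset0) s)%:Z <= delta B - delta (B `&` D).
  have := strD _ (fsubset_refl _).
  have := delta_submod D (foldr fsetU B s); rewrite (fsetIC D); lia.
move: {strD} us gs ds; elim: s => [|C s IH] /=; first by rewrite addr0.
case/andP => Cs us gs ds.
have {}IH := IH us (fun C' h => gs C' (mem_behead (s := C :: s) h))
  (fun C1 C2 h1 h2 => ds C1 C2 (mem_behead (s := C :: s) h1) (mem_behead (s := C :: s) h2)).
set T := foldr fsetU B s in IH *.
have gC : good B C by apply: gs; rewrite mem_head.
have BT : B `<=` T by rewrite /T; elim: (s) => //= C' s' h; apply: fsubsetU; rewrite h orbT.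
have [[C0 dBC eBC mBC] _ _] := gC.
have CT : [disjoint C & T].
  have dis C' : C' \in s -> [disjoint C & C'].
    move=> C's; apply: ds; rewrite ?mem_head // ?inE ?C's ?orbT //.
    by apply: contraNneq Cs => ->.
  rewrite /T; elim: (s) dis => [|C' s' h] dis /=; first by rewrite fdisjoint_sym.
  rewrite fdisjointXU dis ?mem_head //= h // => C'' h''.
  by apply: dis; rewrite inE h'' orbT.
set X := C `&` D.
have e1 : (C `|` T) `&` D = (T `&` D) `|` X by rewrite /X; fset_tac.
rewrite e1.
have XC : X `<=` C by apply: fsubsetIl.
have u1 : T `|` ((T `&` D) `|` X) = T `|` X by fset_tac.
have i1 : T `&` ((T `&` D) `|` X) = T `&` D by fset_tac.
have s1 := delta_submod T ((T `&` D) `|` X); rewrite u1 i1 in s1.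
have u2 : (T `|` X) `|` (B `|` C) = C `|` T by fset_tac.
have i2 : (T `|` X) `&` (B `|` C) = B `|` X by fset_tac.
have s2 := delta_submod (T `|` X) (B `|` C); rewrite u2 i2 eBC in s2.
have [mgC _ _] := gC.
have s3 := minimal0_ge mgC XC.
have [e|X0] := eqVneq X fset0.
  by rewrite /= add0n; clear - s1 s2 s3 IH; lia.
rewrite /=.
(* If only a proper part of C lies in D, minimality of C supplies the unit. If C lies in D, it comes
   from a triple through a point of C and b, which is outside D. *)
have [eX|XneC] := eqVneq X C; last first.
  by have s4 := mBC X XC X0 XneC; clear - s1 s2 s4 IH; lia.
have [S [tS SBC bS [c cC cS]]] := good_triple gC bB.
have lt : delta (T `|` ((T `&` D) `|` X)) + delta (T `&` ((T `&` D) `|` X)) <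
    delta T + delta ((T `&` D) `|` X).
  apply: (delta_submod_strict tS).
  - by apply: fsubset_trans SBC _; rewrite u1 eX; fset_tac.
  - apply/negP => /fsubsetP/(_ c cS); exact/negP/(fdisjointP CT).
  - by apply/negP => /fsubsetP/(_ b bS); rewrite /X !inE (negbTE bD) !andbF.
by rewrite u1 i1 in lt; clear - lt s2 s3 IH; lia.
Qed.

(* No triple joins A to C except inside B `|` C, since it would make the
   predimension drop below that of A; likewise for C'. *)
Lemma copy_lift A B C C' : B `<=` A -> [disjoint A & C] -> [disjoint A & C'] ->
  delta A <= delta (A `|` C) -> delta A <= delta (A `|` C') ->
  delta (B `|` C) <= delta B -> C != fset0 -> copy_over B C C' ->
  copy_over A C C'.
Proof.
move=> BA dC dC' leC leC' leB C0 [f [emb idB eC']].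
have sep X : [disjoint A & X] -> delta A <= delta (A `|` X) ->
    delta (B `|` X) <= delta B ->
    forall S, is_triple S -> S `<=` A `|` X -> (S `<=` A) || (S `<=` B `|` X).
  move=> dX le leBX S tS SAX; apply/negPn/negP; rewrite negb_or => /andP[h1 h2].
  have u : A `|` (B `|` X) = A `|` X by fset_tac.
  have i : A `&` (B `|` X) = B by fset_tac.
  have := @delta_submod_strict _ A (B `|` X) S tS; rewrite u i.
  by move=> /(_ SAX h1 h2); clear - le leBX; lia.
have eBC' : f @` (B `|` C) = B `|` C' by rewrite imfsetU (img_id idB) eC'.
have leB' : delta (B `|` C') <= delta B.
  by rewrite -eBC' (emb_delta emb).
pose g x := if x \in A then x else f x.
have gA x : x \in A -> g x = x by rewrite /g => ->.
have gC x : x \in C -> g x = f x.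
  by rewrite /g; case: ifP => // xA; move/fdisjointP/(_ x xA): dC => /negbTE->.
have gB x : x \in B `|` C -> g x = f x.
  rewrite inE => /orP[xB|/gC//]; rewrite gA ?idB //; exact: (fsubsetP BA).
have fC x : x \in C -> f x \in C' by rewrite -eC'; apply: in_img.
have fCA x : x \in C -> f x \notin A.
  by move=> /fC xC; apply/negP => /(fdisjointP dC'); rewrite xC.
have ginv x : x \in A `|` C -> g x \in A -> x \in A.
  by rewrite inE => /orP[//|xC]; rewrite gC // (negbTE (fCA _ xC)).
exists g; split=> //; last first.
  by rewrite -eC'; apply: eq_in_imfset => x xC; apply: gC.
apply: emb_of_triples.
  move=> x y; rewrite !inE.
  case xA: (x \in A); case yA: (y \in A) => /= xC yC.
  - by rewrite !gA.
  - by rewrite gA // gC // => e; move: (fCA _ yC); rewrite -e xA.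
  - by rewrite gC // gA // => e; move: (fCA _ xC); rewrite e yA.
  - by rewrite !gC // => e; case: emb => inj _; apply: inj e; rewrite inE ?xC ?yC orbT.
move=> S SAC c3; apply/idP/idP => tS.
  have gS : g @` S `<=` A `|` C'.
    apply/fsubsetP => ? /imfsetP[x /= xS ->]; have := fsubsetP SAC x xS.
    rewrite !in_fsetU => /orP[xA|xC]; first by rewrite gA ?xA.
    by rewrite gC // fC // orbT.
  have /orP[gS'|gS'] := sep C' dC' leC' leB' _ tS gS.
    suff <- : g @` S = S by [].
    apply: img_id => x xS; apply/gA/ginv; first exact: (fsubsetP SAC).
    by apply: (fsubsetP gS'); apply: in_img.
  have SBC : S `<=` B `|` C.
    apply/fsubsetP => x xS; have := fsubsetP SAC x xS; rewrite !inE.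
    case/orP => [xA|->]; last by rewrite orbT.
    have := fsubsetP gS' _ (in_img g xS); rewrite gA // inE => /orP[->//|xC'].
    by move/fdisjointP/(_ x xA): dC'; rewrite xC'.
  rewrite -(emb_triple emb) //; suff <- : g @` S = f @` S by [].
  by apply: eq_in_imfset => x xS; apply/gB/(fsubsetP SBC).
have /orP[SA|SA] := sep C dC leC leB _ tS SAC.
  suff -> : g @` S = S by [].
  by apply: img_id => x xS; apply/gA/(fsubsetP SA).
have -> : g @` S = f @` S.
  by apply: eq_in_imfset => x xS; apply/gB/(fsubsetP SA).
by rewrite (emb_triple emb).
Qed.

End OneStructure.

(** * The free amalgam of D and A [|] C over an n-strong A *)

Section Amalgam.
Variables (mu : mu_function) (M : hstruct) (A C D : {fset M}) (n : nat).
Implicit Types (B S X Y Z : {fset M}).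
Hypotheses (AD : A `<=` D) (dCD : [disjoint C & D]).
Hypothesis free : forall S, is_triple S -> S `<=` D `|` C ->
  (S `<=` D) || (S `<=` A `|` C).
Hypotheses (KD : Kmu mu D) (KE : Kmu mu (A `|` C)).
Hypothesis leE : delta A <= delta (A `|` C).
Hypothesis minE : forall X, X `<=` C -> X != fset0 -> X != C ->
  delta A < delta (A `|` X).
Hypothesis strA : forall X, X `<=` D -> (#|` X| <= n)%N -> delta A <= delta (A `|` X).
Hypotheses (C0 : C != fset0) (cC : (#|` C| <= n)%N) (n3 : (3 <= n)%N).
(** When C has relative dimension 0, adding it next to copies already in D could exceed [mu]; in
    that situation a copy in D is used instead of the amalgam. *)
Hypothesis no_copy : delta (A `|` C) <= delta A ->
  forall C', C' `<=` D -> ~ copy_over A C C'.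

Lemma amalgam_disj : [disjoint C & A].
Proof. exact: fdisjointWr AD dCD. Qed.

Lemma amalgam_delta Z : Z `<=` D `|` C ->
  delta Z + delta (Z `&` A) = delta (Z `&` D) + delta (Z `&` (A `|` C)).
Proof.
move=> ZDC; have u1 : (Z `&` D) `|` (Z `&` (A `|` C)) = Z by fset_tac.
have i1 : (Z `&` D) `&` (Z `&` (A `|` C)) = Z `&` A by fset_tac.
rewrite -(@delta_free _ (Z `&` D)) u1 ?i1 // => S tS SZ.
rewrite !fsubsetI SZ /=.
by apply: free => //; apply: fsubset_trans SZ ZDC.
Qed.

Lemma amalgam_min X : X `<=` C -> delta A <= delta (A `|` X).
Proof.
move=> XC; have [->|X0] := eqVneq X fset0; first by rewrite fsetU0.
have [->//|XneC] := eqVneq X C.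
by apply/ltW/minE.
Qed.

(** Parts of C have nonnegative relative dimension over A, hence also over the smaller base Z [&]
    A. *)
Lemma amalgam_geD Z : Z `<=` D `|` C -> delta (Z `&` D) <= delta Z.
Proof.
move=> ZDC; have e := amalgam_delta ZDC.
have h := @delta_rel_anti_disj M (Z `&` A) A (Z `&` C).
have u1 : Z `&` A `|` Z `&` C = Z `&` (A `|` C) by fset_tac.
rewrite u1 in h.
have h2 : delta A <= delta (A `|` (Z `&` C)) by apply: amalgam_min; apply: fsubsetIr.
have {}h := h (fsubsetIr _ _) (fdisjointWl (fsubsetIr _ _) amalgam_disj).
clear - e h h2; lia.
Qed.

(** The mirror image of the previous bound. On the side of D, strength of A is known only against n
    points, hence the cardinality condition. *)
Lemma amalgam_geE Z : Z `<=` D `|` C -> (#|` (Z `&` D) `\` A| <= n)%N ->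
  delta (Z `&` (A `|` C)) <= delta Z.
Proof.
move=> ZDC c; have e := amalgam_delta ZDC.
have h := delta_submod A (Z `&` D).
have u1 : A `|` Z `&` D = A `|` ((Z `&` D) `\` A) by fset_tac.
have i1 : A `&` (Z `&` D) = Z `&` A by fset_tac.
rewrite u1 i1 in h.
have h2 : delta A <= delta (A `|` ((Z `&` D) `\` A)) by apply: strA => //; fset_tac.
clear - e h h2; lia.
Qed.

(** A set Y with at least four points and predimension below 3 would have traces of predimension at
    most 2 on both sides, so each trace has at most two points or is a line. Counting leaves only
    two lines sharing two points of A, and then the third point in D is a forbidden copy of C. *)
Lemma amalgam_K0 : K0 (D `|` C).
Proof.
apply/K0P => Y YDC c4; rewrite leNgt; apply/negP => lt3.
have [[KD0 _] [KE0 _]] := (KD, KE).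
have K3 X (K : K0 X) : delta X < 3 -> (#|` X| <= 2)%N \/ is_triple X.
  move=> lt; have [|c3] := leqP #|` X| 2; first by left.
  by right; apply/negPn/negP => nt; have := K0_ge3 K c3 nt; lia.
have leD := amalgam_geD YDC.
have KYD : K0 (Y `&` D) by apply: K0_sub KD0; apply: fsubsetIr.
have hD := K3 _ KYD (le_lt_trans leD lt3).
have cD : (#|` Y `&` D| <= 3)%N by case: hD => [|/triple_card]; lia.
(* The trace on D has at most three points, so [n3] provides enough strength. *)
have leE' : delta (Y `&` (A `|` C)) <= delta Y.
  apply: amalgam_geE => //; apply: leq_trans n3; apply: leq_trans cD.
  by apply: fsubset_leq_card; fset_tac.
have KYE : K0 (Y `&` (A `|` C)) by apply: K0_sub KE0; apply: fsubsetIr.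
have hE := K3 _ KYE (le_lt_trans leE' lt3).
have cU := cardfsUI (Y `&` D) (Y `&` (A `|` C)).
have u1 : (Y `&` D) `|` (Y `&` (A `|` C)) = Y by fset_tac.
have i1 : (Y `&` D) `&` (Y `&` (A `|` C)) = Y `&` A by fset_tac.
rewrite u1 i1 in cU.
have e := amalgam_delta YDC.
have dl X : ((#|` X| <= 2)%N \/ is_triple X) ->
   (#|` X| <= 2)%N /\ delta X = #|` X|%:Z \/ [/\ is_triple X, #|` X| = 3%N & delta X = 2].
  case=> [h|t]; first by left; rewrite delta_small.
  by right; split; rewrite ?triple_card // delta3 ?triple_card // t.
have cA1 : (#|` Y `&` A| <= #|` Y `&` D|)%N by apply: fsubset_leq_card; apply: fsetIS.
have {}hD := dl _ hD; have {}hE := dl _ hE.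
have cE : (#|` Y `&` (A `|` C)| <= 3)%N by case: hE => [[]|[]]; lia.
have hA : (#|` Y `&` A| <= 2)%N by lia.
have eA := delta_small hA.
case: hD => [[h1 h2]|[tD h1 h2]]; case: hE => [[h3 h4]|[tE h3 h4]].
- by clear - c4 lt3 h1 h2 h3 h4 e eA cU hA; lia.
- by clear - c4 lt3 h1 h2 h3 h4 e eA cU hA; lia.
- by clear - c4 lt3 h1 h2 h3 h4 e eA cU hA; lia.
have cA2 : #|` Y `&` A| = 2%N by clear - c4 lt3 h1 h2 h3 h4 e eA cU hA; lia.
(* Y consists of two points of A and of a third point on their line in each
   of D and A `|` C; the latter makes up C. *)
have cardI : #|` Y `&` C| = 1%N.
  have := cardfsUI (Y `&` A) (Y `&` C).
  have -> : (Y `&` A) `|` (Y `&` C) = Y `&` (A `|` C) by fset_tac.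
  have -> : (Y `&` A) `&` (Y `&` C) = fset0 by fset_tac.
  by rewrite cardfs0; lia.
have cardJ : #|` Y `&` D `\` A| = 1%N.
  have := cardfsID A (Y `&` D).
  have -> : (Y `&` D) `&` A = Y `&` A by fset_tac.
  by lia.
have eYE : (Y `&` A) `|` (Y `&` C) = Y `&` (A `|` C) by fset_tac.
have leYC : delta (A `|` (Y `&` C)) <= delta A.
  have h := @delta_rel_anti_disj M (Y `&` A) A (Y `&` C).
  rewrite eYE h4 eA cA2 in h.
  have {}h := h (fsubsetIr _ _) (fdisjointWl (fsubsetIr _ _) amalgam_disj).
  by clear - h; lia.
have YC : Y `&` C = C.
  apply/eqP/negPn/negP => ne.
  have := minE (fsubsetIr Y C) _ ne; rewrite -cardfs_gt0 cardI => /(_ isT).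
  by rewrite ltNge leYC.
rewrite YC in leYC eYE.
have /cardfs1P[c eC] : #|` C| == 1%N by rewrite -{1}YC cardI.
have /cardfs1P[d ed] : #|` Y `&` D `\` A| == 1%N by rewrite cardJ.
have dA : [disjoint A & [fset d]] by rewrite -ed; fset_tac.
have eYD : (Y `&` A) `|` [fset d] = Y `&` D by rewrite -ed; fset_tac.
have dD : [fset d] `<=` D by rewrite -ed; fset_tac.
apply: (no_copy leYC dD); apply: (@copy_lift _ A (Y `&` A)) => //.
- exact: fsubsetIr.
- by rewrite fdisjoint_sym; apply: amalgam_disj.
- by apply: strA dD _; rewrite cardfs1; apply: leq_trans n3.
- by rewrite eYE h4 eA cA2.
exists (fun x => if x == c then d else x).
have cA : c \notin A by apply: (fdisjointP amalgam_disj); rewrite eC inE.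
have eB : {in Y `&` A, forall x, (if x == c then d else x) = x}.
  by move=> x; rewrite inE => /andP[_ xA]; case: eqP => // e'; rewrite -e' xA in cA.
have im : [fset (if x == c then d else x) | x in Y `&` A `|` C] = Y `&` D.
  by rewrite imfsetU (img_id eB) eC imfset_fset1 eqxx.
split=> //; last by rewrite eC imfset_fset1 eqxx.
apply: emb_of_triples.
  by apply/card_in_imfsetP; rewrite im eYE h1 h3.
move=> S SB cS; have -> : S = Y `&` A `|` C by apply/eqP; rewrite eqEfcard SB cS eYE h3.
by rewrite im eYE tD tE.
Qed.

(** Every family either lies in one of the two sides, where its bound is known, or has its base
    outside D and all members meeting D, where [meet_count] and the lower bound on [mu] apply. *)
Lemma amalgam_Kmu : Kmu mu (D `|` C).
Proof.
apply/KmuP; split=> [|B F BDC FDC cF C1 C1F]; first exact: amalgam_K0.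
have [gF dF copF] := cF.
have [/KmuP[KD0 muD] /KmuP[KE0 muE]] := (KD, KE).
have BC' C' : C' \in F -> B `|` C' `<=` D `|` C by move=> C'F; rewrite fsubUset BDC FDC.
have [BD|nBD] := boolP (B `<=` D).
  (* A member not inside D avoids D, since a proper trace would contradict [amalgam_geD]. It is then
     a part of C of relative dimension 0, so it is C by minimality. *)
  have inD C' : C' \in F -> ~~ (C' `<=` D) -> C' = C.
    move=> C'F nC'D; have [[C'0 dBC' eC' mC'] _ _] := gF _ C'F.
    have IC' : C' `&` D = fset0.
      apply/eqP/negPn/negP => I0.
      have ne : C' `&` D != C' by apply: contraNneq nC'D => <-; apply: fsubsetIr.
      have := mC' _ (fsubsetIl _ _) I0 ne.
      have := amalgam_geD (BC' _ C'F).
      have -> : (B `|` C') `&` D = B `|` C' `&` D by fset_tac.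
      by rewrite eC'; clear; lia.
    have C'C : C' `<=` C.
      have h := FDC _ C'F; apply/fsubsetP => x xC'; have := fsubsetP h x xC'.
      rewrite !inE => /orP[xD|//]; have : x \in C' `&` D by rewrite inE xC'.
      by rewrite IC'.
    apply/eqP/negPn/negP => ne; have := minE C'C C'0 ne.
    have dC'D : [disjoint C' & D] by rewrite /fdisjoint IC'.
    have := delta_rel_anti_disj BD dC'D; rewrite eC'.
    have := @amalgam_delta (D `|` C') _; rewrite fsetUS // => /(_ isT).
    have -> : (D `|` C') `&` A = A by clear IC'; fset_tac.
    have -> : (D `|` C') `&` D = D by fset_tac.
    have -> : (D `|` C') `&` (A `|` C) = A `|` C' by fset_tac.
    by clear; lia.
  have [CF|nCF] := boolP (C \in F); last first.
    apply: (muD B F) => // C' C'F; apply/negPn/negP => nC'D.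
    by move: nCF; rewrite -(inD _ C'F nC'D) C'F.
  have gC := gF _ CF; have [[_ dBC eC mC] _ gBC] := gC.
  (* C sees only the part of B inside A, so a good base of C cannot reach outside A. *)
  have BA : B `<=` A.
    apply/negPn/negP => nBA.
    have ne : B `&` A `<` B.
      rewrite fproperEneq fsubsetIl andbT; apply: contraNneq nBA => <-.
      exact: fsubsetIr.
    have := gBC _ ne.
    have := amalgam_delta (BC' _ CF); rewrite eC.
    have -> : (B `|` C) `&` A = B `&` A.
      by have d := amalgam_disj; fset_tac.
    have -> : (B `|` C) `&` D = B by fset_tac.
    have -> : (B `|` C) `&` (A `|` C) = B `&` A `|` C by fset_tac.
    by clear; lia.
  have leC : delta (A `|` C) <= delta A.
    by have := delta_rel_anti_disj BA amalgam_disj; rewrite eC; clear; lia.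
  (* A member in D but not in A is disjoint from A by n-strength, and [copy_lift] makes it a copy of
     C over A, which [no_copy] excludes. The whole family thus lies in A [|] C. *)
  have copyC C' : C' \in F -> C' `<=` D -> C' `<=` A.
    move=> C'F C'D; apply/negPn/negP => nC'A.
    have [[C'0 dBC' eC' mC'] _ _] := gF _ C'F.
    have c' : (#|` C'| <= n)%N by rewrite (copy_card (copF _ _ CF C'F)).
    have dAC' : [disjoint A & C'].
      rewrite fdisjoint_sym; apply/negPn/negP => I0.
      have ne : C' `&` A != C' by apply: contraNneq nC'A => <-; apply: fsubsetIr.
      have := mC' _ (fsubsetIl _ _) I0 ne.
      have := delta_submod A (B `|` C').
      have -> : A `|` (B `|` C') = A `|` C' by fset_tac.
      have -> : A `&` (B `|` C') = B `|` C' `&` A by fset_tac.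
      have := strA C'D c'; rewrite eC'.
      by clear; lia.
    apply: (no_copy leC C'D); apply: (copy_lift BA) => //.
    - by rewrite fdisjoint_sym; apply: amalgam_disj.
    - exact: strA.
    - by rewrite eC.
    - exact: copF.
  apply: (muE B F) => //; first exact: fsubset_trans BA (fsubsetUl _ _).
  move=> C' C'F; have [C'D|nC'D] := boolP (C' `<=` D).
    exact: fsubset_trans (copyC _ C'F C'D) (fsubsetUl _ _).
  by rewrite (inD _ C'F nC'D) fsubsetUr.
have gC1 := gF _ C1F.
have [_ KBC _] := gC1.
have [allD|/existsNP[C2 /not_implyP[C2F /negP]]] :=
    pselect (forall C', C' \in F -> C' `&` D != fset0).
  have strT X : X `<=` foldr fsetU B (enum_fset F) -> delta D <= delta (D `|` X).
    move=> XT; have XDC : X `<=` D `|` C.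
      apply: fsubset_trans XT _.
      elim: (enum_fset F) (fun C' (h : C' \in enum_fset F) => FDC C' h) => //= C' s IH h.
      rewrite fsubUset h ?mem_head //= IH // => C'' h''.
      by apply: h; rewrite inE h'' orbT.
    have := @amalgam_geD (D `|` X) _; rewrite fsubUset fsubsetUl XDC => /(_ isT).
    by have -> : (D `|` X) `&` D = D by fset_tac.
  have := meet_count (fset_uniq F) gF dF nBD (K0_sub (fsubsetUl _ _) KBC) strT.
  have -> : count (fun C' => C' `&` D != fset0) (enum_fset F) = #|` F|.
    by apply/eqP; rewrite -all_count; apply/allP => C' C'F; apply: allD.
  have := mu_ge mu ((good_pairP _ _).2 gC1).
  by rewrite -lez_nat => le' le; apply: le_trans le le'.
rewrite negbK => /eqP I2.
have /fsubsetPn[b0 b0B b0D] := nBD.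
have dC2D x : x \in C2 -> x \notin D.
  by move=> xC2; apply/negP => xD; have := in_fset0 x; rewrite -I2 inE xC2 xD.
have C2C : C2 `<=` C.
  have h := FDC _ C2F; apply/fsubsetP => x xC2.
  by have := fsubsetP h x xC2; rewrite inE (negbTE (dC2D _ xC2)).
have cF' C' : C' \in F -> (#|` C'| <= n)%N.
  move=> C'F; rewrite (copy_card (copF _ _ C2F C'F)).
  by apply: leq_trans cC; apply: fsubset_leq_card.
(* Each point of B is on a triple with a point of C2, which is in C and outside D; by freeness this
   triple lies in A [|] C. *)
have BE : B `<=` A `|` C.
  apply/fsubsetP => b bB; apply/negPn/negP => bE.
  have [S [tS SB bS [c cC2 cS]]] := good_triple (gF _ C2F) bB.
  have /orP[SD|SE] := free tS (fsubset_trans SB (BC' _ C2F)).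
    by have := fsubsetP SD c cS; rewrite (negbTE (dC2D _ cC2)).
  by move/negP: bE; apply; apply: (fsubsetP SE).
apply: (muE B F) => // C' C'F; apply/negPn/negP => nC'E.
have [[C'0 dBC' eC' mC'] _ _] := gF _ C'F.
(* The triple through b0, which is outside D, cannot lie in D and so brings a point of C' into A [|]
   C. *)
have I0 : C' `&` (A `|` C) != fset0.
  have [S [tS SB bS [c cC' cS]]] := good_triple (gF _ C'F) b0B.
  have /orP[SD|SE] := free tS (fsubset_trans SB (BC' _ C'F)).
    by rewrite (fsubsetP SD _ bS) in b0D.
  by apply/fset0Pn; exists c; rewrite in_fsetI cC' (fsubsetP SE).
have ne : C' `&` (A `|` C) != C' by apply: contraNneq nC'E => <-; apply: fsubsetIr.
have := mC' _ (fsubsetIl _ _) I0 ne.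
have := amalgam_geE (BC' _ C'F).
have -> : (B `|` C') `&` (A `|` C) = B `|` C' `&` (A `|` C) by fset_tac.
rewrite eC' => /(_ _)/Wrap[|]; last by clear; lia.
apply: leq_trans (cF' _ C'F); apply: fsubset_leq_card.
have d := amalgam_disj; clear dC2D; fset_tac.
Qed.

End Amalgam.

(* The free amalgam of M and A `|` C over A, where f embeds A in M. *)
Section Pushout.
Variables (M N : hstruct) (A C : {fset N}) (f : N -> M).
Hypotheses (emb : embedding_on A f) (dAC : [disjoint A & C]).

Definition po_left (u : M + N) : option M := if u is inl x then Some x else None.

(** A point of M is seen from N as its preimage under f in A, found by search; injectivity of f
    makes it unique. *)
Definition po_right (u : M + N) : option N :=
  match u with
  | inl x => ohead [seq a <- enum_fset A | f a == x]
  | inr y => if y \in C then Some y else None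
  end.

Definition po_lift (K : hstruct) (p : M + N -> option K) (u v w : M + N) : bool :=
  match p u, p v, p w with
  | Some x, Some y, Some z => hR x y z
  | _, _, _ => false
  end.

Definition po_R u v w := po_lift po_left u v w || po_lift po_right u v w.

Lemma po_distinct u v w : po_R u v w -> [/\ u != v, u != w & v != w].
Proof.
have H (K : hstruct) (p : M + N -> option K) :
    po_lift p u v w -> [/\ u != v, u != w & v != w].
  rewrite /po_lift; case eu: (p u) => [x|//]; case ev: (p v) => [y|//].
  case ew: (p w) => [z|//] /hR_distinct[xy xz yz]; split.
  - by apply: contra_neq xy => e; apply: Some_inj; rewrite -eu -ev e.
  - by apply: contra_neq xz => e; apply: Some_inj; rewrite -eu -ew e.
  - by apply: contra_neq yz => e; apply: Some_inj; rewrite -ev -ew e.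
by case/orP => /H.
Qed.

Lemma po_swap12 u v w : po_R u v w = po_R v u w.
Proof.
have H (K : hstruct) (p : M + N -> option K) : po_lift p u v w = po_lift p v u w.
  rewrite /po_lift; case: (p u) (p v) (p w) => [x|] [y|] [z|] //; exact: hR_swap12.
by rewrite /po_R !H.
Qed.

Lemma po_swap23 u v w : po_R u v w = po_R u w v.
Proof.
have H (K : hstruct) (p : M + N -> option K) : po_lift p u v w = po_lift p u w v.
  rewrite /po_lift; case: (p u) (p v) (p w) => [x|] [y|] [z|] //; exact: hR_swap23.
by rewrite /po_R !H.
Qed.

(** The carrier is the whole disjoint sum. The points [inr y] with y outside C are on no triple, and
    a point of A is represented by its image in M. *)
Definition pushout := HStruct po_distinct po_swap12 po_swap23.

Definition po_inl (x : M) : pushout := inl x.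
Definition po_inr (y : N) : pushout := if y \in A then inl (f y) else inr y.
Definition po_outl (x0 : M) (u : pushout) : M := if u is inl x then x else x0.

Lemma po_right_inr y : y \in A `|` C -> po_right (po_inr y) = Some y.
Proof.
rewrite inE /po_inr; case yA: (y \in A) => /= yC; last by rewrite yC.
case E: [seq a <- _ | _] => [|a s] /=.
  have : y \in [seq a <- enum_fset A | f a == f y].
    by rewrite mem_filter eqxx; exact: yA.
  by rewrite E.
have : a \in [seq a <- enum_fset A | f a == f y] by rewrite E mem_head.
by rewrite mem_filter => /andP[/eqP e aA]; case: emb => inj _; rewrite (inj a y).
Qed.

Lemma po_right_Some u y : po_right u = Some y -> u = po_inr y /\ y \in A `|` C.
Proof.
case: u => [x|z] /=; last first.
  case: ifP => // zC [<-]; rewrite /po_inr inE zC orbT.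
  by case: ifP => // zA; move/fdisjointP/(_ z zA): dAC; rewrite zC.
case E: [seq a <- _ | _] => [//|a s] /= [<-].
have : a \in [seq a <- enum_fset A | f a == x] by rewrite E mem_head.
by rewrite mem_filter /po_inr inE => /andP[/eqP e aA]; rewrite [a \in A]aA e.
Qed.

Lemma po_inr_in y : y \in A -> po_inr y = po_inl (f y).
Proof. by rewrite /po_inr => ->. Qed.

Lemma po_inr_out x y : y \in C -> po_inr y != po_inl x.
Proof.
move=> yC; rewrite /po_inr; case: ifP => // yA.
by move/fdisjointP/(_ y yA): dAC; rewrite yC.
Qed.

Lemma po_inl_emb D : embedding_on D po_inl.
Proof.
split=> [x y _ _ [] //|x y z _ _ _]; rewrite /= /po_R /= /po_lift /=.
apply/idP/idP => [|->//]; case/orP => //.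
case ex: (ohead _) => [a|//]; case ey: (ohead _) => [b|//]; case ez: (ohead _) => [c|//].
have H t d : ohead [seq a <- enum_fset A | f a == t] = Some d -> d \in A /\ f d = t.
  case E: [seq a <- _ | _] => [//|a' s] /= [<-].
  have : a' \in [seq a <- enum_fset A | f a == t] by rewrite E mem_head.
  by rewrite mem_filter => /andP[/eqP].
have [aA <-] := H _ _ ex; have [bA <-] := H _ _ ey; have [cA <-] := H _ _ ez.
by case: emb => _ ->.
Qed.

Lemma po_inr_emb : embedding_on (A `|` C) po_inr.
Proof.
split=> [x y xE yE e|x y z xE yE zE].
  by apply: Some_inj; rewrite -!po_right_inr // e.
rewrite /= /po_R {2}/po_lift !po_right_inr //.
apply/idP/idP => [|->]; last by rewrite orbT.
case/orP => //; rewrite /po_lift /po_inr.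
case: ifP => //= xA; case: ifP => //= yA; case: ifP => //= zA.
by case: emb => _ ->.
Qed.

Lemma po_triple (S : {fset pushout}) : is_triple S ->
  (forall u, u \in S -> exists x, u = po_inl x) \/ S `<=` po_inr @` (A `|` C).
Proof.
case/is_tripleP => u [v [w [/orP[]]]]; rewrite /po_lift => R ->; [left | right].
  case: u v w R => [u|?] [v|?] [w|?] //= _ t; rewrite !inE -!orbA.
  by case/or3P=> /eqP ->; [exists u | exists v | exists w].
move: R; case eu: (po_right u) => [x|//]; case ev: (po_right v) => [y|//].
case ew: (po_right w) => [z|//] _.
have [-> xE] := po_right_Some eu; have [-> yE] := po_right_Some ev.
have [-> zE] := po_right_Some ew.
by rewrite !fsubUset !fsub1set !in_img.
Qed.

End Pushout.

(** * Extension property of the generic *)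

Section Generic.
Variables (mu : mu_function) (G : hstruct).
Hypothesis hG : is_generic mu G.
Implicit Types (A B C D X Y Z : {fset G}).

Lemma gen_Kmu A : Kmu mu A.
Proof.
have [[c [Kc sc cov]] _] := hG.
have mono k n : (k <= n)%N -> c k `<=` c n.
  move=> /subnKC <-; elim: (n - k)%N => [|j IH]; first by rewrite addn0 fsubset_refl.
  by rewrite addnS; apply: fsubset_trans IH _; have [] := sc (k + j)%N.
have [n sub] : exists n, A `<=` c n.
  suff [n H] : exists n, {subset enum_fset A <= c n} by exists n; apply/fsubsetP.
  elim: (enum_fset A) => [|x s [n H]]; first by exists 0%N.
  have [k xk] := cov x; exists (maxn k n) => y; rewrite inE => /orP[/eqP->|/H yn].
    by apply: (fsubsetP (mono _ _ (leq_maxl k n))).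
  by apply: (fsubsetP (mono _ _ (leq_maxr k n))).
exact: Kmu_sub sub (Kc n).
Qed.

Lemma gen_K0 A : K0 A.
Proof. by have [] := gen_Kmu A. Qed.
Arguments gen_K0 : clear implicits.

Lemma gen_hull A : exists2 D, A `<=` D & strong_in D.
Proof. exact: K0_hull gen_K0 A. Qed.

Definition nstrong n A := forall X, (#|` X| <= n)%N -> delta A <= delta (A `|` X).

Lemma nstrong_mono k n A : (k <= n)%N -> nstrong n A -> nstrong k A.
Proof. by move=> kn h X c; apply: h; apply: leq_trans kn. Qed.

Lemma strong_in_nstrong n A : strong_in A -> nstrong n A.
Proof. by move=> h X _; apply: h; apply: fsubsetUl. Qed.

(** A test set X for A [|] C is the test set C [|] X for A, which costs |C| units of strength. *)
Lemma nstrong_ext n A C : nstrong n A -> delta (A `|` C) <= delta A ->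
  nstrong (n - #|` C|) (A `|` C).
Proof.
move=> h le X c; rewrite -fsetUA.
(* If |C| > n the truncated difference is 0, and only the empty set is tested. *)
have [nC|Cn] := ltnP n #|` C|; last first.
  apply: le_trans le _; apply: h.
  have := cardfsUI C X; lia.
have -> : X = fset0 by apply/cardfs0_eq; lia.
by rewrite fsetU0.
Qed.

(** A strong hull D of the image of A is amalgamated freely with A [|] C. Either D already contains
    a suitable copy of C, or the amalgam is in K_mu, D is strong in it, and genericity embeds it
    over D. *)
Lemma min_extension_step (N : hstruct) (n : nat) (A C : {fset N}) (f : N -> G) :
  Kmu mu (A `|` C) ->
  [disjoint A & C] -> C != fset0 -> delta A <= delta (A `|` C) ->
  (forall X : {fset N}, X `<=` C -> X != fset0 -> X != C -> delta A < delta (A `|` X)) ->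
  embedding_on A f -> nstrong n (f @` A) -> (#|` C| <= n)%N -> (3 <= n)%N ->
  exists f', [/\ embedding_on (A `|` C) f', {in A, f' =1 f} &
                 nstrong (n - #|` C|) (f' @` (A `|` C))].
Proof.
move=> KAC dAC C0 leE minE emb strA cC n3.
have [D AD sD] := gen_hull (f @` A).
pose P := pushout A C f.
pose i : G -> P := po_inl A C f; pose e : N -> P := po_inr A C f.
have embi X : embedding_on X i by apply: po_inl_emb.
have di X : delta (i @` X) = delta X := emb_delta (embi X) (fsubset_refl X).
have ci X : #|` i @` X| = #|` X| := emb_card (embi X) (fsubset_refl X).
have embe : embedding_on (A `|` C) e by apply: po_inr_emb.
have eA x : x \in A -> e x = i (f x) by apply: po_inr_in.
have iinj x y : i x = i y -> x = y by case.
have sA : A `<=` A `|` C by apply: fsubsetUl.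
have sC : C `<=` A `|` C by apply: fsubsetUr.
have eAf : e @` A = i @` (f @` A) by rewrite img_comp; apply: eq_in_imfset => x /eA.
pose A' := e @` A; pose C' := e @` C; pose D' := i @` D.
have eE : A' `|` C' = e @` (A `|` C) by rewrite imfsetU.
have AD' : A' `<=` D' by rewrite /A' eAf; apply: img_subset.
have dCD' : [disjoint C' & D'].
  apply/fdisjointP => u /imfsetP[y /= yC ->]; apply/negP => /imfsetP[x /= _].
  by apply/eqP; apply: po_inr_out.
have free (S : {fset P}) : is_triple S -> S `<=` D' `|` C' ->
    (S `<=` D') || (S `<=` A' `|` C').
  move=> tS SDC; case: (po_triple dAC tS) => [h|h]; last by rewrite eE h orbT.
  apply/orP; left; apply/fsubsetP => u uS; have [x ex] := h u uS.
  have := fsubsetP SDC u uS; rewrite inE => /orP[//|/imfsetP[y /= yC]].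
  by rewrite ex => /esym/eqP; rewrite (negbTE (po_inr_out f dAC x yC)).
have KD : Kmu mu D' by apply: Kmu_img => //; apply: gen_Kmu.
have KE : Kmu mu (A' `|` C') by rewrite eE; apply: Kmu_img.
have dA' (X : {fset N}) : X `<=` C -> delta (A' `|` e @` X) = delta (A `|` X).
  by move=> XC; rewrite -imfsetU (emb_delta embe) //; apply: fsetUS.
have dA0 : delta A' = delta A by rewrite (emb_delta embe).
have dfA : delta (f @` A) = delta A by rewrite (emb_delta emb).
have cC' : #|` C'| = #|` C| by rewrite (emb_card embe).
have strA' (X : {fset P}) : X `<=` D' -> (#|` X| <= n)%N -> delta A' <= delta (A' `|` X).
  move=> XD c; have [Y YD eX] := emb_preim XD.
  rewrite dA0 eX /A' eAf -imfsetU di -dfA; apply: strA.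
  by rewrite -ci -eX.
have C'0 : C' != fset0 by rewrite -cardfs_gt0 cC' cardfs_gt0.
have leE' : delta A' <= delta (A' `|` C') by rewrite dA0 dA'.
have minE' (X : {fset P}) : X `<=` C' -> X != fset0 -> X != C' -> delta A' < delta (A' `|` X).
  move=> XC X0 XneC; have [Y YC eX] := emb_preim XC.
  rewrite dA0 eX dA' //; apply: minE => //.
    by rewrite -cardfs_gt0 -(emb_card embe) -?eX ?cardfs_gt0 // (fsubset_trans YC sC).
  by apply: contra_neq XneC => e'; rewrite eX e'.
have cCn : (#|` C'| <= n)%N by rewrite cC'.
(* A copy in D serves as the image of C; strength then drops by |C| through [nstrong_ext]. *)
have [[le [X [XD [phi [embp idp eX]]]]]|no_copy] := pselect
    (delta (A' `|` C') <= delta A' /\ exists X : {fset P}, X `<=` D' /\ copy_over A' C' X).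
  have /fset0Pn[c0 c0C] := C0.
  have /imfsetP[x0 _ _] : phi (e c0) \in i @` D.
    by apply: (fsubsetP XD); rewrite -eX; apply/in_img/in_img.
  pose f' x := po_outl x0 (phi (e x)).
  have embo Y : embedding_on (i @` Y) (po_outl x0 : P -> G).
    split=> [u v|u v w].
      by move=> /imfsetP[a /= _ ->] /imfsetP[b /= _ ->] /= ->.
    move=> /imfsetP[a /= aY ->] /imfsetP[b /= bY ->] /imfsetP[c /= cY ->].
    by have [_ hom] := embi Y; apply/esym/hom.
  have embf' : embedding_on (A `|` C) f'.
    apply: (emb_comp (f := e) (g := (fun u => po_outl x0 (phi u)) : P -> G)) => //.
    apply: (emb_comp (f := phi) (g := po_outl x0 : P -> G)); first by rewrite -eE.
    apply: emb_subset (embo D); rewrite -eE imfsetU (img_id idp) fsubUset AD'.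
    by rewrite eX.
  have f'A : {in A, f' =1 f}.
    by move=> x xA; rewrite /f' idp ?in_img // eA.
  exists f'; split=> //; have -> : #|` C| = #|` f' @` C| by rewrite (emb_card embf').
  rewrite imfsetU; have -> : f' @` A = f @` A by apply: eq_in_imfset.
  apply: nstrong_ext => //.
  have <- : f' @` A = f @` A by apply: eq_in_imfset.
  by rewrite -imfsetU !(emb_delta embf') // -dA0 -(dA' C).
have no_copy' : delta (A' `|` C') <= delta A' -> forall X : {fset P}, X `<=` D' -> ~ copy_over A' C' X.
  by move=> le X XD cX; apply: no_copy; split=> //; exists X.
have K := amalgam_Kmu AD' dCD' free KD KE leE' minE' strA' C'0 cCn n3 no_copy'.
have [_ ext] := hG.
have stD : strong D' (D' `|` C').
  split=> [|Z DZ ZDC]; first exact: fsubsetUl.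
  have := amalgam_geD AD' dCD' free leE' minE' ZDC.
  by have -> : Z `&` D' = D' by clear -DZ; fset_tac.
have [g [embg gi sg]] := ext D P (D' `|` C') i (gen_Kmu D) K (embi D) stD sD.
exists (fun x => g (e x)).
have sE : e @` (A `|` C) `<=` D' `|` C'.
  by rewrite imfsetU fsubUset fsubsetUr andbT; apply: fsubset_trans AD' (fsubsetUl _ _).
have embge : embedding_on (A `|` C) (fun x => g (e x)).
  by apply: emb_comp => //; apply: emb_subset embg.
split=> //.
  by move=> x xA; rewrite eA // gi // (fsubsetP AD) // in_img.
apply: (@nstrong_mono _ n); first exact: leq_subr.
move=> X c.
have eD : g @` D' = D by rewrite img_comp; apply: img_id => x xD; apply: gi.
have eW : (fun x => g (e x)) @` (A `|` C) = f @` A `|` g @` C'.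
  rewrite -img_comp imfsetU imfsetU -/A' -/C'; congr (_ `|` _).
  rewrite /A' eAf img_comp; apply: img_id => x xA.
  by apply: gi; apply: (fsubsetP AD).
have eT : g @` (D' `|` C') = D `|` g @` C' by rewrite imfsetU eD.
have dD : [disjoint g @` C' & D].
  by rewrite -eD (emb_disj embg) // ?fsubsetUl ?fsubsetUr.
have eTd : delta (D `|` g @` C') = delta (D' `|` C') by rewrite -eT (emb_delta embg).
have eDd : delta D = delta D' by rewrite di.
have eP := amalgam_delta AD' dCD' free (fsubset_refl (D' `|` C')).
have i1 : (D' `|` C') `&` A' = A' by fset_tac.
have i2 : (D' `|` C') `&` D' = D' by fset_tac.
have i3 : (D' `|` C') `&` (A' `|` C') = A' `|` C' by fset_tac.
rewrite i1 i2 i3 in eP.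
rewrite (emb_delta embge) // eW.
rewrite eT in sg.
have h1 : delta (f @` A) <= delta (f @` A `|` (X `&` D)).
  apply: strA; apply: leq_trans c; apply: fsubset_leq_card; exact: fsubsetIl.
have h2 := sg ((f @` A `|` g @` C' `|` X) `|` (D `|` g @` C')) (fsubsetUr _ _).
have h3 := delta_submod (f @` A `|` g @` C' `|` X) (D `|` g @` C').
have h4 := delta_submod ((f @` A `|` g @` C' `|` X) `&` (D `|` g @` C')) D.
have u1 : (f @` A `|` g @` C' `|` X) `&` (D `|` g @` C') `|` D = D `|` g @` C'.
  by clear -AD dD; fset_tac.
have u2 : (f @` A `|` g @` C' `|` X) `&` (D `|` g @` C') `&` D = f @` A `|` (X `&` D).
  by clear -AD dD; fset_tac.
rewrite u1 u2 in h4.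
have d1 := dA' _ (fsubset_refl C).
rewrite -/C' in d1.
clear -h1 h2 h3 h4 eP eTd eDd dA0 dfA d1; lia.
Qed.

(* A strong extension is a tower of minimal ones, each of which extends f. *)
Lemma strong_extension m A B (f : G -> G) : strong A B -> embedding_on A f ->
  nstrong (m + #|` B `\` A|) (f @` A) -> (3 <= m)%N ->
  exists f', [/\ embedding_on B f', {in A, f' =1 f} & nstrong m (f' @` B)].
Proof.
have [k] := ubnP #|` B `\` A|; elim: k A f => // k IH A f ck [AB sAB] emb strA m3.
have [eBA|BA0] := eqVneq (B `\` A) fset0.
  have e : B = A.
    apply/eqP; rewrite eqEfsubset AB andbT; apply/fsubsetP => x xB.
    by apply/negPn/negP => xA; have := in_fset0 x; rewrite -eBA !inE xA xB.
  by rewrite e; exists f; split=> //; move: strA; rewrite eBA cardfs0 addn0.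
suff [C [CBA C0 leE minE sC]] : exists C, [/\ C `<=` B `\` A, C != fset0,
    delta A <= delta (A `|` C),
    forall X, X `<=` C -> X != fset0 -> X != C -> delta A < delta (A `|` X) &
    strong (A `|` C) B].
  have dAC : [disjoint A & C] by fset_tac.
  have cC := fsubset_leq_card CBA.
  have C1 : (0 < #|` C|)%N by rewrite cardfs_gt0.
  have [||f1 [emb1 f1f str1]] := min_extension_step (gen_Kmu _) dAC C0 leE minE emb strA.
  - by clear -cC; lia.
  - by clear -m3; lia.
  have cD : #|` B `\` (A `|` C)| = (#|` B `\` A| - #|` C|)%N.
    by rewrite -cardfsDS //; congr (size (enum_fset _)); fset_tac.
  have [|//|//||//|f2 [emb2 f2f1 str2]] := IH (A `|` C) f1.
  - by clear -cD C1 ck cC; lia.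
  - by rewrite cD; apply: nstrong_mono str1; clear -cC; lia.
  exists f2; split=> // x xA; rewrite f2f1 ?inE ?xA //; exact: f1f.
(* The first step of the tower is a minimal part of relative dimension at most 0 if there is one,
   and otherwise a single point of relative dimension 1. *)
have [[C [CBA C0 leC]]|noC] := pselect (exists C,
    [/\ C `<=` B `\` A, C != fset0 & delta (A `|` C) <= delta A]).
  have [C1 [C1C [C10 leC1] minC1]] :=
    @min_fset G (fun X => X != fset0 /\ delta (A `|` X) <= delta A) C (conj C0 leC).
  have C1BA := fsubset_trans C1C CBA.
  exists C1; split=> //.
  - by apply: sAB; [apply: fsubsetUl | fset_tac].
  - move=> X XC1 X0 XneC; rewrite ltNge; apply/negP => leX; apply: (minC1 X) => //.
    by rewrite fproperEneq XneC.
  - split=> [|Z ACZ ZB]; first by fset_tac.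
    by apply: le_trans leC1 _; apply: sAB => //; apply: fsubset_trans ACZ; apply: fsubsetUl.
have /fset0Pn[x xBA] := BA0; exists [fset x].
have xB : [fset x] `<=` B `\` A by rewrite fsub1set.
split=> //.
- by rewrite -cardfs_gt0 cardfs1.
- by apply: sAB; [apply: fsubsetUl | fset_tac].
- by move=> X; rewrite fsubset1 => /orP[->//|/eqP->]; rewrite eqxx.
split=> [|Z AxZ ZB]; first by fset_tac.
have h : ~~ (delta Z <= delta A).
  apply/negP => le; apply: noC; exists (Z `\` A); split.
  - by fset_tac.
  - apply/fset0Pn; exists x; move: xBA; rewrite !inE => /andP[-> _].
    by rewrite (fsubsetP AxZ) // !inE eqxx orbT.
  - by have -> : A `|` Z `\` A = Z by fset_tac.
have := deltaU1 A x; rewrite fsetUC; clear -h; lia.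
Qed.

End Generic.

Arguments gen_K0 {mu G} hG A.

(** * Back and forth *)

Lemma vcons_map (T U : Type) (f : T -> U) n (x : T) (v : 'I_n -> T) :
  (fun i => f (vcons x v i)) = vcons (f x) (fun i => f (v i)).
Proof. by apply: funext => i; rewrite /vcons; case: unlift. Qed.

Section EF.
Variables (mu : mu_function) (G : hstruct).
Hypothesis hG : is_generic mu G.
Implicit Types (A B X : {fset G}).

(** Either x keeps n0-strength, or x and at most n0 further points have relative dimension at most
    0, and adding them all costs at most n0 + 1 units. The constant 4 is 1 for x and 3 reserved for
    amalgamation. *)
Lemma forth n0 n1 A (f : G -> G) x :
  embedding_on A f -> nstrong (n0 + n1 + 4) A -> nstrong (n0 + n1 + 4) (f @` A) ->
  exists B f', [/\ A `<=` B, x \in B, embedding_on B f', {in A, f' =1 f} &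
    [/\ #|` B| <= #|` A|.+1, nstrong n0 B & nstrong n0 (f' @` B)]%N \/
    [/\ #|` B| <= #|` A| + n0.+1, nstrong n1 B & nstrong n1 (f' @` B)]%N].
Proof.
move=> emb sA sfA.
have strB C : (#|` C| <= n0.+1)%N -> strong A (A `|` C).
  move=> cC; split=> [|Z AZ ZC]; first exact: fsubsetUl.
  have -> : Z = A `|` (Z `&` C) by fset_tac.
  apply: sA; have := fsubset_leq_card (fsubsetIr Z C).
  by clear -cC; lia.
have ext m C : (#|` C| <= n0.+1)%N -> (m + #|` C| <= n0 + n1 + 1)%N ->
    exists f', [/\ embedding_on (A `|` C) f', {in A, f' =1 f} &
      nstrong m (f' @` (A `|` C))].
  move=> cC cm; have [||f' [e1 e2 e3]] :=
      @strong_extension mu G hG (m + 3) A _ f (strB C cC) emb.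
  - apply: nstrong_mono sfA.
    have : (#|` (A `|` C) `\` A| <= #|` C|)%N by apply: fsubset_leq_card; fset_tac.
    by clear -cm; lia.
  - by clear; lia.
  by exists f'; split=> //; apply: nstrong_mono e3; apply: leq_addr.
have [s0|/existsNP[X /not_implyP[cX /negP]]] := pselect (nstrong n0 (A `|` [fset x])).
  have [||f' [e1 e2 e3]] := ext n0 [fset x]; rewrite ?cardfs1 //; first by lia.
  exists (A `|` [fset x]), f'; split=> //.
  - exact: fsubsetUl.
  - by rewrite !inE eqxx orbT.
  left; split=> //; have := cardfsUI A [fset x]; rewrite cardfs1; lia.
rewrite -ltNge -fsetUA => lt; set C := [fset x] `|` X in lt.
have cC : (#|` C| <= n0.+1)%N.
  by have := cardfsUI [fset x] X; rewrite -/C cardfs1; move: cX; clear; lia.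
have leC : delta (A `|` C) <= delta A.
  by have := deltaU1 A x; rewrite fsetUC; move: lt; clear; lia.
have [||f' [e1 e2 e3]] := ext n1 C => //; first by clear -cC; lia.
exists (A `|` C), f'; split=> //.
- exact: fsubsetUl.
- by rewrite !inE eqxx /= orbT.
right; split=> //; first by have := cardfsUI A C; clear -cC; lia.
by apply: nstrong_mono (nstrong_ext sA leC); clear -cC; lia.
Qed.

(* Uniformity of n in A, f and v is what replaces saturation. *)
Lemma sat_nstrong k (phi : formula k) : forall K, exists n, forall A (f : G -> G) (v : 'I_k -> G),
  (#|` A| <= K)%N -> embedding_on A f -> nstrong n A -> nstrong n (f @` A) ->
  (forall i, v i \in A) -> sat phi v <-> sat phi (fun i => f (v i)).
Proof.
elim: phi => {k} [k i j|k i j l|k|k p IHp q IHq|k p IH] K.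
- exists 0%N => A f v _ [inj _] _ _ vA /=.
  by split=> [->//|e]; apply: inj e.
- exists 0%N => A f v _ [_ hom] _ _ vA /=.
  by rewrite hom.
- by exists 0%N.
- have [n Hp] := IHp K; have [n' Hq] := IHq K.
  exists (maxn n n') => A f v cA emb sA sfA vA /=.
  have m1 X : nstrong (maxn n n') X -> nstrong n X by apply: nstrong_mono; apply: leq_maxl.
  have m2 X : nstrong (maxn n n') X -> nstrong n' X by apply: nstrong_mono; apply: leq_maxr.
  have [h1 h1'] := Hp A f v cA emb (m1 _ sA) (m1 _ sfA) vA.
  have [h2 h2'] := Hq A f v cA emb (m2 _ sA) (m2 _ sfA) vA.
  by split=> h hp; [exact: h2 (h (h1' hp)) | exact: h2' (h (h1 hp))].
(* The two outcomes of [forth]: one new point with strength n0, or n0 + 1 new points with strength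
   n1. Hence n0 is fixed first and n1 depends on it. *)
have [n0 H0] := IH K.+1; have [n1 H1] := IH (K + n0.+1)%N.
exists (n0 + n1 + 4)%N.
have half A (f : G -> G) (v : 'I_k -> G) : (#|` A| <= K)%N -> embedding_on A f ->
    nstrong (n0 + n1 + 4) A -> nstrong (n0 + n1 + 4) (f @` A) ->
    (forall i, v i \in A) -> sat (FAll p) (fun i => f (v i)) -> sat (FAll p) v.
  move=> cA emb sA sfA vA /= Hv x.
  have [B [f' [AB xB emb' f'f H]]] := forth x emb sA sfA.
  have vB i : vcons x v i \in B.
    by rewrite /vcons; case: unlift => //= j; apply: (fsubsetP AB).
  have e : (fun i => f' (vcons x v i)) = vcons (f' x) (fun i => f (v i)).
    by rewrite vcons_map; congr vcons; apply: funext => i; apply: f'f.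
  case: H => -[cB sB sf'B].
    apply/(H0 B f' _ _ emb' sB sf'B vB); last by rewrite e; apply: Hv.
    by apply: leq_trans cB _.
  apply/(H1 B f' _ _ emb' sB sf'B vB); last by rewrite e; apply: Hv.
  by apply: leq_trans cB _; rewrite leq_add2r.
move=> A f v cA emb sA sfA vA; split; last exact: half cA emb sA sfA vA.
(* The other implication is [half] applied to the inverse of f. *)
move=> Hv x; have [g [embg gf]] := emb_inverse emb x.
have gA : g @` (f @` A) = A by rewrite img_comp; apply: img_id.
apply: (half (f @` A) g) => //.
- by rewrite (emb_card emb).
- by rewrite gA.
- by move=> i; apply: in_img.
by move: Hv; congr (sat (FAll p) _); apply: funext => i; rewrite gf.
Qed.

End EF.

(** * Uniform bounds on definable sets *)

Lemma fset_of_bounded (T : choiceType) (P : T -> Prop) b :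
  (forall F : {fset T}, (forall x, x \in F -> P x) -> (#|` F| <= b)%N) ->
  exists F : {fset T}, (#|` F| <= b)%N /\ forall x, x \in F <-> P x.
Proof.
move=> H; apply: contrapT => noF.
suff [F [FP cF]] : exists F : {fset T}, (forall x, x \in F -> P x) /\ #|` F| = b.+1.
  by have := H F FP; rewrite cF ltnn.
elim: b.+1 => [|k [F [FP cF]]]; first by exists fset0; rewrite cardfs0; split.
have [x [Px xF]] : exists x, P x /\ x \notin F.
  apply: contrapT => nox; apply: noF; exists F; split; first exact: H.
  move=> x; split=> [/FP//|Px]; apply/negPn/negP => xF.
  by apply: nox; exists x.
exists (x |` F); rewrite cardfsU1 xF cF; split=> // y.
by rewrite !inE => /orP[/eqP->|/FP].
Qed.

Lemma card_le_fibers (T U : choiceType) (h : T -> U) (s : seq U) b (F : {fset T}) :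
  (forall x, x \in F -> h x \in s) ->
  (forall u (F' : {fset T}), u \in s -> F' `<=` F -> (forall x, x \in F' -> h x = u) ->
     (#|` F'| <= b)%N) ->
  (#|` F| <= size s * b)%N.
Proof.
elim: s F => [|u s IH] F hF fib.
  have -> : F = fset0 by apply/fsetP => x; rewrite inE; apply/negP => /hF.
  by rewrite cardfs0.
pose F1 := [fset x in F | h x == u]; pose F2 := [fset x in F | h x != u].
have e : F = F1 `|` F2 by apply/fsetP => x; rewrite !inE; case: (h x == u); rewrite ?andbT ?andbF ?orbF.
have F1F : F1 `<=` F by rewrite e fsubsetUl.
have F2F : F2 `<=` F by rewrite e fsubsetUr.
rewrite /= mulSn; apply: (@leq_trans (#|` F1| + #|` F2|)).
  by rewrite {1}e; have := cardfsUI F1 F2; lia.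
apply: leq_add.
  by apply: (fib u) => //; [rewrite mem_head | move=> x; rewrite !inE => /andP[_ /eqP]].
apply: IH => [x|u' F' u's F'F2 hF'].
  by rewrite !inE => /andP[/hF]; rewrite inE => /orP[->|].
by apply: (fib u') => //; [rewrite inE u's orbT | apply: fsubset_trans F2F].
Qed.

(** * Finitely many isomorphism types of pairs of bounded size *)

Section Codes.
Variables K m : nat.

Definition codeT : finType :=
  ('I_K.+1 * 'I_m.+1 * {ffun 'I_(K + m) * 'I_(K + m) * 'I_(K + m) -> bool})%type.

(** The two sizes and the relation table in enumeration order. Positions past the end of the list
    read the default [x0], which does not disturb the comparison of the actual positions. *)
Definition code (M : hstruct) (x0 : M) (B C : {fset M}) : codeT :=
  let s := enum_fset B ++ enum_fset C in
  (inord #|` B|, inord #|` C|,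
   [ffun t : 'I_(K + m) * 'I_(K + m) * 'I_(K + m) =>
      hR (nth x0 s t.1.1) (nth x0 s t.1.2) (nth x0 s t.2)]).

(** The isomorphism matches points by position. The last clause makes it the identity on B when the
    two bases coincide, so that equal codes over one base give copies over it. *)
Lemma code_iso (M N : hstruct) (x0 : M) (y0 : N) (B C : {fset M}) (B' C' : {fset N}) :
  (#|` B| <= K)%N -> (#|` C| <= m)%N -> (#|` B'| <= K)%N -> (#|` C'| <= m)%N ->
  [disjoint B & C] -> [disjoint B' & C'] -> code x0 B C = code y0 B' C' ->
  exists f : M -> N, [/\ embedding_on (B `|` C) f, f @` B = B', f @` C = C' &
    {in B, forall x, f x = nth y0 (enum_fset B') (index x (enum_fset B))}].
Proof.
move=> cB cC cB' cC' d d' [].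
move=> /(congr1 (@nat_of_ord _)); rewrite !inordK // => eB.
move=> /(congr1 (@nat_of_ord _)); rewrite !inordK // => eC.
move=> /ffunP tab.
set s := enum_fset B ++ enum_fset C in tab.
set s' := enum_fset B' ++ enum_fset C' in tab.
have us (Q : hstruct) (X Y : {fset Q}) : [disjoint X & Y] -> uniq (enum_fset X ++ enum_fset Y).
  move=> dXY; rewrite cat_uniq !fset_uniq andbT /=; apply/hasPn => x xY.
  by rewrite fdisjoint_sym in dXY; apply: (fdisjointP dXY).
have uss := us _ _ _ d; have uss' := us _ _ _ d'.
have ss : size s = size s' by rewrite !size_cat eB eC.
have sKm : (size s <= K + m)%N by rewrite size_cat leq_add.
pose f x := nth y0 s' (index x s).
have fB x : x \in B -> f x = nth y0 (enum_fset B') (index x (enum_fset B)).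
  by move=> xB; rewrite /f /s /s' index_cat xB nth_cat -eB index_mem xB.
have fC x : x \in C -> f x = nth y0 (enum_fset C') (index x (enum_fset C)).
  move=> xC; rewrite /f /s /s' index_cat nth_cat -eB.
  have -> : (x \in enum_fset B) = false.
    by apply/negP => xB; move/fdisjointP/(_ x xB): d; rewrite xC.
  by rewrite ltnNge leq_addr /= addKn.
have fBC x : x \in B `|` C -> x \in s by rewrite inE mem_cat.
have emb : embedding_on (B `|` C) f.
  split=> [x y /fBC xs /fBC ys /eqP|x y z /fBC xs /fBC ys /fBC zs].
    rewrite nth_uniq -?ss ?index_mem // => /eqP e.
    by rewrite -(nth_index x0 xs) e nth_index.
  have lt u : u \in s -> (index u s < K + m)%N.
    by move=> us'; apply: leq_trans sKm; rewrite index_mem.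
  have := tab (Ordinal (lt _ xs), Ordinal (lt _ ys), Ordinal (lt _ zs)).
  by rewrite !ffunE /= !nth_index // => ->.
exists f; split=> //.
- apply/eqP; rewrite eqEfcard (emb_card emb) ?fsubsetUl // eB leqnn andbT.
  apply/fsubsetP => y /imfsetP[x /= xB ->]; rewrite fB // mem_nth //.
  have lt : (index x (enum_fset B) < #|` B|)%N by rewrite index_mem.
  by rewrite eB in lt.
- apply/eqP; rewrite eqEfcard (emb_card emb) ?fsubsetUr // eC leqnn andbT.
  apply/fsubsetP => y /imfsetP[x /= xC ->]; rewrite fC // mem_nth //.
  have lt : (index x (enum_fset C) < #|` C|)%N by rewrite index_mem.
  by rewrite eC in lt.
Qed.

(** By invariance [mu] takes at most one value per code, and there are finitely many codes; the sum
    of one bound per code bounds all values. *)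
Lemma mu_bounded (mu : mu_function) : exists b, forall (M : hstruct) (B C : {fset M}),
  good B C -> (#|` B| <= K)%N -> (#|` C| <= m)%N -> (mu M B C <= b)%N.
Proof.
pose Q (t : codeT) (v : nat) := exists (M : hstruct) (x0 : M) (B C : {fset M}),
  [/\ good B C, (#|` B| <= K)%N, (#|` C| <= m)%N, code x0 B C = t & mu M B C = v].
have ex t : exists u, forall v, Q t v -> (v <= u)%N.
  have [[u Qu]|noQ] := pselect (exists u, Q t u); last first.
    by exists 0%N => v Qv; case: noQ; exists v.
  exists u => _ [N [y0 [B' [C' [g' cB' cC' e' <-]]]]].
  case: Qu => [M [x0 [B [C [g cB cC e <-]]]]].
  have [[_ d _ _] _ _] := g; have [[_ d' _ _] _ _] := g'.
  have [f [emb fB fC _]] := code_iso cB cC cB' cC' d d' (etrans e (esym e')).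
  rewrite (@mu_iso mu M N B C B' C') //; [exact/good_pairP | exact/good_pairP|].
  by exists f.
have [U HU] := choice ex.
exists (\sum_t U t)%N => M B C g cB cC.
have [[/fset0Pn[x0 _] _ _ _] _ _] := g.
apply: leq_trans (HU (code x0 B C) _ _) _; first by exists M, x0, B, C.
by rewrite (bigD1 (code x0 B C)) //= leq_addr.
Qed.

End Codes.

Section Bounds.
Variables (mu : mu_function) (G : hstruct).
Hypothesis hG : is_generic mu G.
Implicit Types (A B C S X Y : {fset G}) (F : {fset {fset G}}).

(** Members with the same code are copies of one another over B, so [mu] bounds each fibre of the
    code map. *)
Lemma good_family_bound K m : exists b, forall B F, (#|` B| <= K)%N ->
  (forall Y, Y \in F -> good B Y /\ (#|` Y| <= m)%N) ->
  {in F &, forall Y Y', Y != Y' -> [disjoint Y & Y']} -> (#|` F| <= b)%N.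
Proof.
have [b Hb] := mu_bounded K m mu.
exists (size (enum (codeT K m)) * b)%N => B F cB gF dF.
have [->|/fset0Pn[Y0 Y0F]] := eqVneq F fset0; first by rewrite cardfs0.
have [[[/fset0Pn[x0 _] _ _ _] _ _] _] := gF _ Y0F.
apply: (card_le_fibers (h := code K m x0 B)) => [Y _|t F' _ F'F codeF'].
  by rewrite mem_enum.
have [->|/fset0Pn[Y YF']] := eqVneq F' fset0; first by rewrite cardfs0.
have [gY cY] := gF _ (fsubsetP F'F Y YF').
apply: leq_trans (Hb _ _ _ gY cB cY).
pose A := foldr fsetU B (enum_fset F').
have BA : B `<=` A.
  by rewrite /A; elim: (enum_fset F') => //= C s h; apply: fsubsetU; rewrite h orbT.
have FA C : C \in F' -> C `<=` A.
  rewrite /A -[C \in F']/(C \in enum_fset F'); elim: (enum_fset F') => //= D s IH.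
  by rewrite inE => /orP[/eqP->|/IH h]; rewrite ?fsubsetUl // fsubsetU // h orbT.
have /KmuP[_ H] := gen_Kmu hG A.
apply: (H B F') => //; split.
- by move=> C CF; case: (gF _ (fsubsetP F'F C CF)).
- by move=> C C' /(fsubsetP F'F) CF /(fsubsetP F'F); apply: dF.
move=> C C' CF C'F.
have [[[C0 d e1 e2] K1 g1] cC] := gF _ (fsubsetP F'F C CF).
have [[[C0' d' _ _] _ _] cC'] := gF _ (fsubsetP F'F C' C'F).
have [f [emb fB fC idB]] := code_iso cB cC cB cC' d d' (etrans (codeF' _ CF) (esym (codeF' _ C'F))).
by exists f; split=> // x xB; rewrite idB // nth_index.
Qed.

(** Each member is good over some subset of B, and there are at most 2 ^ K subsets. *)
Lemma minimal_family_bound K m : exists b, forall B F, (#|` B| <= K)%N ->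
  (forall Y, Y \in F -> minimal0 B Y /\ (#|` Y| <= m)%N) ->
  {in F &, forall Y Y', Y != Y' -> [disjoint Y & Y']} -> (#|` F| <= b)%N.
Proof.
have [b Hb] := good_family_bound K m.
exists (2 ^ K * b)%N => B F cB mF dF.
have ex Y : exists B', Y \in F -> B' `<=` B /\ good B' Y.
  have [/mF[mY _]|] := boolP (Y \in F); last by exists fset0.
  by have [B' B'B g] := good_base mY (gen_K0 hG _); exists B'.
have [h Hh] := choice ex.
apply: (@leq_trans (size (enum_fset (fpowerset B)) * b)).
  apply: (card_le_fibers (h := h)) => [Y YF|B' F' B'B F'F hF'].
    by have [] := Hh Y YF; rewrite -fpowersetE.
  rewrite -[_ \in _]/(B' \in fpowerset B) fpowersetE in B'B.
  apply: (Hb B') => [|Y YF'|Y Y' /(fsubsetP F'F) YF /(fsubsetP F'F)].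
  - exact: leq_trans (fsubset_leq_card B'B) cB.
  - have YF := fsubsetP F'F Y YF'; have [_ c] := mF _ YF.
    by have [_ g] := Hh _ YF; rewrite -(hF' _ YF').
  - exact: dF.
by rewrite leq_mul2r [size _]card_fpowerset leq_exp2l // cB orbT.
Qed.

(** Strength against Y [|] Y' forces the intersection to have relative dimension at most 0; if
    nonempty, it equals both sets by minimality. *)
Lemma minimal0_disjoint m B Y Y' : nstrong (m + m) B ->
  minimal0 B Y -> minimal0 B Y' -> (#|` Y| <= m)%N -> (#|` Y'| <= m)%N ->
  Y != Y' -> [disjoint Y & Y'].
Proof.
move=> sB [Y0 d e mY] [Y0' d' e' mY'] c c'.
apply: contra_neqT => I0.
have le : delta (B `|` (Y `&` Y')) <= delta B.
  have := delta_submod (B `|` Y) (B `|` Y').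
  have -> : (B `|` Y) `|` (B `|` Y') = B `|` (Y `|` Y') by fset_tac.
  have -> : (B `|` Y) `&` (B `|` Y') = B `|` (Y `&` Y') by fset_tac.
  have := sB (Y `|` Y') _; have := cardfsUI Y Y' => h /(_ _)/Wrap[|]; first by clear -h c c'; lia.
  by rewrite e e'; clear; lia.
have e1 : Y `&` Y' = Y.
  apply/eqP/negPn/negP => ne.
  by have := mY _ (fsubsetIl _ _) I0 ne; rewrite ltNge le.
have e2 : Y `&` Y' = Y'.
  apply/eqP/negPn/negP => ne.
  by have := mY' _ (fsubsetIr _ _) I0 ne; rewrite ltNge le.
by rewrite -e1 e2.
Qed.

(* Distinct minimal extensions of B are disjoint, so mu bounds their number; the
   other extensions are exhausted by iterating over B and its minimal ones. *)
Lemma zero_extensions_bound m : forall K, exists b L, forall B, (#|` B| <= K)%N ->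
  nstrong L B -> exists S, (#|` S| <= b)%N /\
  forall Y, (#|` Y| <= m)%N -> delta (B `|` Y) <= delta B -> Y `<=` S.
Proof.
elim: m => [|m IH] K.
  exists 0%N, 0%N => B _ _; exists fset0; rewrite cardfs0; split=> // Y.
  by rewrite leqn0 cardfs_eq0 => /eqP->.
have [b Hb] := minimal_family_bound K m.+1.
pose K1 := (K + b * m.+1)%N.
have [b' [L' HL']] := IH K1.
(* Strength L' must remain after U, of at most b * m.+1 points, has been added; the last summand
   makes distinct minimal extensions disjoint. *)
exists (b' + K1)%N, (L' + b * m.+1 + (m.+1 + m.+1))%N => B cB sB.
have sB2 : nstrong (m.+1 + m.+1) B by apply: nstrong_mono sB; apply: leq_addl.
have [F [cF HF]] := @fset_of_bounded _ (fun Y => minimal0 B Y /\ (#|` Y| <= m.+1)%N) b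
  (fun F HF => Hb B F cB HF (fun Y Y' YF Y'F => minimal0_disjoint sB2 (HF _ YF).1 (HF _ Y'F).1
     (HF _ YF).2 (HF _ Y'F).2)).
pose U := foldr fsetU fset0 (enum_fset F).
have FU Y : Y \in F -> Y `<=` U.
  rewrite /U -[Y \in F]/(Y \in enum_fset F); elim: (enum_fset F) => //= D s IHs.
  by rewrite inE => /orP[/eqP->|/IHs h]; rewrite ?fsubsetUl // fsubsetU // h orbT.
have [cU leU] : (#|` U| <= b * m.+1)%N /\ delta (B `|` U) <= delta B.
  suff H (s : seq {fset G}) : (forall Y, Y \in s -> Y \in F) ->
      (#|` foldr fsetU fset0 s| <= size s * m.+1)%N /\
      delta (B `|` foldr fsetU fset0 s) <= delta B.
    have [//|c le] := H (enum_fset F); split=> //.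
    by apply: leq_trans c _; rewrite leq_mul2r cF orbT.
  elim: s => [_|Y s IHs sF]; first by split; rewrite ?cardfs0 ?fsetU0.
  rewrite [foldr _ _ _]/=; have [|c le] := IHs; first by move=> Y' h; apply: sF; rewrite inE h orbT.
  have /HF[[_ _ eY _] cY] := sF Y (mem_head _ _).
  set T := foldr _ _ _ in c le *; split.
    rewrite [size _]/= mulSn; have := cardfsUI Y T; move: (size s * _)%N c cY => q.
    by clear; lia.
  have := delta_submod (B `|` Y) (B `|` T).
  have -> : (B `|` Y) `|` (B `|` T) = B `|` (Y `|` T) by fset_tac.
  have -> : (B `|` Y) `&` (B `|` T) = B `|` (Y `&` T) by fset_tac.
  have h : delta B <= delta (B `|` (Y `&` T)).
    apply: sB2; have := fsubset_leq_card (fsubsetIl Y T); move: cY; clear; lia.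
  by move: h eY le; clear; lia.
have cB1 : (#|` B `|` U| <= K1)%N by have := cardfsUI B U; move: cU cB; rewrite /K1; clear; lia.
have sB1 : nstrong L' (B `|` U).
  by apply: nstrong_mono (nstrong_ext sB leU); move: cU; clear; lia.
have [S' [cS' HS']] := HL' _ cB1 sB1.
exists (S' `|` (B `|` U)); split.
  by have := cardfsUI S' (B `|` U); move: cS' cB1; clear; lia.
move=> Y cY leY.
have [Y0|Y0] := eqVneq (Y `\` B) fset0.
  apply/fsubsetP => x xY; rewrite !inE; have := in_fset0 x.
  by rewrite -Y0 !inE xY andbT; case: (x \in B) => //; rewrite orbT.
have eY : B `|` (Y `\` B) = B `|` Y by fset_tac.
have [|C [CY [C0 leC] minC]] := @min_fset G
   (fun X => X != fset0 /\ delta (B `|` X) <= delta B) (Y `\` B); first by rewrite eY.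
have cC : (#|` C| <= m.+1)%N.
  by apply: leq_trans cY; apply: fsubset_leq_card; fset_tac.
have CF : C \in F.
  apply/HF; split=> //; split=> //.
  - by fset_tac.
  - apply/eqP; rewrite eq_le leC /=; apply: sB2; move: cC; clear; lia.
  - move=> X XC X0 XneC; rewrite ltNge; apply/negP => leX; apply: (minC X) => //.
    by rewrite fproperEneq XneC.
have CU := FU _ CF.
(* Removing a minimal part C, already in U, leaves fewer than m.+1 points of relative dimension at
   most 0 over B [|] U, so the induction hypothesis applies. *)
have Y1S : Y `\` C `<=` S'.
  apply: HS'.
    have -> : #|` Y `\` C| = (#|` Y| - #|` C|)%N by rewrite cardfsDS //; fset_tac.
    by move: C0 cY; rewrite -cardfs_gt0; clear; lia.
  have := delta_submod (B `|` U) (B `|` Y).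
  have -> : (B `|` U) `|` (B `|` Y) = B `|` U `|` (Y `\` C) by fset_tac.
  have -> : (B `|` U) `&` (B `|` Y) = B `|` (U `&` Y) by fset_tac.
  have h : delta B <= delta (B `|` (U `&` Y)).
    apply: sB2; have := fsubset_leq_card (fsubsetIr U Y); move: cY; clear; lia.
  by move: h leY; clear; lia.
by fset_tac.
Qed.

(** The strength L K depends on the size bound K of the resulting set. A set that is not strong
    enough is enlarged by a witness, which lowers the predimension, so at most d enlargements
    occur. *)
Lemma nstrong_closure (L : nat -> nat) d : forall k, exists b, forall V : {fset G},
  (#|` V| <= k)%N -> delta V < d%:Z ->
  exists B K, [/\ V `<=` B, (#|` B| <= K)%N, (K <= b)%N & nstrong (L K) B].
Proof.
elim: d => [|d IH] k.
  exists 0%N => V _; have := K0_ge0 (gen_K0 hG V); clear; lia.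
have [b Hb] := IH (k + L k)%N.
exists (maxn k b) => V cV dV.
have [sV|/existsNP[X /not_implyP[cX /negP]]] := pselect (nstrong (L k) V).
  by exists V, k; split=> //; apply: leq_maxl.
rewrite -ltNge => lt.
have [||B [K [VB cB Kb sB]]] := Hb (V `|` X).
- by have := cardfsUI V X; move: cV cX; clear; lia.
- by move: lt dV; clear; lia.
exists B, K; split=> //; first by apply: fsubset_trans VB; apply: fsubsetUl.
by apply: leq_trans Kb _; apply: leq_maxr.
Qed.

(** The parameters are enclosed in a bounded, sufficiently strong B. Outside B and the bounded set S
    of small extensions of relative dimension at most 0, any two points are exchanged by a map
    fixing B whose domain and image are strong enough to preserve phi. *)
Lemma definable_bound k (phi : formula k.+1) : exists b, forall v : 'I_k -> G,
  exists S, (#|` S| <= b)%N /\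
   ((forall x, x \notin S -> sat phi (vcons x v)) \/
    (forall x, x \notin S -> ~ sat phi (vcons x v))).
Proof.
have [n0 Hn0] := choice (sat_nstrong hG phi).
have ex K : exists bL : nat * nat, forall B, (#|` B| <= K)%N -> nstrong bL.2 B ->
    exists S, (#|` S| <= bL.1)%N /\
    forall Y, (#|` Y| <= (n0 K.+1).+1)%N -> delta (B `|` Y) <= delta B -> Y `<=` S.
  by have [b [L H]] := zero_extensions_bound (n0 K.+1).+1 K; exists (b, L).
have [bL HbL] := choice ex.
(* The second argument k.+1 suffices because delta V <= |V| <= k. *)
have [c Hc] := nstrong_closure (fun K => (bL K).2 + n0 K.+1 + 2)%N k.+1 k.
(* The size K of the closure varies with the parameters but is at most c, hence the maximum. *)
exists (\max_(i < c.+1) ((bL i).1 + i))%N => v.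
pose V := [fset x in [seq v i | i <- enum 'I_k]].
have cV : (#|` V| <= k)%N.
  by rewrite card_fseq (leq_trans (size_undup _)) // size_map size_enum_ord.
have [|B [K [VB cB Kc sB]]] := Hc V cV; first by have := delta_le_card V; move: cV; clear; lia.
have [|S [cS HS]] := HbL K B cB; first by apply: nstrong_mono sB; clear; lia.
exists (S `|` B); split.
  have : (#|` S `|` B| <= (bL K).1 + K)%N by have := cardfsUI S B; move: cS cB; clear; lia.
  have Kc' : (K < c.+1)%N by [].
  by move=> h; apply: leq_trans h _; exact: (leq_bigmax (F := fun i : 'I_c.+1 => ((bL i).1 + i)%N) (Ordinal Kc')).
have gen x : x \notin S `|` B -> delta (B `|` [fset x]) = delta B + 1 /\
    nstrong (n0 K.+1) (B `|` [fset x]).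
  move=> xSB; have nle X : (#|` X| <= n0 K.+1)%N -> delta B < delta (B `|` ([fset x] `|` X)).
    move=> cX; rewrite ltNge; apply/negP => le.
    have cxX : (#|` [fset x] `|` X| <= (n0 K.+1).+1)%N.
      by have := cardfsUI [fset x] X; rewrite cardfs1; move: cX; clear; lia.
    have := fsubsetP (HS _ cxX le) x; rewrite !inE eqxx => /(_ isT) xS.
    by move: xSB; rewrite inE xS.
  have up : delta (B `|` [fset x]) <= delta B + 1 by rewrite fsetUC; apply: deltaU1.
  split.
    by have := nle fset0; rewrite cardfs0 fsetU0 => /(_ isT); move: up; clear; lia.
  by move=> X cX; have := nle X cX; rewrite fsetUA; move: up; clear; lia.
have vB i : v i \in B.
  apply: (fsubsetP VB); rewrite !inE; apply/mapP; exists i => //.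
  by rewrite mem_enum.
have same x y : x \notin S `|` B -> y \notin S `|` B ->
    sat phi (vcons x v) -> sat phi (vcons y v).
  move=> xSB ySB; have [ex1 sx] := gen x xSB; have [ey1 sy] := gen y ySB.
  have xB : x \notin B by move: xSB; rewrite inE negb_or => /andP[].
  have yB : y \notin B by move: ySB; rewrite inE negb_or => /andP[].
  pose f z := if z == x then y else z.
  have fx : f x = y by rewrite /f eqxx.
  have fB z : z \in B -> f z = z.
    by rewrite /f; case: eqP => // -> h; rewrite h in xB.
  (* A point of relative dimension 1 over B is on no triple with two points of B, so exchanging two
     such points preserves all triples. *)
  have noT w S' : delta (B `|` [fset w]) = delta B + 1 -> w \notin B ->
      is_triple S' -> S' `<=` B `|` [fset w] -> S' `<=` B.
    move=> ew wB tS sS; apply/negPn/negP => nS.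
    have := @delta_submod_strict _ B [fset w] S' tS sS nS.
    have -> : B `&` [fset w] = fset0.
      by apply/fsetP => z; rewrite !inE; case: eqP => [->|]; rewrite ?(negbTE wB) ?andbF.
    rewrite (@delta_small _ [fset w]) cardfs1 // delta0 ew.
    have -> : ~~ (S' `<=` [fset w]).
      by apply/negP => /fsubset_leq_card; rewrite cardfs1 triple_card.
    by move=> /(_ isT); clear; lia.
  have emb : embedding_on (B `|` [fset x]) f.
    apply: emb_of_triples.
      move=> z w; rewrite !inE => /orP[zB|/eqP->] /orP[wB|/eqP->]; rewrite ?fx ?fB //.
        by move=> e; rewrite -e zB in yB.
      by move=> e; rewrite e wB in yB.
    move=> S' S'B cS'; apply/idP/idP => tS.
      have fS' : f @` S' `<=` B `|` [fset y].
        apply: fsubset_trans (img_subset _ S'B) _.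
        by rewrite imfsetU imfset_fset1 fx (img_id fB).
      have := noT y _ ey1 yB tS fS' => /fsubsetP h.
      suff <- : f @` S' = S' by [].
      apply: img_id => z zS; apply: fB; have := fsubsetP S'B z zS.
      rewrite !inE => /orP[//|/eqP ez]; have := h _ (in_img f zS).
      by rewrite ez fx (negbTE yB).
    have /fsubsetP h := noT x _ ex1 xB tS S'B.
    by rewrite (img_id (fun z zS => fB z (h z zS))).
  have imB : f @` (B `|` [fset x]) = B `|` [fset y].
    by rewrite imfsetU imfset_fset1 fx (img_id fB).
  have cBx : (#|` B `|` [fset x]| <= K.+1)%N.
    by have := cardfsUI B [fset x]; rewrite cardfs1; move: cB; clear; lia.
  have vx i : vcons x v i \in B `|` [fset x].
    by rewrite /vcons; case: unlift => [j|] /=; rewrite !inE ?vB // eqxx orbT.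
  have := Hn0 K.+1 _ f _ cBx emb sx _ vx; rewrite imB => /(_ sy)[H _] /H.
  rewrite vcons_map fx; congr (sat phi (vcons y _)).
  by apply: funext => i; rewrite fB.
have [[x [xSB sx]]|nox] := pselect (exists x, x \notin S `|` B /\ sat phi (vcons x v)).
  by left=> y ySB; apply: same sx.
by right=> x xSB sx; apply: nox; exists x.
Qed.

End Bounds.

(** * First-order transfer *)

Section Definable.

(** Uniform in all structures, so that a sentence found for G speaks about M. The closure properties
    below spare writing de Bruijn formulas by hand. *)
Definition definable n (P : forall M : hstruct, ('I_n -> M) -> Prop) : Prop :=
  exists phi : formula n, forall (M : hstruct) (v : 'I_n -> M), sat phi v <-> P M v.

Lemma vcons0 (T : Type) n (x : T) (v : 'I_n -> T) : vcons x v ord0 = x.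
Proof. by rewrite /vcons unlift_none. Qed.

Lemma vcons_lift (T : Type) n (x : T) (v : 'I_n -> T) i : vcons x v (lift ord0 i) = v i.
Proof. by rewrite /vcons liftK. Qed.

Lemma vcons_eta (T : Type) n (v : 'I_n.+1 -> T) :
  v = vcons (v ord0) (fun i => v (lift ord0 i)).
Proof.
apply: funext => i; case: (unliftP ord0 i) => [j|] ->.
  by rewrite vcons_lift.
by rewrite vcons0.
Qed.

Lemma definable_ext n (P Q : forall M : hstruct, ('I_n -> M) -> Prop) :
  (forall M v, P M v <-> Q M v) -> definable P -> definable Q.
Proof. by move=> PQ [phi H]; exists phi => M v; rewrite H. Qed.

Lemma definable_imp n (P Q : forall M : hstruct, ('I_n -> M) -> Prop) :
  definable P -> definable Q -> definable (fun M v => P M v -> Q M v).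
Proof.
move=> [p Hp] [q Hq]; exists (FImp p q) => M v /=.
by have := Hp M v; have := Hq M v; tauto.
Qed.

Lemma definable_not n (P : forall M : hstruct, ('I_n -> M) -> Prop) :
  definable P -> definable (fun M v => ~ P M v).
Proof. by move=> dP; apply: definable_imp => //; exists (FBot n). Qed.

Lemma definable_and n (P Q : forall M : hstruct, ('I_n -> M) -> Prop) :
  definable P -> definable Q -> definable (fun M v => P M v /\ Q M v).
Proof.
move=> dP dQ; apply: (definable_ext _ (definable_not (definable_imp dP (definable_not dQ)))).
move=> M v; split=> [H|[p q] H]; last exact: H.
by apply: contrapT => n1; apply: H => p q; apply: n1.
Qed.

Lemma definable_or n (P Q : forall M : hstruct, ('I_n -> M) -> Prop) :
  definable P -> definable Q -> definable (fun M v => P M v \/ Q M v).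
Proof.
move=> dP dQ; apply: (definable_ext _ (definable_imp (definable_not dP) dQ)).
move=> M v; split=> [H|[p|q] //].
by have [p|np] := pselect (P M v); [left | right; apply: H].
Qed.

Lemma definable_all n (P : forall M : hstruct, ('I_n.+1 -> M) -> Prop) :
  definable P -> definable (fun (M : hstruct) (v : 'I_n -> M) => forall x, P M (vcons x v)).
Proof.
by move=> [p Hp]; exists (FAll p) => M v /=; split=> H x; apply/Hp.
Qed.

Lemma definable_ex n (P : forall M : hstruct, ('I_n.+1 -> M) -> Prop) :
  definable P -> definable (fun (M : hstruct) (v : 'I_n -> M) => exists x, P M (vcons x v)).
Proof.
move=> dP; apply: (definable_ext _ (definable_not (definable_all (definable_not dP)))).
move=> M v; split=> [H|[x Px] H]; last exact: H Px.
by apply: contrapT => nx; apply: H => x Px; apply: nx; exists x.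
Qed.

Lemma definable_big n (I : finType) (P : I -> forall M : hstruct, ('I_n -> M) -> Prop) :
  (forall i, definable (P i)) -> definable (fun M v => forall i, P i M v).
Proof.
move=> dP; suff H (s : seq I) : definable (fun M v => forall i, i \in s -> P i M v).
  apply: (definable_ext _ (H (enum I))) => M v.
  by split=> h i; [apply: h; rewrite mem_enum | move=> _; apply: h].
elim: s => [|i s IH].
  by exists (FImp (FBot n) (FBot n)) => M v; split=> [_ i|_] //=.
apply: (definable_ext _ (definable_and (dP i) IH)) => M v.
split=> [[Pi h] j|h]; first by rewrite inE => /orP[/eqP->//|/h].
by split=> [|j js]; apply: h; rewrite inE ?eqxx ?js ?orbT.
Qed.

Definition vlift n m (rho : 'I_n -> 'I_m) : 'I_n.+1 -> 'I_m.+1 :=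
  vcons ord0 (fun i => lift ord0 (rho i)).

Lemma vcons_vlift (T : Type) n m (rho : 'I_n -> 'I_m) (x : T) (v : 'I_m -> T) :
  (fun i => vcons x v (vlift rho i)) = vcons x (fun i => v (rho i)).
Proof.
apply: funext => i; rewrite /vlift; case: (unliftP ord0 i) => [j|] ->.
  by rewrite !vcons_lift.
by rewrite !vcons0.
Qed.

Fixpoint rename n (phi : formula n) : forall m, ('I_n -> 'I_m) -> formula m :=
  match phi in formula n return forall m, ('I_n -> 'I_m) -> formula m with
  | FEq _ i j => fun m rho => FEq (rho i) (rho j)
  | FRel _ i j k => fun m rho => FRel (rho i) (rho j) (rho k)
  | FBot _ => fun m rho => FBot m
  | FImp _ p q => fun m rho => FImp (rename p rho) (rename q rho)
  | FAll _ p => fun m rho => FAll (rename p (vlift rho))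
  end.

Lemma sat_rename n (phi : formula n) (M : hstruct) : forall m (rho : 'I_n -> 'I_m) v,
  sat (rename phi rho) v <-> sat (M := M) phi (fun i => v (rho i)).
Proof.
elim: phi => {n} [n i j|n i j k|n|n p IHp q IHq|n p IH] m rho v //=.
  by split=> h /IHp/h/IHq.
by split=> h x; move: (h x); rewrite IH vcons_vlift.
Qed.

Lemma definable_rename n m (rho : 'I_n -> 'I_m) (P : forall M : hstruct, ('I_n -> M) -> Prop) :
  definable P -> definable (fun (M : hstruct) (v : 'I_m -> M) => P M (fun i => v (rho i))).
Proof. by move=> [p Hp]; exists (rename p rho) => M v; rewrite sat_rename. Qed.

Definition vapp (T : Type) m n (w : 'I_m -> T) (v : 'I_n -> T) (i : 'I_(m + n)) : T :=
  match fintype.split i with inl j => w j | inr j => v j end.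

Lemma vapp_l (T : Type) m n (w : 'I_m -> T) (v : 'I_n -> T) j : vapp w v (lshift n j) = w j.
Proof. by rewrite /vapp (unsplitK (inl j)). Qed.

Lemma vapp_r (T : Type) m n (w : 'I_m -> T) (v : 'I_n -> T) j : vapp w v (rshift m j) = v j.
Proof. by rewrite /vapp (unsplitK (inr j)). Qed.

Lemma vapp_vcons (T : Type) m n x (w : 'I_m -> T) (v : 'I_n -> T) :
  vapp (vcons x w) v = vcons x (vapp w v).
Proof.
apply: funext => i; case: (unliftP ord0 i) => [j|] ->.
  rewrite vcons_lift; case: (splitP j) => k ek.
    have -> : lift ord0 j = lshift n (lift ord0 k) by apply: val_inj; rewrite /= ek.
    have -> : j = lshift n k by apply: val_inj.
    by rewrite !vapp_l vcons_lift.
  have -> : lift ord0 j = rshift m.+1 k by apply: val_inj; rewrite /= /bump ek.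
  have -> : j = rshift m k by apply: val_inj.
  by rewrite !vapp_r.
have e : lshift n (ord0 : 'I_m.+1) = ord0 by apply: val_inj.
by rewrite vcons0 -e vapp_l vcons0.
Qed.

(** The block w precedes v in the index order, so it is quantified away one variable at a time
    through [vapp_vcons]. *)
Lemma definable_exblock m n (P : forall M : hstruct, ('I_(m + n) -> M) -> Prop) :
  definable P ->
  definable (fun (M : hstruct) (v : 'I_n -> M) => exists w : 'I_m -> M, P M (vapp w v)).
Proof.
elim: m P => [|m IH] P dP.
  apply: (definable_ext _ dP) => M v.
  have e (w : 'I_0 -> M) : vapp w v = v.
    apply: funext => i; have -> : i = rshift 0 i by apply: val_inj.
    by rewrite vapp_r; congr v; apply: val_inj.
  split=> [Pv|[w]]; last by rewrite e.
  have w (i : 'I_0) : M by case: i.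
  by exists w; rewrite e.
apply: (definable_ext _ (IH _ (definable_ex dP))) => M v.
split=> [[w [x Pw]]|[w Pw]]; first by exists (vcons x w); rewrite vapp_vcons.
exists (fun i => w (lift ord0 i)), (w ord0).
by rewrite -vapp_vcons -vcons_eta.
Qed.

Lemma definable_closure n (P : forall M : hstruct, ('I_n -> M) -> Prop) :
  definable P -> exists phi : sentence, forall M : hstruct, holds M phi <-> forall v, P M v.
Proof.
elim: n P => [|n IH] P dP.
  by have [p Hp] := dP; exists p => M; split=> H v; apply/Hp.
have [phi H] := IH _ (definable_all dP); exists phi => M; rewrite H.
by split=> h v; [rewrite (vcons_eta v); apply: h | move=> x; apply: h].
Qed.

Lemma definable_transfer (G M : hstruct) n (P : forall M : hstruct, ('I_n -> M) -> Prop) :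
  models M (theory G) -> definable P -> (forall v, P G v) -> forall v, P M v.
Proof.
move=> hM dP PG; have [phi H] := definable_closure dP.
by apply/H/hM/H.
Qed.

End Definable.

(** * Infinity of the generic and existence of its lines *)

Section GenericFacts.
Variables (mu : mu_function) (G : hstruct).
Hypothesis hG : is_generic mu G.

Definition empty_rel : nat -> nat -> nat -> bool := fun _ _ _ => false.

Lemma empty_rel_distinct x y z : empty_rel x y z -> [/\ x != y, x != z & y != z].
Proof. by []. Qed.

Definition free_struct : hstruct :=
  HStruct empty_rel_distinct (fun _ _ _ => erefl) (fun _ _ _ => erefl).

Lemma delta_free_struct (A : {fset free_struct}) : delta A = #|` A|%:Z.
Proof.
suff e : r A = 0%N by rewrite /delta e; lia.
apply/eqP; rewrite rE cardfs_eq0; apply/eqP/fsetP => S.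
rewrite in_triples inE; apply/negP => /andP[_ /is_tripleP[x [y [z []]]]].
by [].
Qed.

(** Without triples the predimension is the cardinality, so nothing nonempty has relative dimension
    0 and there are no good pairs. *)
Lemma Kmu_free_struct (A : {fset free_struct}) : Kmu mu A.
Proof.
apply/KmuP; split; first by apply/K0P => Y _; rewrite delta_free_struct; lia.
move=> B F _ _ [gF _ _] C CF; have [[C0 d e _] _ _] := gF _ CF.
have := cardfsUI B C; rewrite (eqP (d : _ == _)) cardfs0.
move: e C0; rewrite !delta_free_struct -cardfs_gt0; lia.
Qed.

Definition free_pts k : {fset free_struct} := [fset x in iota 0 k].

Lemma in_free_pts k (x : nat) : (x \in free_pts k) = (x < k)%N.
Proof. by rewrite !inE mem_iota. Qed.

Lemma card_free_pts k : #|` free_pts k| = k.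
Proof. by rewrite card_fseq undup_id ?iota_uniq // size_iota. Qed.

Lemma gen_inhabited : inhabited G.
Proof.
have [_ ext] := hG.
have [|||g _] := @ext fset0 free_struct (free_pts 1) (fun=> 0%N) (gen_Kmu hG _)
  (Kmu_free_struct _).
- by split=> [x y|x y z]; rewrite inE.
- split=> [|Z _ _]; first by rewrite imfset0 fsub0set.
  by rewrite imfset0 delta0 delta_free_struct.
- by move=> C _; rewrite delta0; apply: (K0_ge0 (gen_K0 hG _)).
by exists; exact: g (0%N : free_struct).
Qed.

Lemma gen_free_pts k n : exists f : free_struct -> G,
  embedding_on (free_pts k) f /\ nstrong n (f @` free_pts k).
Proof.
have [x0] := gen_inhabited; elim: k n => [|k IH] n.
  exists (fun=> x0); have -> : free_pts 0 = fset0.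
    by apply/fsetP => x; rewrite in_free_pts inE.
  split; first by split=> [x y|x y z]; rewrite inE.
  by rewrite imfset0 => X _; rewrite delta0; apply: (K0_ge0 (gen_K0 hG _)).
(* The next point spends one unit of strength, and [min_extension_step] asks for at least 3. *)
have [f [emb sf]] := IH (n + 3)%N.
have [||||||f' [emb' _ sf']] := @min_extension_step mu G hG free_struct (n + 3)
    (free_pts k) [fset (k : free_struct)] f (Kmu_free_struct _) _ _ _ _ emb sf.
- by rewrite fdisjointX1 in_free_pts ltnn.
- by rewrite -cardfs_gt0 cardfs1.
- rewrite !delta_free_struct lez_nat; apply: fsubset_leq_card; exact: fsubsetUl.
- by move=> X; rewrite fsubset1 => /orP[->//|/eqP->]; rewrite eqxx.
- by rewrite cardfs1; lia.
- by lia.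
have e : free_pts k `|` [fset (k : free_struct)] = free_pts k.+1.
  apply/fsetP => x; rewrite in_fsetU in_fset1 !in_free_pts ltnS [in RHS]leq_eqVlt orbC.
  by [].
rewrite e in emb' sf'; exists f'; split=> //.
by apply: nstrong_mono sf'; rewrite cardfs1; lia.
Qed.

Lemma gen_infinite (S : {fset G}) : exists x, x \notin S.
Proof.
apply: contrapT => nox.
have [f [emb _]] := gen_free_pts #|` S|.+1 0.
have : (#|` f @` free_pts #|` S|.+1| <= #|` S|)%N.
  apply: fsubset_leq_card; apply/fsubsetP => x _; apply/negPn/negP => xS.
  by apply: nox; exists x.
by rewrite (emb_card emb) // card_free_pts ltnn.
Qed.

Definition line_rel (x y z : 'I_3) : bool := [&& x != y, x != z & y != z].

Lemma line_distinct x y z : line_rel x y z -> [/\ x != y, x != z & y != z].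
Proof. by case/and3P. Qed.

Lemma line_swap12 x y z : line_rel x y z = line_rel y x z.
Proof. by rewrite /line_rel (eq_sym x y); congr (_ && _); rewrite andbC. Qed.

Lemma line_swap23 x y z : line_rel x y z = line_rel x z y.
Proof. by rewrite /line_rel (eq_sym y z); bool_congr. Qed.

Definition line_struct : hstruct := HStruct line_distinct line_swap12 line_swap23.

(** The base of a good pair has at least two points, which leaves room for one copy at most, whereas
    [mu] is at least delta B >= 2. *)
Lemma Kmu_line_struct (A : {fset line_struct}) : Kmu mu A.
Proof.
have c3 (X : {fset line_struct}) : (#|` X| <= 3)%N.
  by rewrite cardfE -[3%N]card_ord; apply: (leq_trans (max_card _)); rewrite card_sub max_card.
apply/KmuP; split; first by apply/K0P => Y _; have := c3 Y; lia.
move=> B F BA FA [gF dF _] C CF; have gC := gF _ CF.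
have := mu_ge mu ((good_pairP _ _).2 gC); have := good_delta gC.
have cB := good_card gC.
suff : (#|` F| <= 1)%N by lia.
rewrite leqNgt; apply/negP => c2.
have [C' C'F ne] : exists2 C', C' \in F & C' != C.
  apply: contrapT => no; have : F `<=` [fset C].
    apply/fsubsetP => C' C'F; rewrite inE; apply/negPn/negP => ne.
    by apply: no; exists C'.
  by move/fsubset_leq_card; rewrite cardfs1; lia.
have [[C0 d _ _] _ _] := gC; have [[C'0 d' _ _] _ _] := gF _ C'F.
have dC := dF _ _ C'F CF ne.
have e1 := cardfsUI B C; rewrite (eqP (d : _ == _)) cardfs0 in e1.
have : [disjoint C' & B `|` C] by rewrite fdisjointXU dC fdisjoint_sym d'.
move=> /eqP d2; have e2 := cardfsUI C' (B `|` C); rewrite d2 cardfs0 in e2.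
have := c3 (C' `|` (B `|` C)).
by move: C0 C'0; rewrite -!cardfs_gt0; lia.
Qed.

(** A pair is n-strong for every n by [K0_ge2], so its extension to the three-point line is realized
    in G. *)
Lemma gen_line (a b : G) : a != b -> exists z, hR a b z.
Proof.
move=> ab; pose i0 : line_struct := (ord0 : 'I_3).
pose i1 : line_struct := (Ordinal (isT : 1 < 3)%N : 'I_3).
pose i2 : line_struct := (Ordinal (isT : 2 < 3)%N : 'I_3).
pose f (i : line_struct) := if i == i0 then a else b.
have e2 : #|` [fset i0; i1]| = 2%N by rewrite cardfs2.
have e3 : #|` [fset i0; i1] `|` [fset i2]| = 3%N by rewrite cardfs3.
have fI : f @` [fset i0; i1] = [fset a; b] by rewrite imfset_fset2.
have injf : {in [fset i0; i1] &, injective f}.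
  by apply/card_in_imfsetP; rewrite fI e2 cardfs2 ab.
have emb : embedding_on [fset i0; i1] f.
  apply: emb_of_triples => // S SI cS.
  by have := fsubset_leq_card SI; rewrite e2 cS.
have t : is_triple ([fset i0; i1] `|` [fset i2]).
  by apply/is_tripleP; exists i0, i1, i2.
have [|||||||f' [emb' f'f _]] := @min_extension_step mu G hG line_struct 3
    [fset i0; i1] [fset i2] f (Kmu_line_struct _) _ _ _ _ emb _.
- by rewrite fdisjointX1 !inE.
- by rewrite -cardfs_gt0 cardfs1.
- by rewrite (delta3 e3) t (delta_small (A := [fset i0; i1])) ?e2.
- by move=> X; rewrite fsubset1 => /orP[->//|/eqP->]; rewrite eqxx.
- move=> X _; rewrite fI (delta_small (A := [fset a; b])) ?cardfs2 ?ab //.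
  apply: (K0_ge2 (gen_K0 hG _)).
  have := fsubset_leq_card (fsubsetUl [fset a; b] X); rewrite cardfs2 ab.
  by [].
- by rewrite cardfs1.
- by [].
have [_ hom] := emb'; exists (f' i2).
have m0 : i0 \in [fset i0; i1] by rewrite !inE.
have m1 : i1 \in [fset i0; i1] by rewrite !inE.
have <- : f' i0 = a by rewrite f'f.
have <- : f' i1 = b by rewrite f'f.
by rewrite hom // !inE.
Qed.

End GenericFacts.

(** * Models of the theory *)

Definition vpair (T : Type) (a b : T) (i : 'I_2) : T := if i == ord0 then a else b.

(** Two third points would give four points of predimension at most 2. *)
Lemma third_point_unique (M : hstruct) (a b c d : M) :
  (forall A : {fset M}, K0 A) -> hR a b c -> hR a b d -> c = d.
Proof.
move=> KM Rc Rd; apply/eqP/negPn/negP => cd.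
have [ab ac bc] := hR_distinct Rc; have [_ ad bd] := hR_distinct Rd.
have t : is_triple [fset a; b; c] by apply/is_tripleP; exists a, b, c.
have dA : d \notin [fset a; b; c] by rewrite !inE ![d == _]eq_sym !negb_or ad bd cd.
have le : delta (d |` [fset a; b; c]) <= delta [fset a; b; c].
  apply: (@delta_addpt M _ d a b) => //; rewrite ?inE ?eqxx ?orbT //.
  by rewrite hR_swap12 hR_swap23.
have := (K0P _).1 (KM (d |` [fset a; b; c])) _ (fsubset_refl _).
rewrite cardfsU1 dA cardfs3 // => /(_ isT).
by move: le; rewrite (delta3 (A := [fset a; b; c])) ?cardfs3 // t; lia.
Qed.

Section Model.
Variables (mu : mu_function) (G : hstruct).
Hypothesis hG : is_generic mu G.
Variable M : hstruct.
Hypothesis hM : models M (theory G).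

Lemma definable_eq n (i j : 'I_n) : definable (fun M v => v i = v j).
Proof. by exists (FEq i j). Qed.

Lemma definable_R n (i j k : 'I_n) : definable (fun M v => hR (v i) (v j) (v k)).
Proof. by exists (FRel i j k). Qed.

Lemma definable_sat n (phi : formula n) : definable (fun M v => sat phi v).
Proof. by exists phi. Qed.

Lemma model_line (a b : M) : a != b -> exists z, hR a b z.
Proof.
pose i0 : 'I_2 := ord0; pose i1 : 'I_2 := ord_max.
pose P (N : hstruct) (v : 'I_2 -> N) := v i0 <> v i1 -> exists z, hR (v i0) (v i1) z.
have dP : definable P.
  apply: definable_imp; first exact/definable_not/definable_eq.
  apply: (definable_ext _ (definable_ex (definable_R (lift ord0 i0) (lift ord0 i1) ord0))).
  by move=> N v; split=> -[z]; exists z; move: p; rewrite !vcons_lift vcons0.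
move=> /eqP ab; apply: (definable_transfer hM dP _ (vpair a b)) => //.
by move=> v /eqP; apply: gen_line hG _ _.
Qed.

Lemma model_infinite (S : {fset M}) : exists x, x \notin S.
Proof.
pose k := #|` S|.
pose P (N : hstruct) (v : 'I_k -> N) := exists x, forall i, x <> v i.
have dP : definable P.
  apply: (definable_ext _ (definable_ex (definable_big
    (fun i : 'I_k => definable_not (definable_eq ord0 (lift ord0 i)))))).
  by move=> N v; split=> -[x h]; exists x => i; move: (h i); rewrite vcons_lift vcons0.
have [x0] : inhabited M.
  pose Q (N : hstruct) (v : 'I_0 -> N) := exists x : N, x = x.
  have dQ : definable Q.
    apply: (definable_ext _ (definable_ex (definable_eq (ord0 : 'I_1) ord0))).
    by move=> N v; split=> -[x h]; exists x.
  have w (i : 'I_0) : M by case: i.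
  have [|x _] := definable_transfer hM dQ _ w; last by exists.
  by move=> v; have [x] := gen_inhabited hG; exists x.
have [|x h] := definable_transfer hM dP _ (fun i => nth x0 (enum_fset S) i).
  move=> v; have [x xS] := gen_infinite hG [fset x in [seq v i | i <- enum 'I_k]].
  exists x => i e; move: xS; rewrite !inE e; apply/negP; rewrite negbK.
  by apply/mapP; exists i; rewrite ?mem_enum.
exists x; apply/negP => xS.
have ix : (index x (enum_fset S) < k)%N by rewrite index_mem.
by apply: (h (Ordinal ix)); rewrite /= nth_index.
Qed.

(** The quantifier-free diagram of Y is one formula; if no tuple of G satisfied it, its negation
    would transfer to M. *)
Lemma model_embeds (Y : {fset M}) : exists f : M -> G, embedding_on Y f.
Proof.
have [g0] := gen_inhabited hG.
have [->|/fset0Pn[y0 y0Y]] := eqVneq Y fset0.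
  by exists (fun=> g0); split=> [x y|x y z]; rewrite inE.
pose k := #|` Y|; pose s := enum_fset Y.
pose w (i : 'I_k) : M := nth y0 s i.
pose Q (N : hstruct) (v : 'I_k -> N) := (forall i j : 'I_k, i != j -> v i <> v j) /\
  (forall i j l : 'I_k, hR (v i) (v j) (v l) = hR (w i) (w j) (w l)).
have dQ : definable Q.
  apply: definable_and.
    apply: definable_big => i; apply: definable_big => j.
    have [_|_] := eqVneq i j; last first.
      by apply: (definable_ext _ (definable_not (definable_eq i j))) => N v; split=> // h; apply: h.
    by exists (FImp (FBot k) (FBot k)) => N v; split=> //= _ [].
  apply: definable_big => i; apply: definable_big => j; apply: definable_big => l.
  case: (hR (w i) (w j) (w l)); first exact: definable_R.
  apply: (definable_ext _ (definable_not (definable_R i j l))) => N v.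
  by case: (hR _ _ _); split.
have [v [vinj vR]] : exists v : 'I_k -> G, Q G v.
  apply: contrapT => no; apply: (definable_transfer hM (definable_not dQ) _ w).
    by move=> v Qv; apply: no; exists v.
  split=> // i j ij /eqP; rewrite /w nth_uniq ?fset_uniq //.
  by move/negP: ij.
have lt x : x \in Y -> (index x s < k)%N by move=> xY; rewrite index_mem.
pose f x := v (insubd (Ordinal (lt _ y0Y)) (index x s)).
have fE x (xY : x \in Y) : f x = v (Ordinal (lt x xY)).
  by rewrite /f; congr v; apply: val_inj; rewrite val_insubd lt.
exists f; split=> [x y xY yY|x y z xY yY zY]; rewrite !fE.
  move=> e; have [e'|/vinj//] := eqVneq (Ordinal (lt x xY)) (Ordinal (lt y yY)).
  by move/(congr1 val): e' => /= e'; rewrite -(nth_index y0 xY) -/s e' nth_index.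
by rewrite vR /w /= !nth_index.
Qed.

Lemma model_K0 (A : {fset M}) : K0 A.
Proof.
apply/K0P => Y _ cY; have [f emb] := model_embeds Y.
rewrite -(emb_delta emb) //; apply: (K0P _).1 (gen_K0 hG (f @` Y)) _ _ _ => //.
by rewrite (emb_card emb).
Qed.

Lemma model_steiner : steiner M.
Proof.
move=> x y /model_line[z R]; exists z; split=> // z' R'.
exact: third_point_unique model_K0 R R'.
Qed.

(** The tuple w lists the b exceptional points. As b does not depend on the parameters, the
    dichotomy is a single universal statement and transfers. *)
Lemma model_definable n (phi : formula n.+1) (v : 'I_n -> M) :
  finite_set (solutions phi v) \/ finite_set (~` solutions phi v)%classic.
Proof.
have [b Hb] := definable_bound hG phi.
pose P1 (N : hstruct) (v : 'I_n -> N) := exists w : 'I_b -> N, forall x,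
  (forall i, x <> w i) -> sat phi (vcons x v).
pose P2 (N : hstruct) (v : 'I_n -> N) := exists w : 'I_b -> N, forall x,
  (forall i, x <> w i) -> ~ sat phi (vcons x v).
pose rho := vlift (fun i : 'I_n => rshift b i).
have far : definable (fun (N : hstruct) (u : 'I_(b + n).+1 -> N) =>
    forall i : 'I_b, u ord0 <> u (lift ord0 (lshift n i))).
  by apply: definable_big => i; apply/definable_not/definable_eq.
have dsat := definable_rename rho (definable_sat phi).
have eqv (N : hstruct) x (w : 'I_b -> N) (u : 'I_n -> N) :
    (fun i => vcons x (vapp w u) (rho i)) = vcons x u.
  by rewrite vcons_vlift; congr vcons; apply: funext => i; rewrite vapp_r.
have eqf (N : hstruct) x (w : 'I_b -> N) (u : 'I_n -> N) :
   (forall i : 'I_b, vcons x (vapp w u) ord0 <> vcons x (vapp w u) (lift ord0 (lshift n i)))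
   <-> (forall i, x <> w i).
  by split=> h i; move: (h i); rewrite vcons0 vcons_lift vapp_l.
have dP1 : definable P1.
  apply: (definable_ext _ (definable_exblock (definable_all (definable_imp far dsat)))).
  move=> N u; split=> -[w h]; exists w => x; move: (h x); rewrite eqv; rewrite eqf; exact: id.
have dP2 : definable P2.
  apply: (definable_ext _ (definable_exblock (definable_all (definable_imp far (definable_not dsat))))).
  move=> N u; split=> -[w h]; exists w => x; move: (h x); rewrite eqv eqf; exact: id.
have PG (u : 'I_n -> G) : P1 G u \/ P2 G u.
  have [x0] := gen_inhabited hG; have [S [cS HS]] := Hb u.
  pose w (i : 'I_b) := nth x0 (enum_fset S) i.
  have wS x : (forall i, x <> w i) -> x \notin S.
    move=> h; apply/negP => xS.
    have ix : (index x (enum_fset S) < b)%N by apply: leq_trans cS; rewrite index_mem.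
    by apply: (h (Ordinal ix)); rewrite /w /= nth_index.
  by case: HS => H; [left | right]; exists w => x /wS; apply: H.
have fin (w : 'I_b -> M) : finite_set (range w) by apply: finite_image.
have := definable_transfer hM (definable_or dP1 dP2) PG v.
case=> -[w h]; [right | left]; apply: (sub_finite_set _ (fin w)) => x /= sx.
  by apply: contrapT => nw; apply: sx; apply: h => i e; apply: nw; exists i.
by apply: contrapT => nw; apply: (h x) => // i e; apply: nw; exists i.
Qed.

End Model.

(** One point is gained, but at least two triples cross from it to A. *)
Lemma delta_addpt2 (M : hstruct) (A S T : {fset M}) x : x \notin A -> S != T ->
  is_triple S -> is_triple T -> S `<=` x |` A -> T `<=` x |` A -> x \in S -> x \in T ->
  delta (x |` A) < delta A.
Proof.
move=> xA ST tS tT SA TA xS xT.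
have nA X : x \in X -> ~~ (X `<=` A).
  by move=> xX; apply/negP => /fsubsetP/(_ x xX); rewrite (negbTE xA).
have n1 X : is_triple X -> ~~ (X `<=` [fset x]).
  by move=> tX; apply/negP => /fsubset_leq_card; rewrite cardfs1 triple_card.
have : (2 <= #|` crossing [fset x] A|)%N.
  (* [cardfs2] evaluates the cardinality of [[fset S; T]] to [(S != T).+1]. *)
  rewrite -[2%N]/(true.+1) -ST -cardfs2; apply: fsubset_leq_card.
  by rewrite fsubUset !fsub1set !in_crossing SA TA tS tT !n1 // !nA.
have := delta_modular [fset x] A; rewrite (delta_small (A := [fset x])) ?cardfs1 //.
have -> : [fset x] `&` A = fset0.
  by apply/fsetP => y; rewrite !inE; case: eqP => // ->; rewrite (negbTE xA).
rewrite delta0; lia.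
Qed.

(** * Lines and cycles in a Steiner triple system inside K0 *)

Section Lines.
Variable M : hstruct.
Hypotheses (KM : forall A : {fset M}, K0 A) (stM : steiner M).
Implicit Types (a b c d x y z : M).

Lemma starP x y : x != y -> hR x y (star x y).
Proof.
move=> xy; rewrite /star; case: pselect => [h|no]; first exact: xchooseP h.
by have [z [R _]] := stM xy; case: no; exists z.
Qed.

Lemma hR_star x y z : hR x y z -> z = star x y.
Proof.
by move=> R; have [xy _ _] := hR_distinct R; apply: third_point_unique KM R (starP xy).
Qed.

Lemma starK a x : a != x -> star a (star a x) = x.
Proof. by move=> /starP R; apply/esym/hR_star; rewrite hR_swap23. Qed.

Lemma lineC a b : a != b -> line b a = line a b.
Proof.
move=> ab; have e : star a b = star b a.
  by apply: hR_star; rewrite hR_swap12; apply: starP.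
apply/seteqP; rewrite /line e.
by split=> x [[->|->]|->]; do ?[by right | by left; left | by left; right].
Qed.

Lemma line_neq a b x : ~ line a b x -> a != x /\ b != x.
Proof. by move=> nL; split; apply/eqP => e; apply: nL; rewrite e; left; [left | right]. Qed.

Lemma star_line a b x : a != b -> ~ line a b x -> ~ line a b (star a x).
Proof.
move=> ab nL; have [ax bx] := line_neq nL; have R := starP ax.
case=> [[e|e]|e]; move: R; rewrite e.
- by move/hR_distinct => [_]; rewrite eqxx.
- by rewrite hR_swap23 => /hR_star e'; apply: nL; right.
- move=> R; apply: nL; left; right.
  have := starP ab; rewrite hR_swap23 => /hR_star ->.
  by apply: hR_star; rewrite hR_swap23.
Qed.

(** A pair is already strong, since every larger finite set has predimension at least 2. *)
Lemma icl_pair a b : a != b -> icl a b = [set a; b]%classic.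
Proof.
move=> ab; apply/seteqP; split=> x.
  apply; split=> //; exists [fset a; b].
    by apply/seteqP; split=> y /=; rewrite !inE; [case=> ->; rewrite eqxx ?orbT
      | case/orP => /eqP ->; [left | right]].
  move=> C abC; rewrite (delta_small (A := [fset a; b])) cardfs2 ab //.
  have := fsubset_leq_card abC; rewrite cardfs2 ab => /(K0_ge2 (@KM C)).
  by clear; lia.
by move=> abx X [_]; apply.
Qed.

Lemma cycle_point_line a b d n : a != b -> ~ line a b d -> ~ line a b (cycle_point a b d n).
Proof.
move=> ab nL; elim: n => //= n IH; case: ifP => _; last exact: star_line.
by rewrite -lineC // in IH *; apply: star_line; rewrite // eq_sym.
Qed.

(* Each point of the path adds one line through a or b, so the first return
   would create a set of at least four points and dimension two. *)
Lemma no_finite_cycle a b d : a != b -> ~ line a b d -> infinite_cycle a b d.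
Proof.
move=> ab nL i0 j0 ij0; apply/negP => /eqP e0.
pose p := cycle_point a b d; pose s n := if odd n then b else a.
have pL n : ~ line a b (p n) by apply: cycle_point_line.
have sp n : s n != p n by rewrite /s; have [ap bp] := line_neq (pL n); case: ifP.
have pR n : hR (s n) (p n) (p n.+1) by rewrite [p n.+1]/(star (s n) (p n)); apply: starP.
have ex : exists j, [exists i : 'I_j, p i == p j].
  by exists j0; apply/existsP; exists (Ordinal ij0); rewrite /= /p e0.
(* With j minimal, the points p i, ..., p (j - 1) are distinct. *)
case: (ex_minnP ex) => j /existsP[[i ij] /= /eqP eij] minj.
have inj k l : (k < l < j)%N -> p k != p l.
  move=> /andP[kl lj]; apply/negP => /eqP e; have := minj l.
  rewrite leqNgt lj => h; have : false; last by [].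
  by apply: h; apply/existsP; exists (Ordinal kl); rewrite /= e.
have ij1 : (i.+1 < j)%N.
  rewrite ltn_neqAle ij andbT; apply/eqP => e.
  by have [_ _] := hR_distinct (pR i); rewrite e eij eqxx.
pose X n : {fset M} := [fset a; b] `|` [fset x in [seq p l | l <- iota i n]].
have inX n x : (x \in X n) = [|| x == a, x == b | x \in [seq p l | l <- iota i n]].
  by rewrite !inE orbA.
have XS n : X n.+1 = p (i + n)%N |` X n.
  apply/fsetP => x; rewrite in_fset1U !inX -[n.+1]addn1 iotaD map_cat mem_cat mem_seq1.
  by rewrite !orbA orbC !orbA.
have sX l n : s l \in X n by rewrite inX /s; case: ifP; rewrite eqxx ?orbT.
have pX l n : (i <= l < i + n)%N -> p l \in X n.
  move=> h; rewrite inX; apply/orP; right; apply/orP; right.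
  by apply: map_f; rewrite mem_iota.
have pnX n : (i + n < j)%N -> p (i + n)%N \notin X n.
  move=> lt; have [ap bp] := line_neq (pL (i + n)%N).
  rewrite inX ![p (i + n)%N == _]eq_sym (negbTE ap) (negbTE bp) /=.
  apply/mapP => -[l]; rewrite mem_iota => /andP[il ln] e.
  by have := @inj l (i + n)%N; rewrite ln lt e eqxx => /(_ isT).
(* The points a and b contribute 2 and the first path point 1; each later point is on a line with
   its predecessor and a or b. *)
have X1 n : (i + n < j)%N -> delta (X n.+1) <= 3.
  elim: n => [|n IH] lt; rewrite XS.
    have := deltaU1 (X 0%N) (p (i + 0)%N).
    have := delta_le_card (X 0%N).
    have -> : #|` X 0%N| = 2%N.
      by rewrite /X /= (_ : [fset x in [::]] = fset0) ?fsetU0 ?cardfs2 ?ab //;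
         apply/fsetP => x; rewrite !inE.
    by clear; lia.
  have lt' : (i + n < j)%N by apply: ltn_trans lt; rewrite addnS.
  apply: le_trans (IH lt'); apply: (@delta_addpt M _ _ (s (i + n)%N) (p (i + n)%N)) => //.
  - exact: pnX.
  - by apply: pX; rewrite leq_addr addnS /=.
  - by rewrite addnS hR_swap12 hR_swap23; apply: pR.
(* So p (i + n.+1) is the last new point, and its neighbours on the path are p (i + n) and p j = p
   i. *)
pose n := (j - i.+2)%N.
have en : (i + n.+1).+1 = j by rewrite /n; move: ij1; clear; lia.
have en1 : (i + n.+1 < j)%N by rewrite -en.
have en0 : (i + n < j)%N by apply: ltn_trans en1; rewrite addnS.
have R1 := pR (i + n)%N; rewrite -addnS in R1.
have R2 := pR (i + n.+1)%N; rewrite en -eij in R2.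
have tr (x y z : M) : hR x y z -> is_triple [fset x; y; z] by rewrite hR_triple.
have ss : s (i + n)%N != s (i + n.+1)%N.
  by rewrite /s addnS /=; case: (odd _) => //=; rewrite eq_sym.
have sub : forall S : {fset M}, (forall x, x \in S -> x \in X n.+2) -> S `<=` X n.+2.
  by move=> S h; apply/fsubsetP.
have m1 : p (i + n)%N \in X n.+2 by apply: pX; clear; lia.
have m2 : p (i + n.+1)%N \in X n.+2 by apply: pX; clear; lia.
have m3 : p i \in X n.+2 by apply: pX; clear; lia.
(* The closing point is on two lines, which differ because one passes through a and the other
   through b. *)
have lt : delta (X n.+2) < delta (X n.+1).
  rewrite XS; apply: (@delta_addpt2 M _ _ _ (p (i + n.+1)%N) _ _ (tr _ _ _ R1) (tr _ _ _ R2)).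
  - exact: pnX.
  - apply: contra_neq ss => /fsetP/(_ (s (i + n)%N)).
    rewrite !inE eqxx /= => /esym/orP[/orP[/eqP//|]|] /eqP e.
      by move: (line_neq (pL (i + n.+1)%N)); rewrite -e /s; case: ifP => _ []; rewrite eqxx.
    by move: (line_neq (pL i)); rewrite -e /s; case: ifP => _ []; rewrite eqxx.
  - by rewrite -XS !fsubUset !fsub1set sX m1.
  - by rewrite -XS !fsubUset !fsub1set sX m3 m2.
  - by rewrite !inE eqxx orbT.
  - by rewrite !inE eqxx orbT.
have c4 : (4 <= #|` X n.+2|)%N.
  have [ai bi] := line_neq (pL i); have [aj bj] := line_neq (pL (i + n.+1)%N).
  have : p i != p (i + n.+1)%N by apply: inj; rewrite en1 andbT; clear; lia.
  move=> pij; have : #|` p (i + n.+1)%N |` [fset a; b; p i]| = 4%N.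
    rewrite cardfsU1 cardfs3 // !inE ![p (i + n.+1)%N == _]eq_sym.
    by rewrite (negbTE aj) (negbTE bj) (negbTE pij).
  move=> <-; apply: fsubset_leq_card; rewrite !fsubUset !fsub1set m2 m3 andbT.
  by rewrite !inX !eqxx /= orbT.
have := (K0P _).1 (@KM (X n.+2)) _ (fsubset_refl _) c4.
by have := X1 n en0; move: lt; clear; lia.
Qed.

End Lines.

(** * Algebraic closure *)

Section Acl.
Variables (mu : mu_function) (G : hstruct).
Hypothesis hG : is_generic mu G.

Lemma noncollinear_strong (M : hstruct) (a b x : M) : (forall A : {fset M}, K0 A) ->
  a != b -> a != x -> b != x -> ~~ hR a b x -> strong_in [fset a; b; x].
Proof.
move=> KM ab ax bx nR C sC; have c3 := cardfs3 ab ax bx.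
have nt : ~~ is_triple [fset a; b; x] by rewrite -hR_triple.
have [_ h] := @KM C _ sC (eq_leq c3).
exact: h C sC (fsubset_refl _).
Qed.

(** Both non-collinear triples are strong in G, hence n-strong for every n, so the map fixing a and
    b and sending x to y preserves all formulas. *)
Lemma gen_noncollinear (a b x y : G) n (phi : formula n.+1) (v : 'I_n -> G) :
  (forall i, v i = a \/ v i = b) -> a != b ->
  a != x -> b != x -> ~~ hR a b x -> a != y -> b != y -> ~~ hR a b y ->
  sat phi (vcons x v) -> sat phi (vcons y v).
Proof.
move=> vab ab ax bx nx ay by_ ny.
have [k Hk] := sat_nstrong hG phi 3.
pose f z := if z == x then y else z.
have fx : f x = y by rewrite /f eqxx.
have fa : f a = a by rewrite /f (negbTE ax).
have fb : f b = b by rewrite /f (negbTE bx).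
have im : f @` [fset a; b; x] = [fset a; b; y].
  by rewrite !imfsetU !imfset_fset1 fx fa fb.
have emb : embedding_on [fset a; b; x] f.
  apply: emb_of_triples; first by apply/card_in_imfsetP; rewrite im !cardfs3.
  move=> S SA cS; have -> : S = [fset a; b; x].
    by apply/eqP; rewrite eqEfcard SA cS cardfs3.
  by rewrite im -!hR_triple (negbTE nx) (negbTE ny).
have vx i : vcons x v i \in [fset a; b; x].
  rewrite /vcons; case: unlift => [j|] /=; rewrite !inE ?eqxx ?orbT //.
  by case: (vab j) => ->; rewrite eqxx ?orbT.
have KG (A : {fset G}) : K0 A := gen_K0 hG A.
have := Hk [fset a; b; x] f _ (eq_leq (cardfs3 ab ax bx)) emb _ _ vx.
rewrite im => /(_ _ _)/Wrap[||[H _] /H].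
- by apply/strong_in_nstrong/noncollinear_strong.
- by apply/strong_in_nstrong/noncollinear_strong.
rewrite vcons_map fx; congr (sat phi (vcons y _)); apply: funext => i.
by case: (vab i) => ->.
Qed.

Variable M : hstruct.
Hypothesis hM : models M (theory G).

Lemma acl_line (a b : M) : a != b -> acl [set a; b]%classic = line a b.
Proof.
move=> ab.
have KM (A : {fset M}) : K0 A := @model_K0 mu G hG M hM A.
have stM := model_steiner hG hM.
have R := starP stM ab.
apply/seteqP; split=> x; last first.
  case=> [[->|->]|->].
  - exists 1%N, (FEq ord0 (lift ord0 ord0)), (fun=> a); split; first by left.
      by apply: (sub_finite_set _ (finite_set1 a)) => y; rewrite /solutions /= vcons_lift vcons0.
    by rewrite /solutions /= vcons_lift vcons0.
  - exists 1%N, (FEq ord0 (lift ord0 ord0)), (fun=> b); split; first by right.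
      by apply: (sub_finite_set _ (finite_set1 b)) => y; rewrite /solutions /= vcons_lift vcons0.
    by rewrite /solutions /= vcons_lift vcons0.
  - exists 2%N, (FRel (lift ord0 ord0) (lift ord0 ord_max) ord0), (vpair a b); split.
    + by move=> i; rewrite /vpair; case: ifP; [left | right].
    + apply: (sub_finite_set _ (finite_set1 (star a b))) => y; rewrite /solutions /=.
      by rewrite !vcons_lift vcons0 /vpair /= => /(hR_star KM stM).
    + by rewrite /solutions /= !vcons_lift vcons0.
move=> [n [phi [v [vab /finite_fsetP[S eS] phix]]]]; apply: contrapT => nL.
have [ax bx] := line_neq nL.
have nx : ~~ hR a b x by apply/negP => /(hR_star KM stM) e; apply: nL; right.
(* The parameters repeat a and b; [sig] records which is which, so that the statement to transfer
   concerns only the triple (x, a, b). *)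
pose sig (i : 'I_n) : 'I_2 := if v i == a then ord0 else ord_max.
have vE i : v i = vpair a b (sig i).
  rewrite /vpair /sig; case: (eqVneq (v i) a) => //= ne.
  by case: (vab i) => // e; rewrite e eqxx in ne.
pose t0 : 'I_3 := ord0; pose t1 : 'I_3 := lift ord0 ord0; pose t2 : 'I_3 := lift ord0 ord_max.
pose K := #|` S|.
pose cover (N : hstruct) (t : 'I_3 -> N) := exists w : 'I_K -> N, forall y,
  sat phi (vcons y (fun i => t (lift ord0 (sig i)))) -> exists i, y = w i.
have dcover : definable cover.
  pose rho := vlift (fun i : 'I_n => rshift K (lift ord0 (sig i))).
  have d1 := definable_rename rho (definable_sat phi).
  have d2 := definable_not (definable_big (fun i : 'I_K =>
    definable_not (definable_eq (ord0 : 'I_(K + 3).+1) (lift ord0 (lshift 3 i))))).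
  apply: (definable_ext _ (definable_exblock (definable_all (definable_imp d1 d2)))).
  move=> N t; split=> -[w h]; exists w => y; move: (h y); rewrite vcons_vlift.
    have -> : (fun i => vapp w t (rshift K (lift ord0 (sig i)))) =
       (fun i => t (lift ord0 (sig i))) by apply: funext => i; rewrite vapp_r.
    move=> h1 /h1 h2; apply: contrapT => no; apply: h2 => i.
    by rewrite vcons0 vcons_lift vapp_l => e; apply: no; exists i.
  have -> : (fun i => vapp w t (rshift K (lift ord0 (sig i)))) =
     (fun i => t (lift ord0 (sig i))) by apply: funext => i; rewrite vapp_r.
  move=> h1 /h1[i e] h2; apply: (h2 i).
  by rewrite vcons0 vcons_lift vapp_l.
(* No triple of G is bad: all points off the line would satisfy phi, and they are infinitely many,
   while [cover] allows at most K. *)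
pose bad (N : hstruct) (t : 'I_3 -> N) :=
  ((t t1 <> t t2 /\ t t1 <> t t0) /\ (t t2 <> t t0 /\ ~ hR (t t1) (t t2) (t t0))) /\
  (sat phi (fun i => t (vlift sig i)) /\ cover N t).
have dbad : definable bad.
  apply: definable_and; first apply: definable_and; first apply: definable_and;
    try exact/definable_not/definable_eq.
    apply: definable_and; first exact/definable_not/definable_eq.
    exact/definable_not/definable_R.
  apply: definable_and => //.
  exact: (definable_rename (vlift sig) (definable_sat phi)).
have eqs (N : hstruct) (t : 'I_3 -> N) :
    (fun i => t (vlift sig i)) = vcons (t t0) (fun i => t (lift ord0 (sig i))).
  by rewrite [t in LHS](vcons_eta t) vcons_vlift.
apply: (definable_transfer hM (definable_not dbad) _ (vcons x (vpair a b))).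
  move=> t [[[/eqP ab' /eqP ax'] [/eqP bx' /negP nx']] [sx [w hw]]].
  rewrite eqs in sx.
  have [c Rc] := gen_line hG ab'.
  have [y] := gen_infinite hG ([fset t t1; t t2; c] `|` [fset z in [seq w i | i <- enum 'I_K]]).
  rewrite !inE !negb_or -!andbA => /and4P[ya yb yc yw].
  have ny : ~~ hR (t t1) (t t2) y.
    apply/negP => Ry; move: yc; apply/negP; rewrite negbK; apply/eqP.
    exact: third_point_unique (fun A => gen_K0 hG A) Ry Rc.
  rewrite eq_sym in ya; rewrite eq_sym in yb.
  have vab' i : t (lift ord0 (sig i)) = t t1 \/ t (lift ord0 (sig i)) = t t2.
    by rewrite /sig; case: ifP; [left | right].
  have [i e] := hw y (gen_noncollinear vab' ab' ax' bx' nx' ya yb ny sx).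
  by move/negP: yw; apply; apply/mapP; exists i; rewrite ?mem_enum.
have e1 : vcons x (vpair a b) t1 = a by rewrite vcons_lift.
have e2 : vcons x (vpair a b) t2 = b by rewrite vcons_lift.
have e0 : vcons x (vpair a b) t0 = x by rewrite vcons0.
have ev : (fun i => vcons x (vpair a b) (lift ord0 (sig i))) = v.
  by apply: funext => i; rewrite vcons_lift vE.
split; first by rewrite e0 e1 e2; split; split; [apply/eqP | apply/eqP | apply/eqP | apply/negP].
rewrite /cover eqs e0 ev; split=> //.
exists (fun i => nth x (enum_fset S) i) => y sy.
have yS : y \in S by have : [set` S]%classic y by rewrite -eS.
have iy : (index y (enum_fset S) < K)%N by rewrite index_mem.
by exists (Ordinal iy); rewrite /= nth_index.
Qed.

End Acl.

(** * Uniformity *)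

Section Cardinality.
Local Open Scope classical_set_scope.

Lemma card_le_inj (T : Type) (U : pointedType) (A : set T) (B : set U) :
  (A #<= B)%card <-> exists f : T -> U, (forall x, A x -> B (f x)) /\
    (forall x y, A x -> A y -> f x = f y -> x = y).
Proof.
split=> [/pcard_leP/injfunPex[f fAB finj]|[f [fAB finj]]].
  by exists f; split=> // x y Ax Ay; apply: finj; rewrite inE.
apply/pcard_leP/injfunPex; exists f => // x y.
by rewrite !inE; apply: finj.
Qed.

Lemma Cantor_Bernstein_bij (T : pointedType) (A B : set T) :
  (A #<= B)%card -> (B #<= A)%card -> exists f, set_bij A B f.
Proof. by move=> AB BA; apply/card_set_bijP; rewrite card_eq_le AB BA. Qed.

(* Zorn: a maximal family of disjoint sequences exhausts A up to a finite set,
   which is then absorbed by shifting one of the sequences. *)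
Lemma infinite_times_nat (T : pointedType) (A : set T) : infinite_set A ->
  exists j : T -> nat -> T, (forall t n, A t -> A (j t n)) /\
    forall t t' n n', A t -> A t' -> j t n = j t' n' -> t = t' /\ n = n'.
Proof.
move=> infA.
pose P (F : set (nat -> T)) := (forall s n, F s -> A (s n)) /\
  (forall s s' n n', F s -> F s' -> s n = s' n' -> s = s' /\ n = n').
have [F [[FA Finj] maxF]] : exists F, P F /\ forall F', F `<` F' -> ~ P F'.
  apply: Zorn_bigcup => C CP tot; split=> [s n [F CF Fs]|s s' n n' [F CF Fs] [F' CF' Fs']].
    by have [h _] := CP _ CF; apply: h.
  have [FF'|F'F] := tot _ _ CF CF'.
    by have [_ h] := CP _ CF'; apply: h => //; apply: FF'.
  by have [_ h] := CP _ CF; apply: h => //; apply: F'F.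
pose R := [set x | A x /\ forall s n, F s -> s n <> x].
have finR : finite_set R.
  apply: contrapT => /infiniteP/card_le_inj[s0 [s0R s0inj]].
  have nF : ~ F s0 by move=> Fs; have [_ /(_ s0 0%N Fs)] := s0R 0%N I.
  apply: (maxF (s0 |` F)).
    split=> [s|]; first by right.
    by move=> /(_ s0) h; apply: nF; apply: h; left.
  split=> [s n [->|]|s s' n n' [->|Fs] [->|Fs']].
  - by have [] := s0R n I.
  - exact: FA.
  - by move=> /s0inj => /(_ I I).
  - by move=> e; have [_ /(_ s' n' Fs')] := s0R n I; rewrite e.
  - by move=> e; have [_ /(_ s n Fs)] := s0R n' I; rewrite e.
  - exact: Finj.
have [s0 Fs0] : exists s, F s.
  apply: contrapT => noF; apply: infA; apply: sub_finite_set finR => x Ax; split=> // s n Fs.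
  by case: noF; exists s.
have /finite_seqP[rs eR] := finR.
pose p := size rs.
(* Each t receives a sequence of F and an index. Along s0 indices are shifted by p, which frees the
   first p of them for the leftover set R. *)
have ex t : exists q : (nat -> T) * nat, A t -> F q.1 /\
   ((exists n, t = q.1 n /\ (q.1 <> s0 /\ q.2 = n \/ q.1 = s0 /\ q.2 = (n + p)%N)) \/
    [/\ R t, q.1 = s0 & q.2 = index t rs]).
  have [At|nAt] := pselect (A t); last by exists (s0, 0%N).
  have [[s [n [Fs e]]]|no] := pselect (exists s n, F s /\ s n = t).
    have [es|ns] := pselect (s = s0).
      by exists (s0, (n + p)%N) => _; split=> //; left; exists n; split; [rewrite -e es | right].
    by exists (s, n) => _; split=> //; left; exists n; split=> //; left.
  exists (s0, index t rs) => _; split=> //; right; split=> //; split=> // s n Fs e.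
  by apply: no; exists s, n.
have [q Hq] := choice ex.
(* The index of t and the number n are coded into one position along the sequence of t. *)
exists (fun t (n : nat) => (q t).1 (choice.pickle ((q t).2, n))); split=> [t n At|t t' n n' At At'].
  by apply: FA; have [] := Hq t At.
have [Fq Ht] := Hq t At; have [Fq' Ht'] := Hq t' At'.
move=> /(Finj _ _ _ _ Fq Fq')[e1 /(pcan_inj choice.pickleK)[e2 ->]]; split=> //.
have ip u : R u -> (index u rs < p)%N by rewrite eR /= index_mem.
case: Ht Ht' => [[m [et c]]|[Rt f1 f2]] [[m' [et' c']]|[Rt' f1' f2']].
- rewrite [LHS]et [RHS]et' e1; congr ((q t').1 _).
  by case: c c' => -[c1 c2] [] [c1' c2']; [congruence | congruence | congruence
     | apply: (@addIn p); rewrite -c2 -c2' e2].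
- have := ip _ Rt'; rewrite -f2' -e2.
  by case: c => -[c1 ->]; [congruence | rewrite ltnNge leq_addl].
- have := ip _ Rt; rewrite -f2 e2.
  by case: c' => -[c1 ->]; [congruence | rewrite ltnNge leq_addl].
- have it : t \in rs by move: Rt; rewrite eR.
  have it' : t' \in rs by move: Rt'; rewrite eR.
  by rewrite -(nth_index t it) -f2 e2 f2' nth_index.
Qed.

End Cardinality.

(* A component of the path graph is a two-way infinite path. Its points are
   indexed from a base point t: (false, n) is reached by n steps starting with a,
   and (true, n) by n + 1 steps starting with b. *)
Section Path.
Variable M : hstruct.
Hypotheses (KM : forall A : {fset M}, K0 A) (stM : steiner M).
Implicit Types (a b c d t x y z : M) (i j : bool * nat).

Definition walk a b t i : M :=
  if i.1 then cycle_point b a t i.2.+1 else cycle_point a b t i.2.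

(** The action of a on indices. On both arms a leads away from the base point at even indices and
    back at odd ones. *)
Definition walk_a i : bool * nat := (i.1, if odd i.2 then i.2.-1 else i.2.+1).

(** The action of b on indices; at index 0 it passes from one arm to the other. *)
Definition walk_b i : bool * nat :=
  if odd i.2 then (i.1, i.2.+1) else if i.2 is n.+1 then (i.1, n) else (~~ i.1, 0%N).

Lemma walk_aK : involutive walk_a.
Proof.
by move=> [s [|n]]; rewrite /walk_a //=; case on: (odd n) => /=; rewrite ?on.
Qed.

Lemma walk_bK : involutive walk_b.
Proof.
move=> [s [|n]]; rewrite /walk_b /= ?negbK //.
case on: (odd n) => /=; last by rewrite on.
by case: n on => //= n /negbTE ->.
Qed.

Lemma cycle_pointE a b d n : cycle_point a b d n.+1 =
  star (if odd n then b else a) (cycle_point a b d n).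
Proof. by []. Qed.

Section Pair.
Variables a b : M.
Hypothesis ab : a != b.
Notation L := (line a b).

Lemma lineN_star x : ~ L x -> ~ L (star a x) /\ ~ L (star b x).
Proof.
move=> nL; split; first exact: star_line.
rewrite -(lineC KM stM ab) in nL *; apply: star_line => //; by rewrite eq_sym.
Qed.

Lemma walk_line t i : ~ L t -> ~ L (walk a b t i).
Proof.
move=> nL; rewrite /walk; case: ifP => _; last exact: cycle_point_line.
by rewrite -(lineC KM stM ab) in nL *; apply: cycle_point_line; rewrite // eq_sym.
Qed.

Lemma cycle_pointS c d x n : c != d -> ~ line c d x ->
  star (if odd n then d else c) (cycle_point c d x n.+1) = cycle_point c d x n.
Proof.
move=> cd nL; rewrite /= starK //.
have := line_neq (cycle_point_line KM stM (n := n) cd nL).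
by case: ifP => _ [].
Qed.

Lemma star_walk t i : ~ L t ->
  star a (walk a b t i) = walk a b t (walk_a i) /\
  star b (walk a b t i) = walk a b t (walk_b i).
Proof.
move=> nL; have nL' : ~ line b a t by rewrite (lineC KM stM ab).
have ba : b != a by rewrite eq_sym.
have S1 n := cycle_pointS n ab nL; have S2 n := cycle_pointS n ba nL'.
have E1 n := cycle_pointE a b t n; have E2 n := cycle_pointE b a t n.
have fst_pair (s : bool) (n : nat) : ((s, n).1 = s) * ((s, n).2 = n) by [].
case: i => -[] n; rewrite /walk /walk_a /walk_b !fst_pair; case on: (odd n); split.
- by have := S2 n; rewrite on; case: n on.
- by rewrite !fst_pair [RHS]E2 oddS on.
- by rewrite [RHS]E2 oddS on.
- by have := S2 n; rewrite on; case: n on.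
- by case: n on => [//|n] on; have := S1 n; move: on; rewrite oddS => /negbTE ->.
- by rewrite !fst_pair [RHS]E1 on.
- by rewrite [RHS]E1 on.
- case: n on => [//|n] on; have := S1 n.
  by move: on; rewrite oddS => /negbFE ->.
Qed.

Definition orbit x : set M := [set walk a b x i | i in [set: bool * nat]]%classic.

Lemma orbit_refl x : orbit x x.
Proof. by exists (false, 0%N). Qed.

Lemma orbit_line x y : ~ L x -> orbit x y -> ~ L y.
Proof. by move=> nL [i _ <-]; apply: walk_line. Qed.

Lemma orbit_star x y : ~ L x -> orbit x y -> orbit x (star a y) /\ orbit x (star b y).
Proof.
move=> nL [i _ <-]; have [-> ->] := star_walk i nL.
by split; [exists (walk_a i) | exists (walk_b i)].
Qed.

Lemma walk_ind (P : M -> Prop) x : P x ->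
  (forall y, ~ L y -> P y -> P (star a y) /\ P (star b y)) -> ~ L x ->
  forall y, orbit x y -> P y.
Proof.
move=> Px stP nL y [[s n] _ <-]; have nL' : ~ line b a x by rewrite (lineC KM stM ab).
have ba : b != a by rewrite eq_sym.
have H1 m : P (cycle_point a b x m).
  elim: m => // m IH; rewrite cycle_pointE.
  by have [h1 h2] := stP _ (cycle_point_line KM stM (n := m) ab nL) IH; case: ifP.
have H2 m : P (cycle_point b a x m).
  elim: m => // m IH; rewrite cycle_pointE.
  have nLm : ~ L (cycle_point b a x m).
    by rewrite -(lineC KM stM ab); apply: cycle_point_line.
  by have [h1 h2] := stP _ nLm IH; case: ifP.
by case: s; rewrite /walk /=; [apply: (H2 n.+1) | apply: H1].
Qed.

(** The operations by a and b are involutions off the line, so every step of a walk can be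
    undone. *)
Lemma orbit_sym x y : ~ L x -> orbit x y -> orbit y x.
Proof.
move=> nL oxy; apply: (walk_ind (P := fun y => orbit y x) _ _ nL oxy); first exact: orbit_refl.
move=> {oxy} z nLz ozx.
have [az bz] := line_neq nLz; have [nLa nLb] := lineN_star nLz.
have tr u : ~ L u -> orbit u z -> orbit u x.
  move=> nLu ouz; apply: (walk_ind (P := orbit u) ouz _ nLz ozx).
  by move=> w _; apply: orbit_star.
split; apply: tr => //.
- by rewrite -{2}(starK KM stM az); have [] := orbit_star nLa (orbit_refl _).
- by rewrite -{2}(starK KM stM bz); have [] := orbit_star nLb (orbit_refl _).
Qed.

Lemma orbit_trans x y z : ~ L x -> orbit x y -> orbit y z -> orbit x z.
Proof.
move=> nL oxy oyz; apply: (walk_ind (P := orbit x) oxy _ (orbit_line nL oxy) oyz).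
by move=> w _; apply: orbit_star.
Qed.

Lemma orbit_eq x y : ~ L x -> orbit x y -> orbit x = orbit y.
Proof.
move=> nL oxy; have oyx := orbit_sym nL oxy; have nLy := orbit_line nL oxy.
by apply/seteqP; split=> z; apply: orbit_trans.
Qed.

Lemma walk_base t i : ~ L t -> walk a b t i = t -> i = (false, 0%N).
Proof.
move=> nL; have nL' : ~ line b a t by rewrite (lineC KM stM ab).
have ba : b != a by rewrite eq_sym.
have c1 := no_finite_cycle KM stM ab nL; have c2 := no_finite_cycle KM stM ba nL'.
case: i => -[] [|n] //; rewrite /walk [(_, _).1]/= [(_, _).2]/= => /eqP e.
- by move: (c2 0%N 1%N isT); rewrite e.
- by move: (c2 0%N n.+2 isT); rewrite e.
- by move: (c1 0%N n.+1 isT); rewrite e.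
Qed.

(** One of a and b moves j towards the base point; applying it to both sides reduces to j at the
    base, where a coincidence would close a cycle. *)
Lemma walk_inj t i j : ~ L t -> walk a b t i = walk a b t j -> i = j.
Proof.
move=> nL; pose m (j : bool * nat) := (j.1 + j.2)%N.
have [k] := ubnP (m j); elim: k i j => // k IH i j mj e.
have Ia : (m (walk_a j) < m j)%N -> i = j.
  move=> lt; apply: (inv_inj walk_aK); apply: IH; first exact: leq_trans lt mj.
  by have [<- _] := star_walk i nL; have [<- _] := star_walk j nL; rewrite e.
have Ib : (m (walk_b j) < m j)%N -> i = j.
  move=> lt; apply: (inv_inj walk_bK); apply: IH; first exact: leq_trans lt mj.
  by have [_ <-] := star_walk i nL; have [_ <-] := star_walk j nL; rewrite e.
case: j mj e Ia Ib => -[] [|n] mj e Ia Ib.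
- exact: Ib.
- case on: (odd n); first by apply: Ib; rewrite /walk_b /m /= on.
  by apply: Ia; rewrite /walk_a /m /= on.
- exact: walk_base nL e.
- case on: (odd n); first by apply: Ib; rewrite /walk_b /m /= on.
  by apply: Ia; rewrite /walk_a /m /= on.
Qed.

(** The choice depends only on the orbit as a set, so all points of one orbit get the same
    representative. *)
Definition rep x : M := xget a (orbit x).

Definition reps : set M := [set t | ~ L t /\ rep t = t]%classic.

Lemma rep_orbit x : orbit x (rep x).
Proof. by apply: xgetPex; exists x; apply: orbit_refl. Qed.

Lemma rep_eq x y : ~ L x -> orbit x y -> rep x = rep y.
Proof. by move=> nL oxy; rewrite /rep (orbit_eq nL oxy). Qed.

Lemma rep_reps x : ~ L x -> reps (rep x).
Proof.
move=> nL; have o := rep_orbit x; split; first exact: orbit_line o.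
by rewrite -(rep_eq nL o).
Qed.

Lemma rep_walk t i : reps t -> rep (walk a b t i) = t.
Proof. by move=> [nL e]; rewrite -(rep_eq (y := walk a b t i) nL) //; exists i. Qed.

(** The implication under the existential makes [pos] total; on the line its value is arbitrary. *)
Lemma pos_ex x : exists i, ~ L x -> walk a b (rep x) i = x.
Proof.
have [|nL] := pselect (L x); first by exists (false, 0%N).
by have [i _ e] := orbit_sym nL (rep_orbit x); exists i.
Qed.

Definition pos x : bool * nat := projT1 (cid (pos_ex x)).

Lemma walk_pos x : ~ L x -> walk a b (rep x) (pos x) = x.
Proof. exact: (projT2 (cid (pos_ex x))). Qed.

Lemma pos_walk t i : reps t -> pos (walk a b t i) = i.
Proof.
move=> rt; have nL := walk_line (i := i) rt.1.
by apply: (walk_inj rt.1); have := walk_pos nL; rewrite rep_walk.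
Qed.

(* Were there only finitely many components, every point would be reached from
   a finite strong set D0 by adding one point and one line, through a or b, at a
   time; but no such step produces a line avoiding a, b and D0. *)
Lemma reps_infinite : (forall S : {fset M}, exists x, x \notin S) -> infinite_set reps.
Proof.
move=> infM /finite_fsetP[T eT].
have [D0 TD sD] := K0_hull KM (a |` (b |` (star a b |` T))).
have aD : a \in D0 by apply: (fsubsetP TD); rewrite !inE eqxx.
have bD : b \in D0 by apply: (fsubsetP TD); rewrite !inE eqxx orbT.
have cD : star a b \in D0 by apply: (fsubsetP TD); rewrite !inE eqxx !orbT.
(* The invariant of adding path points to D0: the predimension stays that of D0, and every triple
   not inside D0 passes through a or b. *)
pose I (D : {fset M}) := [/\ D0 `<=` D, delta D = delta D0 &
  forall S, is_triple S -> S `<=` D -> [|| S `<=` D0, a \in S | b \in S]].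
(* Quantifying over D allows x, y and x * y to be added one after the other. *)
pose P x := forall D, I D -> exists D', [/\ I D', D `<=` D' & x \in D'].
have P0 x : x \in D0 -> P x.
  by move=> xD0 D ID; exists D; split=> //; case: ID => /fsubsetP h _ _; apply: h.
have Pstep s x : (s == a) || (s == b) -> s != x -> P x -> P (star s x).
  move=> sab sx Px D ID; have [D' [ID' DD' xD']] := Px D ID.
  have [yD'|yD'] := boolP (star s x \in D'); first by exists D'.
  have [D0D' eD' tD'] := ID'; have R := starP stM sx.
  have sD0 : s \in D0 by case/orP: sab => /eqP ->.
  have sD' : s \in D' := fsubsetP D0D' _ sD0.
  have t : is_triple [fset s; x; star s x] by rewrite -hR_triple.
  have ge : delta D0 <= delta (star s x |` D').
    by apply: sD; apply: fsubset_trans D0D' _; apply: fsubsetUr.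
  exists (star s x |` D'); split.
  - split; first by apply: fsubset_trans D0D' _; apply: fsubsetUr.
      apply/eqP; rewrite eq_le ge andbT -eD'.
      by apply: (delta_addpt yD' sD' xD'); rewrite hR_swap12 hR_swap23.
    move=> S tS SD; have [yS|yS] := boolP (star s x \in S); last first.
      apply: tD' => //; apply/fsubsetP => z zS.
      by have := fsubsetP SD z zS; rewrite in_fset1U => /orP[/eqP e|//]; rewrite -e zS in yS.
    have [->|ne] := eqVneq S [fset s; x; star s x].
      by case/orP: sab => /eqP ->; rewrite !inE eqxx ?orbT.
    have := delta_addpt2 yD' ne tS t SD _ yS; rewrite !fsubUset !fsub1set !inE sD' xD' eqxx !orbT.
    by move=> /(_ isT isT); rewrite ltNge eD' ge.
  - by apply: fsubset_trans DD' _; apply: fsubsetUr.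
  - by rewrite !inE eqxx.
have Pall x : P x.
  have [|nL] := pselect (L x); first by case=> [[]|] ->; apply: P0.
  have rL := rep_reps nL.
  apply: (walk_ind (P := P) (x := rep x)); last exact: (orbit_sym nL (rep_orbit x)).
  - apply/P0/(fsubsetP TD); rewrite !in_fset1U; apply/orP; right; apply/orP; right.
    apply/orP; right; have : [set` T]%classic (rep x) by rewrite -eT.
    by [].
  - move=> y nLy Py; have [ay by_] := line_neq nLy.
    by split; apply: Pstep; rewrite ?eqxx ?orbT.
  - by case: rL.
have [x xD] := infM D0.
(* With y different from a * x and b * x, the line through x and y contains neither a nor b, yet the
   invariant demands one of them. *)
have [y] := infM (x |` (star a x |` (star b x |` D0))).
rewrite !in_fset1U !negb_or => /and4P[yx yax ybx yD].
have ID0 : I D0 by split=> // S _ ->.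
have [D1 [I1 _ x1]] := Pall x D0 ID0; have [D2 [I2 D12 y2]] := Pall y D1 I1.
have [D3 [[_ _ tD] D23 z3]] := Pall (star x y) D2 I2.
rewrite eq_sym in yx; have R := starP stM yx.
have := tD [fset x; y; star x y]; rewrite -hR_triple R !fsubUset !fsub1set z3.
rewrite (fsubsetP D23 _ y2) (fsubsetP D23 _ (fsubsetP D12 _ x1)) => /(_ isT isT).
have neq u v : u \in D0 -> v \notin D0 -> (u == v) = false.
  by move=> uD; apply: contraNF => /eqP <-.
rewrite (negbTE xD) /= !inE !(neq _ _ _ xD) // !(neq _ _ _ yD) //=.
move=> /orP[] /eqP e; move: R; rewrite -e hR_swap23 hR_swap12 => /(hR_star KM stM) e'.
  by rewrite e' eqxx in yax.
by rewrite e' eqxx in ybx.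
Qed.

End Pair.
End Path.

Section Uniform.
Variable M : hstruct.
Hypotheses (KM : forall A : {fset M}, K0 A) (stM : steiner M).
Hypothesis infM : forall S : {fset M}, exists x, x \notin S.

(** M may be uncountable, so both sets of representatives are compared with M: a point is coded by
    its path and its position, and an infinite set absorbs the factor of the natural numbers. *)
Lemma reps_bij (a b a' b' : M) : a != b -> a' != b' ->
  exists f : M -> M, set_bij (reps a b) (reps a' b') f.
Proof.
move=> ab ab'; pose MP : pointedType := HB.pack (Choice.sort M) (isPointed.Build (Choice.sort M) a).
suff le (c d : M) : c != d -> ([set: MP]%classic #<= (reps c d : set MP))%card.
  apply: (@Cantor_Bernstein_bij MP (reps a b) (reps a' b')).
    by apply: card_le_trans (le _ _ ab'); apply: subset_card_le.
  by apply: card_le_trans (le _ _ ab); apply: subset_card_le.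
move=> cd; have inf := reps_infinite KM stM cd infM.
have [j [jr jinj]] := @infinite_times_nat MP (reps c d) inf.
have [t0 rt0] := infinite_setN0 inf.
(* The codes 0, 1 and 2 are reserved for the three points of the line, hence the shift by 3. *)
pose f (x : M) : MP := if pselect (line c d x)
  then j t0 (if x == c then 0%N else if x == d then 1%N else 2%N)
  else j (rep c d x) (choice.pickle (pos KM stM cd x) + 3)%N.
apply/card_le_inj; exists f; split=> [x _|x y _ _]; rewrite /f.
  by case: pselect => [Lx|nL]; apply: jr => //; apply: rep_reps.
case: pselect => [Lx|nx]; case: pselect => [Ly|ny].
- move=> /(jinj _ _ _ _ rt0 rt0)[_].
  have third z : line c d z -> z != c -> z != d -> z = star c d.
    by case=> [[->|->]|//]; rewrite eqxx.
  case: (eqVneq x c) => [->|xc]; case: (eqVneq y c) => [->|yc] //; try by case: ifP.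
  case: (eqVneq x d) => [->|xd]; case: (eqVneq y d) => [->|yd] // _.
  by rewrite (third x) // (third y).
- by move=> /(jinj _ _ _ _ rt0 (rep_reps KM stM cd ny))[_]; do 2?case: ifP => _; rewrite addn3.
- by move=> /(jinj _ _ _ _ (rep_reps KM stM cd nx) rt0)[_]; do 2?case: ifP => _; rewrite addn3.
- move=> /(jinj _ _ _ _ (rep_reps KM stM cd nx) (rep_reps KM stM cd ny))[e1 /addIn].
  move/(pcan_inj choice.pickleK) => e2.
  by rewrite -(walk_pos KM stM cd nx) e1 e2 walk_pos.
Qed.

Lemma line_third (a b s x y : M) : a != b -> line a b x -> x != a -> x != b ->
  (s == a) || (s == b) -> hR s x y -> (y == a) || (y == b).
Proof.
move=> ab [[->|->]|->]; rewrite ?eqxx // => _ _ /orP[] /eqP-> R.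
  apply/orP; right; apply/eqP/esym.
  apply: third_point_unique KM _ R; rewrite hR_swap23; exact: starP.
apply/orP; left; apply/eqP/esym.
by apply: third_point_unique KM _ R; rewrite hR_swap23 hR_swap12; apply: starP.
Qed.

(** Paths are matched by a bijection of representatives and their points by position. The third
    point of the line, the only vertex on it, is isolated and goes to its counterpart. *)
Lemma uniform_of_steiner : uniform M.
Proof.
move=> a b a' b' ab ab'; have [sig [sfun sinj ssurj]] := reps_bij ab ab'.
pose c := star a b; pose c' := star a' b'.
pose g (x : M) := if pselect (line a b x) then c'
  else walk a' b' (sig (rep a b x)) (pos KM stM ab x).
have gL x : line a b x -> g x = c' by rewrite /g; case: pselect.
have gN x : ~ line a b x -> g x = walk a' b' (sig (rep a b x)) (pos KM stM ab x).
  by rewrite /g; case: pselect.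
have rN x : ~ line a b x -> reps a' b' (sig (rep a b x)).
  by move=> nL; apply: sfun; apply: rep_reps.
have gNL x : ~ line a b x -> ~ line a' b' (g x).
  by move=> nL; rewrite gN //; apply: walk_line => //; case: (rN x nL).
(* Off the line an edge is an application of a or b, so commuting with both operations makes g
   preserve and reflect edges. *)
have gS x : ~ line a b x -> g (star a x) = star a' (g x) /\ g (star b x) = star b' (g x).
  move=> nL; have [nLa nLb] := lineN_star KM stM ab nL.
  have [oa ob] := orbit_star KM stM ab nL (orbit_refl a b x).
  have rx := rep_reps KM stM ab nL.
  have [wa wb] := star_walk KM stM ab (pos KM stM ab x) rx.1.
  have [wa' wb'] := star_walk KM stM ab' (pos KM stM ab x) (rN x nL).1.
  rewrite !gN // -(rep_eq KM stM ab nL oa) -(rep_eq KM stM ab nL ob) wa' wb'.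
  by rewrite -[in pos _ _ _ (star a x)](walk_pos KM stM ab nL) wa
    -[in pos _ _ _ (star b x)](walk_pos KM stM ab nL) wb !pos_walk.
have vert (d e x : M) : d != e -> vertices (path_graph d e) x <-> d != x /\ e != x.
  move=> de; rewrite /= icl_pair //; split=> [h|[dx ex] [] e'].
  - by split; apply/eqP => e'; apply: h; rewrite -e'; [left | right].
  - by rewrite e' eqxx in dx.
  - by rewrite e' eqxx in ex.
have vc (d e : M) : d != e -> vertices (path_graph d e) (star d e).
  by move=> de; apply/vert => //; have [_ ? ?] := hR_distinct (starP stM de).
have vL x : vertices (path_graph a b) x -> line a b x -> x = c.
  by move=> /(vert _ _ _ ab)[ax bx] [[e|e]|//]; rewrite e eqxx in ax bx.
have vN (d e x : M) : d != e -> ~ line d e x -> vertices (path_graph d e) x.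
  by move=> de nL; apply/vert => //; apply: line_neq.
have ginj x y : vertices (path_graph a b) x -> vertices (path_graph a b) y ->
    g x = g y -> x = y.
  move=> vx vy; have [Lx|nx] := pselect (line a b x); have [Ly|ny] := pselect (line a b y).
  - by move=> _; rewrite (vL x) // (vL y).
  - by move=> e; case: (gNL y ny); rewrite -e gL //; right.
  - by move=> e; case: (gNL x nx); rewrite e gL //; right.
  rewrite !gN // => e; have r1 := rN x nx; have r2 := rN y ny.
  have e1 : rep a b x = rep a b y.
    apply: sinj; rewrite ?inE; try exact: rep_reps.
    by rewrite -(rep_walk KM stM ab' (pos KM stM ab x) r1) e rep_walk.
  have e2 : pos KM stM ab x = pos KM stM ab y.
    by rewrite -(pos_walk KM stM ab' (pos KM stM ab x) r1) e pos_walk.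
  by rewrite -(walk_pos KM stM ab nx) e1 e2 walk_pos.
have gfun x : vertices (path_graph a b) x -> vertices (path_graph a' b') (g x).
  move=> vx; have [Lx|nx] := pselect (line a b x); first by rewrite gL //; apply: vc.
  by apply: vN => //; apply: gNL.
have edge s s' x y : (s == a) || (s == b) -> (s' == a') || (s' == b') ->
    (forall x, ~ line a b x -> g (star s x) = star s' (g x)) ->
    (forall x, ~ line a b x -> ~ line a b (star s x)) ->
    vertices (path_graph a b) x -> vertices (path_graph a b) y ->
    hR s x y <-> hR s' (g x) (g y).
  move=> sab sab' gs sN vx vy.
  have [Lx|nx] := pselect (line a b x).
    have bad (d e u v w : M) : d != e -> line d e u -> (w == d) || (w == e) ->
        vertices (path_graph d e) u -> vertices (path_graph d e) v -> ~ hR w u v.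
      move=> de Lu wde /(vert _ _ _ de)[du eu] /(vert _ _ _ de)[dv ev] R.
      have := line_third de Lu _ _ wde R; rewrite ![u == _]eq_sym du eu ![v == _]eq_sym.
      by rewrite (negbTE dv) (negbTE ev) => /(_ isT isT).
    split=> R; first by case: (bad a b x y s).
    case: (bad a' b' (g x) (g y) s') => //; try exact: gfun.
    by rewrite gL //; right.
  have sx : s != x by case/orP: sab => /eqP ->; case: (line_neq nx).
  have sx' : s' != g x by case/orP: sab' => /eqP ->; case: (line_neq (gNL x nx)).
  split=> [/(hR_star KM stM) ->|/(hR_star KM stM)]; first by rewrite gs //; apply: starP.
  rewrite -gs // => /ginj -> //; first exact: starP.
  by apply: vN => //; apply: sN.
exists g; split.
  split=> [x /gfun //|x y|y vy]; first by rewrite !inE; apply: ginj.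
  have [Ly|ny] := pselect (line a' b' y).
    exists c; first exact: vc.
    rewrite gL; last by right.
    by move: vy => /(vert _ _ _ ab')[ay by_]; case: Ly => [[e|e]|//]; rewrite e eqxx in ay by_.
  have ry := rep_reps KM stM ab' ny.
  have [t rt et] := ssurj _ ry.
  have nw := walk_line KM stM ab (i := pos KM stM ab' y) rt.1.
  exists (walk a b t (pos KM stM ab' y)); first exact: vN.
  by rewrite gN // rep_walk // pos_walk // et walk_pos.
move=> x y vx vy; split; apply: edge => //; rewrite ?eqxx ?orbT // => z nz.
- by case: (gS z nz).
- by case: (lineN_star KM stM ab nz).
- by case: (gS z nz).
- by case: (lineN_star KM stM ab nz).
Qed.

End Uniform.

Local Open Scope classical_set_scope.

Theorem fact5p3p2 (mu : mu_function) (G : hstruct) (hG : is_generic mu G)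
    (M : hstruct) (hM : models M (theory G)) :
  [/\ strongly_minimal M, steiner M & uniform M] /\
  forall a b : M, a != b ->
    acl [set a; b] = line a b /\
    forall d : M, ~ line a b d -> infinite_cycle a b d.
Proof.
have KM (A : {fset M}) : K0 A := @model_K0 mu G hG M hM A.
have stM := model_steiner hG hM.
have infM := model_infinite hG hM.
split; last first.
  move=> a b ab; split; first by exact: (acl_line hG hM ab).
  by move=> d; apply: no_finite_cycle.
split=> //; last exact: uniform_of_steiner.
split=> [/finite_fsetP[S eS]|N eNM n phi v].
  have [x] := infM S; have : [set` S] x by rewrite -eS.
  by move=> /= ->.
have hN : models N (theory G).
  by move=> psi /hM h; have : theory N psi by rewrite eNM.
exact: (model_definable hG hN phi v).
Qed.
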